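(* Let $k\ge1$. There exist positive constants $\beta$ and $h_0$ such that for all $h<h_0$ and all $\boldsymbol{u}_h\in V_h^k$, $$\beta\,|||\boldsymbol{u}_h|||\le\sup_{\boldsymbol{v}_h\in V_h^k}\frac{A_h(\boldsymbol{u}_h,\boldsymbol{v}_h)}{|||\boldsymbol{v}_h|||}.$$
   Context: $\Omega\subset\mathbb{R}^2$ is a convex bounded domain with polygonal boundary $\partial\Omega=\cup_i\Gamma_i$ ($\Gamma_i$ the sides) and outward unit normal $\boldsymbol{n}$; $\mu,\lambda>0$ are constants; $\boldsymbol{\varepsilon}(\boldsymbol{u})=\frac12(\nabla\boldsymbol{u}+\nabla\boldsymbol{u}^{\rm T})$; $V=[H^1(\Omega)]^2$. $\{\mathcal{T}_h\}_h$ is a quasi-uniform, shape regular family of triangulations fitted to $\Omega$: with $h_K=\mathrm{diam}(K)$ and $\rho_K$ the radius of the largest inscribed circle of $K$, $h_K/\rho_K\le c_\rho$ for all $K\in\mathcal{T}_h$, and $h=\max_K h_K$. $V_h^k=\{\boldsymbol{v}\in V:\boldsymbol{v}|_K\in[\mathbb{P}_k(K)]^2\ \forall K\in\mathcal{T}_h\}$. Standing mesh assumption: the boundary elements (those with a face or a vertex on $\partial\Omega$) can be grouped into closed disjoint patches $P_j$ (each boundary element in exactly one patch), each with at least two elements and a number of elements bounded in terms of $c_\rho$ and sufficiently large compared to $c_\rho$, such that with $F_j=\partial P_j\cap\partial\Omega$ one has $c_1h\le\mathrm{meas}(F_j)\le c_2h$ and every side $\Gamma_i$ is partitioned by at least one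 $F_j$. Forms ($L^2$ inner products $(\cdot,\cdot)_\Omega$, $\langle\cdot,\cdot\rangle_{\partial\Omega}$; $\|\cdot\|_\Theta$ the $L^2(\Theta)$-norm): $a(\boldsymbol{u},\boldsymbol{v})=(2\mu\boldsymbol{\varepsilon}(\boldsymbol{u}),\boldsymbol{\varepsilon}(\boldsymbol{v}))_\Omega+(\lambda\nabla\cdot\boldsymbol{u},\nabla\cdot\boldsymbol{v})_\Omega$, $b(\boldsymbol{u},\boldsymbol{v})=\langle2\mu\boldsymbol{\varepsilon}(\boldsymbol{u})\cdot\boldsymbol{n},\boldsymbol{v}\rangle_{\partial\Omega}+\langle\lambda\nabla\cdot\boldsymbol{u},\boldsymbol{v}\cdot\boldsymbol{n}\rangle_{\partial\Omega}$, $A_h(\boldsymbol{u},\boldsymbol{v})=a(\boldsymbol{u},\boldsymbol{v})-b(\boldsymbol{u},\boldsymbol{v})+b(\boldsymbol{v},\boldsymbol{u})$. Triple norm: $|||\boldsymbol{w}|||^2=\mu\big(\|\nabla\boldsymbol{w}\|_\Omega^2+\|h^{-1/2}\boldsymbol{w}\|_{\partial\Omega}^2\big)+\lambda\big(\|\nabla\cdot\boldsymbol{w}\|_\Omega^2+\|h^{-1/2}\boldsymbol{w}\cdot\boldsymbol{n}\|_{\partial\Omega}^2\big)$. The constants $\beta,h_0$ may depend on $\mu,\lambda$, $k$, $\Omega$ and the mesh family's regularity, but not on $h$ or $\boldsymbol{u}_h$; the supremum is over nonzero $\boldsymbol{v}_h$. *)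

(* Defs.v *)
From HB Require Import structures.
From mathcomp Require Import all_boot all_order all_algebra.
From mathcomp Require Import all_classical all_reals all_analysis.

Set Implicit Arguments.
Unset Strict Implicit.
Unset Printing Implicit Defensive.

Import Order.TTheory GRing.Theory Num.Theory.
Import numFieldNormedType.Exports.

Local Open Scope classical_set_scope.
Local Open Scope ring_scope.

(** Points of the plane are pairs, so that the product measure applies; the
    values of vector fields are column vectors. *)

Section PlaneGeometry.
Context {R : realType}.
Implicit Types (x y : R * R) (A : set (R * R)).

Definition enorm x : R := Num.sqrt (x.1 ^+ 2 + x.2 ^+ 2).

Definition cross x y : R := x.1 * y.2 - x.2 * y.1.

Definition unit_vec (j : 'I_2) : R * R := ((j == 0)%:R, (j == 1)%:R).

Definition frontier A : set (R * R) := closure A `\` interior A.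

Definition diam A : R := sup [set d | exists x y, [/\ A x, A y & d = enorm (x - y)]].

Definition inradius A : R :=
  sup [set r | 0 <= r /\ exists c, forall x, enorm (x - c) <= r -> A x].

Definition area : set (measurableTypeR R * measurableTypeR R) -> \bar R :=
  (lebesgue_measure \x lebesgue_measure)%E.
HB.instance Definition _ := Measure.on area.

End PlaneGeometry.

Section ColumnVectors.
Context {R : realType}.

Definition dot (a b : 'cV[R]_2) : R := \sum_i a i 0 * b i 0.

Definition frob (A B : 'M[R]_2) : R := \sum_i \sum_j A i j * B i j.

End ColumnVectors.

Section Polygon.
Context {R : realType} {m : nat} (V : 'I_m -> R * R).

Definition side_vec (i : 'I_m) : R * R := V (ordS i) - V i.

Definition side_param (i : 'I_m) (t : R) : R * R := V i + t *: side_vec i.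

Definition side (i : 'I_m) : set (R * R) := side_param i @` `[0, 1].

(** [V] lists the corners counterclockwise; [ordS] is the cyclic successor.
    The last condition makes every [V i] a genuine corner, so that the
    [side i] are the maximal segments of the boundary. *)
Definition convex_polygonal_domain (Om : set (R * R)) : Prop :=
  [/\ open Om, Om !=set0,
      convex_set (Om : set (convex_lmodType (R * R)%type)) & bounded_set Om] /\
  [/\ frontier Om = \bigcup_(i in [set: 'I_m]) side i,
      injective V,
      forall i x, Om x -> 0 < cross (side_vec i) (x - V i) &
      forall i, cross (side_vec i) (side_vec (ordS i)) != 0].

(** Unit normal of side [i]; outward because the domain lies to the left. *)
Definition normal (i : 'I_m) : 'cV[R]_2 :=
  (enorm (side_vec i))^-1 *:
    \col_(j < 2) (if j == 0 then (side_vec i).2 else - (side_vec i).1).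

(** Arc length integral over the boundary. The integrand also depends on the
    side, since the normal does. *)
Definition bint (f : 'I_m -> R * R -> R) : R :=
  \sum_i enorm (side_vec i) *
    (\int[lebesgue_measure]_(t in `[0, 1]) f i (side_param i t)).

Definition bmeas (F : set (R * R)) : R := bint (fun _ x => \1_F x).

End Polygon.

Section Sobolev.
Context {R : realType} (Om : set (R * R)).
Implicit Types f g phi : R * R -> R.

Definition partial (j : 'I_2) f : R * R -> R := fun x => 'D_(unit_vec j) f x.

Definition smooth phi : Prop :=
  forall s : seq 'I_2, let psi := foldr partial phi s in
    continuous psi /\ forall j x, derivable psi x (unit_vec j).

Definition test_function phi : Prop :=
  smooth phi /\
  exists C : set (R * R), [/\ compact C, C `<=` Om & forall x, ~ C x -> phi x = 0].

Definition L2 f : Prop :=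
  measurable_fun (Om : set (measurableTypeR R * measurableTypeR R)) f /\
  area.-integrable Om (fun x => (f x ^+ 2)%:E).

Definition weak_partial (j : 'I_2) f g : Prop :=
  forall phi, test_function phi ->
    \int[area]_(x in Om) (f x * partial j phi x) =
    - \int[area]_(x in Om) (g x * phi x).

Definition H1 f : Prop :=
  L2 f /\ forall j, exists2 g, L2 g & weak_partial j f g.

End Sobolev.

Section Triangulation.
Context {R : realType} {m : nat} (V : 'I_m -> R * R) (Om : set (R * R)).
Context {n : nat} (T : 'I_n -> 'I_3 -> R * R).

Definition face (p : 'I_3 -> R * R) (S : {set 'I_3}) : set (R * R) :=
  [set x | exists w : 'I_3 -> R,
     [/\ forall a, 0 <= w a, forall a, a \notin S -> w a = 0,
         \sum_a w a = 1 & x = \sum_a w a *: p a]].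

Definition elt (K : 'I_n) : set (R * R) := face (T K) [set: 'I_3]%SET.

(** Conformity: distinct elements meet in a common vertex, a common edge, or
    not at all ([face p set0] is empty). *)
Definition triangulation : Prop :=
  [/\ forall K, cross (T K 1 - T K 0) (T K 2%:R - T K 0) != 0,
      \bigcup_(K in [set: 'I_n]) elt K = closure Om &
      forall K L, K != L -> exists S S' : {set 'I_3},
        [/\ S \proper [set: 'I_3]%SET, S' \proper [set: 'I_3]%SET,
            elt K `&` elt L = face (T K) S & elt K `&` elt L = face (T L) S']].

Definition meshsize : R := \big[Num.max/0]_(K < n) diam (elt K).

Definition shape_regular (c_rho : R) : Prop :=
  forall K, diam (elt K) / inradius (elt K) <= c_rho.

Definition quasi_uniform (c_qu : R) : Prop :=
  forall K, meshsize <= c_qu * diam (elt K).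

(** An element with a face on the boundary has a vertex there as well. *)
Definition boundary_elements : {set 'I_n} :=
  [set K | `[< exists a, frontier Om (T K a) >]].

Definition patch (B : {set 'I_n}) : set (R * R) :=
  \bigcup_(K in [set` B]) elt K.

Definition patch_trace (B : {set 'I_n}) : set (R * R) :=
  frontier (patch B) `&` frontier Om.

(** Patches are closed sets of triangles and may touch; "disjoint" means that
    they share no element. Likewise the pieces partitioning a side overlap
    only in sets of length zero. *)
Definition patch_assumption (n_min n_max : nat) (c_1 c_2 : R) : Prop :=
  exists P : {set {set 'I_n}},
    [/\ finset.partition P boundary_elements,
        forall B, B \in P ->
          (2 <= #|B|)%N /\ (n_min <= #|B| <= n_max)%N,
        forall B, B \in P ->
          c_1 * meshsize <= bmeas V (patch_trace B) <= c_2 * meshsize &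
        forall i : 'I_m, exists J : {set {set 'I_n}},
          [/\ J \subset P, J != finset.set0,
              side V i = \bigcup_(B in [set` J]) patch_trace B &
              forall B B', B \in J -> B' \in J -> B != B' ->
                bmeas V (patch_trace B `&` patch_trace B') = 0]].

Definition poly_on (k : nat) (A : set (R * R)) (f : R * R -> R) : Prop :=
  exists c : nat -> nat -> R, forall x, A x ->
    f x = \sum_(i < k.+1) \sum_(j < k.+1 | (i + j <= k)%N)
            c i j * x.1 ^+ i * x.2 ^+ j.

(** A class of [H1] with polynomial restrictions is represented by the function
    that agrees with its polynomial on every closed element, the continuous
    representative; in particular its boundary trace is its restriction. *)
Definition Vh (k : nat) (v : R * R -> 'cV[R]_2) : Prop :=
  forall i : 'I_2, H1 Om (fun x => v x i 0) /\
    forall K, poly_on k (elt K) (fun x => v x i 0).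

(** Two elements of [Vh] are identified when they agree on the closure. *)
Definition nonzero (v : R * R -> 'cV[R]_2) : Prop :=
  exists2 x, closure Om x & v x != 0.

End Triangulation.

Section Forms.
Context {R : realType} {m : nat} (V : 'I_m -> R * R) (Om : set (R * R)).
Context (mu lam h : R).
Implicit Types (u v w : R * R -> 'cV[R]_2).

(** For piecewise polynomial fields in [H1] the classical derivatives exist in
    the interior of every element, and are the weak ones almost everywhere. *)
Definition grad u (x : R * R) : 'M[R]_2 :=
  \matrix_(i < 2, j < 2) partial j (fun y => u y i 0) x.

(** Boundary values of the gradient, as limits from inside the domain; for a
    piecewise polynomial field they exist except at finitely many points. *)
Definition trace_grad u (x : R * R) : 'M[R]_2 :=
  \matrix_(i < 2, j < 2) lim (grad u y i j @[y --> within Om (nbhs x)]).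

Definition sym (G : 'M[R]_2) : 'M[R]_2 := 2^-1 *: (G + G^T).

Definition strain u x := sym (grad u x).

Definition div u x : R := \tr (grad u x).

Definition trace_strain u x := sym (trace_grad u x).

Definition trace_div u x : R := \tr (trace_grad u x).

Definition form_a u v : R :=
  \int[area]_(x in Om) (2 * mu * frob (strain u x) (strain v x)) +
  \int[area]_(x in Om) (lam * div u x * div v x).

Definition form_b u v : R :=
  bint V (fun i x => 2 * mu * dot (trace_strain u x *m normal V i) (v x)) +
  bint V (fun i x => lam * trace_div u x * dot (v x) (normal V i)).

Definition form_A u v : R := form_a u v - form_b u v + form_b v u.

Definition triple_norm w : R := Num.sqrt
  (mu * (\int[area]_(x in Om) frob (grad w x) (grad w x) +
         bint V (fun _ x => h^-1 * dot (w x) (w x))) +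
   lam * (\int[area]_(x in Om) (div w x ^+ 2) +
          bint V (fun i x => h^-1 * dot (w x) (normal V i) ^+ 2))).

End Forms.

(* Main.v *)
From HB Require Import structures.
Require Import Defs.
From mathcomp Require Import all_boot all_order all_algebra.
From mathcomp Require Import all_classical all_reals all_analysis.
From mathcomp Require Import measurable_realfun.
From mathcomp Require Import ring lra.

(** The stabilizing mechanism is that the nonsymmetric form controls the energy
    of [u] by itself, [A_h (u, u) = a (u, u)], since the two boundary forms
    cancel, while control of the boundary values is obtained from a second test
    field. For an element with an edge on the boundary, the vertex opposite to
    this edge is an interior point ([apex_interior]). Let [w] be the continuous
    piecewise affine field with the value [- u] at these vertices and zero at all
    others. It vanishes on the boundary, so that [b (u, w) = 0], and on each
    boundary element its gradient is normal to the boundary edge with size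
    [|u| / h] up to the oscillation of [u] on the element. Therefore [b (w, u)]
    bounds the boundary terms of the squared norm of [u] from above, up to a
    multiple of the squared gradient of [u] ([penalty_bound]), and the energy of
    [w] is bounded by the same terms ([test_norm]).

    The strain controls the gradient only together with the boundary values.
    The inequality used here, [korn_boundary], comes from the identity
    [|grad u|^2 = 2 |eps u|^2 - (div u)^2 + 2 det (grad u)] and from the fact
    that the integral of the determinant is a boundary integral of
    [u_1 u_2' - u_2 u_1'] along the sides ([jacobian_boundary]). On a straight
    side this integrand is, up to a derivative, the product of the normal
    component with the derivative of the tangential component, and the latter
    is a strain; the corner values left by the derivative are recovered from the
    tangential components along the two sides that meet there. By the inverse
    inequality the boundary strain is at most [h^{-1}] times the energy, whence
    [|grad u|^2 <= C |eps u|^2 + (delta / h) |u|^2] in the integrated sense for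
    every [delta >= h], with a constant depending on [delta] but not on the mesh.

    With [v = u + alpha w] and first [delta], then [alpha] small
    ([test_choice]), [A_h (u, v)] bounds the squared norm of [u] from above and
    the norms of [u] and [v] are comparable.

    All integrals are reduced to polynomials. Integrals over the domain become
    sums over the open elements and integrals over a side become sums over the
    boundary edges, because vertices and mesh lines are null sets
    ([Om_integral], [side_integral]). An edge is represented by an element with
    one of its vertices, the opposite one, called the apex; sums over all such
    pairs of a quantity that changes sign between the two elements sharing an
    edge reduce to the boundary ([flag_sum]). This cancellation gives both the
    membership of piecewise polynomials in [H1] ([piecewise_H1]) and the
    determinant identity. Shape regularity and quasi-uniformity are used through
    the discs of [inscribed_disc] only; they yield a uniform inverse inequality
    ([inverse_mesh]), bounds for heights and edges, and a bound for the number
    of elements that meet at a vertex ([vertex_count]). *)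

Import Order.TTheory GRing.Theory Num.Theory.
Import numFieldNormedType.Exports.
Set Implicit Arguments.
Unset Strict Implicit.
Unset Printing Implicit Defensive.
Local Open Scope classical_set_scope.
Local Open Scope ring_scope.

(** * Integrals and null sets *)

Section NullSets.
Local Open Scope ereal_scope.
Context d (T : measurableType d) (R : realType).
Variable mu : {measure set T -> \bar R}.
Import HBNNSimple.

Let nn_le_off_null (N : set T) (f g : T -> \bar R) :
  measurable N -> mu N = 0 -> (forall x, 0 <= f x) -> (forall x, 0 <= g x) ->
  (forall x, ~ N x -> f x = g x) -> \int[mu]_x f x <= \int[mu]_x g x.
Proof.
move=> mN N0 f0 g0 fg.
rewrite !ge0_integralTE//; apply: ge_ereal_sup => _ [h /= hf <-].
rewrite -integralT_nnsfun (@ge0_negligible_integral _ _ _ mu setT N) //; last 2 first.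
- exact/measurable_EFinP.
- by move=> x _; rewrite lee_fin.
rewrite setTD integral_nnsfun; last exact: measurableC.
have mNC : measurable (~` N) by exact: measurableC.
apply: ereal_sup_ubound; exists (proj_nnsfun h mNC) => /=; last first.
  congr (sintegral mu _); apply/funext => x; rewrite /= mindicE patchE.
  by case: ifPn => _; rewrite ?mulr1 ?mulr0.
move=> x; rewrite mindicE; case: (boolP (x \in _)) => [|_].
  by rewrite inE => /fg <-; rewrite mulr1.
by rewrite mulr0.
Qed.

(** Simple functions do not see null sets, and the integral is defined by them
    for every function: no measurability is involved. *)
Lemma integral_off_null (N D : set T) (f g : T -> \bar R) :
  measurable N -> mu N = 0 -> (forall x, D x -> ~ N x -> f x = g x) ->
  \int[mu]_(x in D) f x = \int[mu]_(x in D) g x.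
Proof.
move=> mN N0 fg; rewrite integral_mkcond [RHS]integral_mkcond.
have fg' x : ~ N x -> (f \_ D) x = (g \_ D) x.
  move=> Nx; rewrite !patchE; case: ifPn => //; rewrite inE => Dx.
  exact: fg.
rewrite [LHS]integralE [RHS]integralE; congr (_ - _); apply/eqP; rewrite eq_le;
  apply/andP; split; apply: (nn_le_off_null mN N0) => //;
  by move=> x Nx; rewrite ?funeposE ?funenegE fg'.
Qed.

End NullSets.

Lemma Rintegral_off_null d (T : measurableType d) (R : realType)
    (mu : {measure set T -> \bar R}) (N D : set T) (f g : T -> R) :
  measurable N -> mu N = 0%E -> (forall x, D x -> ~ N x -> f x = g x) ->
  \int[mu]_(x in D) f x = \int[mu]_(x in D) g x.
Proof.
move=> mN N0 fg; congr fine; apply: (integral_off_null mN N0) => x Dx Nx.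
by rewrite fg.
Qed.

(** * Measurability and continuity *)

Section PlaneMeasurability.
Context {R : realType}.
Local Notation P := (measurableTypeR R * measurableTypeR R)%type.

Lemma open_measurable2 (U : set (R * R)) : open U -> measurable (U : set P).
Proof.
move=> oU.
pose box (q : rat * rat * (rat * rat)) : set (R * R) :=
  `]ratr q.1.1, ratr q.1.2[%classic `*` `]ratr q.2.1, ratr q.2.2[%classic.
have -> : U = \bigcup_(q in [set q | box q `<=` U]) box q.
  apply/seteqP; split => [x Ux|x [q /= qU /qU//]].
  have : nbhs x U by exact: open_nbhs_nbhs.
  move=> /(@nbhs_ballP R)[e /= e0 eU].
  have [a /itvP aP] := @rat_in_itvoo R (x.1 - e) x.1 ltac:(by rewrite ltrBlDr ltrDl).
  have [b /itvP bP] := @rat_in_itvoo R x.1 (x.1 + e) ltac:(by rewrite ltrDl).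
  have [c /itvP cP] := @rat_in_itvoo R (x.2 - e) x.2 ltac:(by rewrite ltrBlDr ltrDl).
  have [d' /itvP dP] := @rat_in_itvoo R x.2 (x.2 + e) ltac:(by rewrite ltrDl).
  exists (a, b, (c, d')) => /=; last first.
    by split; rewrite /= in_itv/= ?aP ?bP ?cP ?dP.
  move=> y [/=]; rewrite !in_itv/= => /andP[y1 y2] /andP[y3 y4].
  apply: eU; split => /=; rewrite /ball/= ltr_distlC.
    by rewrite (lt_trans _ y1) ?aP// (lt_trans y2) ?bP.
  by rewrite (lt_trans _ y3) ?cP// (lt_trans y4) ?dP.
rewrite bigcup_mkcond; apply: countable_bigcupT_measurable.
  exact: countableP.
move=> q; case: ifPn => // _.
by apply: measurableX; exact: measurable_itv.
Qed.

Lemma continuous_measurable2 (f : R * R -> R) : continuous f ->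
  measurable_fun setT (f : P -> measurableTypeR R).
Proof.
move=> cf; apply: (measurability _ (RGenOInfty.measurableE R)).
move=> _ [_ [a ->] <-]; rewrite setTI; apply: open_measurable2.
by apply: open_comp => // x _; exact: cf.
Qed.

Lemma closed_measurable2 (F : set (R * R)) : closed F -> measurable (F : set P).
Proof.
move=> cF; rewrite -[F]setCK; apply: measurableC.
by apply: open_measurable2; rewrite openC.
Qed.

End PlaneMeasurability.

Section ContinuityRules.
Context {R : realType} {T : topologicalType}.
Implicit Types f g : T -> R.

Lemma ct_cst (c : R) : continuous (fun _ : T => c).
Proof. by move=> x; exact: cvg_cst. Qed.

Lemma ct_add f g : continuous f -> continuous g -> continuous (fun x => f x + g x).
Proof. by move=> cf cg x; apply: cvgD; [exact: cf|exact: cg]. Qed.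

Lemma ct_mul f g : continuous f -> continuous g -> continuous (fun x => f x * g x).
Proof. by move=> cf cg x; apply: cvgM; [exact: cf|exact: cg]. Qed.

Lemma ct_opp f : continuous f -> continuous (fun x => - f x).
Proof. by move=> cf x; apply: cvgN; exact: cf. Qed.

Lemma ct_exp f n : continuous f -> continuous (fun x => f x ^+ n).
Proof.
move=> cf; elim: n => [|n IH]; first by under eq_fun do rewrite expr0; move=> x; exact: cvg_cst.
by under eq_fun do rewrite exprS; exact: ct_mul.
Qed.

Lemma ct_sum (I : Type) (s : seq I) (p : pred I) (F : I -> T -> R) :
  (forall i, continuous (F i)) -> continuous (fun x => \sum_(i <- s | p i) F i x).
Proof.
move=> cF; elim: s => [|i s IH].
  by under eq_fun do rewrite big_nil; move=> x; exact: cvg_cst.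
have [pi|pi] := boolP (p i); under eq_fun do rewrite big_cons ?pi ?(negbTE pi);
  [exact: ct_add|exact: IH].
Qed.

Lemma ct_comp (U : topologicalType) (f : U -> R) (g : T -> U) :
  continuous f -> continuous g -> continuous (fun x => f (g x)).
Proof. by move=> cf cg x; apply: continuous_comp; [exact: cg|exact: cf]. Qed.

Lemma ct_id (U : topologicalType) : continuous (fun x : U => x).
Proof. by move=> x; exact: cvg_id. Qed.

Lemma ct_fst (U W : topologicalType) : continuous (@fst U W).
Proof. by move=> x; exact: cvg_fst. Qed.

Lemma ct_snd (U W : topologicalType) : continuous (@snd U W).
Proof. by move=> x; exact: cvg_snd. Qed.

End ContinuityRules.

Lemma continuous_pair (T U W : topologicalType) (f : T -> U) (g : T -> W) :
  continuous f -> continuous g -> continuous (fun t => (f t, g t)).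
Proof.
by move=> cf cg x; apply: (@cvg_pair _ _ _ _ (nbhs (f x)) (nbhs (g x))); [exact: cf|exact: cg].
Qed.

Ltac continuity :=
  rewrite /=;
  lazymatch goal with
  | |- continuous (fun x => x) => exact (@ct_id _)
  | |- continuous (fun x => @fst _ _ x) => exact (@ct_fst _ _)
  | |- continuous (fun x => @snd _ _ x) => exact (@ct_snd _ _)
  | |- continuous (fun x => Algebra.add (@?f x) (@?g x)) =>
      refine (@ct_add _ _ f g _ _); continuity
  | |- continuous (fun x => GRing.mul (@?f x) (@?g x)) =>
      refine (@ct_mul _ _ f g _ _); continuity
  | |- continuous (fun x => Algebra.opp (@?f x)) =>
      refine (@ct_opp _ _ f _); continuity
  | |- continuous (fun x => GRing.exp (@?f x) ?n) =>
      refine (@ct_exp _ _ f n _); continuity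
  | |- continuous (fun x => @pair _ _ (@?f x) (@?g x)) =>
      refine (@continuous_pair _ _ _ f g _ _); continuity
  | |- continuous (fun x => ?f (@?g x)) =>
      first [ solve [auto] | exact (@ct_cst _ _ _)
            | refine (@ct_comp _ _ _ f g _ _); [solve [auto]|continuity] ]
  | _ => first [ solve [auto] | exact (@ct_cst _ _ _) ]
  end.

(** * Integrals of continuous functions *)

Section Integrals.
Context {R : realType}.
Local Notation P := (measurableTypeR R * measurableTypeR R)%type.
Local Notation leb := (@lebesgue_measure R).
Implicit Types (a b c : R) (f g F : R -> R) (Phi Psi : R * R -> R) (A : set (R * R)).

Definition sqbox (M : R) : set (R * R) := `[- M, M] `*` `[- M, M].

Definition inbox A := exists M, A `<=` sqbox M.

Lemma sqbox_bounds M x : sqbox M x -> `|x.1| <= M /\ `|x.2| <= M.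
Proof. by rewrite /sqbox/= !in_itv/= !ler_norml. Qed.

Lemma measurable_sqbox M : measurable (sqbox M : set P).
Proof. by apply: measurableX; exact: measurable_itv. Qed.

Lemma bounded_on_sqbox Phi M : continuous Phi ->
  exists B, forall x, sqbox M x -> `|Phi x| <= B.
Proof.
move=> cPhi.
have cS : compact (sqbox M) by apply: compact_setX; exact: segment_compact.
have cI : compact (Phi @` sqbox M).
  by apply: continuous_compact => //; exact: continuous_subspaceT.
have /(@compact_bounded R R)[B [_ hB]] := cI.
exists (B + 1) => x Mx; apply: (hB (B + 1)); first by rewrite ltrDl.
by exists x.
Qed.

Lemma area_box_lt A : measurable (A : set P) -> inbox A -> (area A < +oo)%E.
Proof.
move=> mA [M AM]; apply: (@le_lt_trans _ _ (area (sqbox M : set P))).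
  by apply: le_measure => //; rewrite inE//; exact: measurable_sqbox.
rewrite /area /sqbox product_measure1E; try exact: measurable_itv.
rewrite /= !lebesgue_measure_itv/=; case: ifPn => _; last by rewrite mule0.
by rewrite -EFinM ltry.
Qed.

Lemma integrable_area Phi A : measurable (A : set P) -> inbox A ->
  continuous Phi -> area.-integrable A (EFin \o (Phi : P -> R)).
Proof.
move=> mA bA cPhi; apply: measurable_bounded_integrable => //.
- exact: area_box_lt.
- by apply: measurable_funS (continuous_measurable2 cPhi).
have [M AM] := bA; have [B hB] := bounded_on_sqbox M cPhi.
exists B; split; first exact: num_real.
by move=> z Bz x /AM /hB /le_trans; apply; exact: ltW.
Qed.

Lemma integrable_itv f a b : continuous f ->
  leb.-integrable `[a, b] (EFin \o (f : measurableTypeR R -> R)).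
Proof.
move=> cf; apply: continuous_compact_integrable; first exact: segment_compact.
exact: continuous_subspaceT.
Qed.

Lemma Rintegral_sum d (T : measurableType d) (mu : {measure set T -> \bar R})
    (D : set T) (I : Type) (s : seq I) (p : pred I) (F : I -> T -> R) :
  measurable D -> (forall i, mu.-integrable D (EFin \o F i)) ->
  \int[mu]_(x in D) (\sum_(i <- s | p i) F i x) =
  \sum_(i <- s | p i) \int[mu]_(x in D) F i x /\
  mu.-integrable D (EFin \o (fun x => \sum_(i <- s | p i) F i x)).
Proof.
move=> mD iF; elim: s => [|i s [IH1 IH2]].
  rewrite big_nil; split.
    under eq_Rintegral do rewrite big_nil.
    by rewrite Rintegral_cst// mul0r.
  rewrite (_ : _ \o _ = cst 0%E); first exact: integrable0.
  by apply/funext => x; rewrite /= big_nil.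
have [pi|pi] := boolP (p i); last first.
  rewrite big_cons (negbTE pi); split.
    by under eq_Rintegral do rewrite big_cons (negbTE pi).
  rewrite (_ : _ \o _ = (EFin \o fun x => \sum_(j <- s | p j) F j x))//.
  by apply/funext => x; rewrite /= big_cons (negbTE pi).
have E x : \sum_(j <- i :: s | p j) F j x = F i x + \sum_(j <- s | p j) F j x.
  by rewrite big_cons pi.
split.
  under eq_Rintegral do rewrite E.
  by rewrite RintegralD// big_cons pi IH1.
pose S x := \sum_(j <- s | p j) F j x.
rewrite (_ : _ \o _ = ((EFin \o F i) \+ (EFin \o S))%E).
  exact: integrableD.
by apply/funext => x; rewrite /= E.
Qed.

Lemma FTC f F a b : a <= b -> continuous f ->
  (forall x : R, is_derive x 1 F (f x)) ->
  \int[leb]_(x in `[a, b]) f x = F b - F a.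
Proof.
move=> + cf dF; rewrite le_eqVlt => /predU1P[<-|ab].
  by rewrite set_itv1 Rintegral_set1 subrr.
have cF : continuous F.
  by move=> x; apply: differentiable_continuous; apply/derivable1_diffP.
rewrite /Rintegral (@continuous_FTC2 R f F a b)//.
- exact: continuous_subspaceT.
- split => //.
  + by apply: cvg_at_right_filter; exact: cF.
  + by apply: cvg_at_left_filter; exact: cF.
- by move=> x _; rewrite derive1E; exact: derive_val.
Qed.

Lemma Rintegral_itv_split f a b c : a <= b -> b <= c -> continuous f ->
  \int[leb]_(x in `[a, c]) f x =
  \int[leb]_(x in `[a, b]) f x + \int[leb]_(x in `[b, c]) f x.
Proof.
move=> ab bc cf.
have := @Rintegral_itvB R f (BLeft a) (BRight c) b (integrable_itv _ _ cf) ab bc.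
move=> /eqP; rewrite subr_eq => /eqP ->.
rewrite addrC (@Rintegral_itv_obnd_cbnd _ _ (BRight c))//.
apply: (integrableS _ _ _ (integrable_itv b c cf)) => //.
by apply: subset_itvr; rewrite bnd_simp.
Qed.

Lemma Rintegral_le_itv f g a b : continuous f -> continuous g ->
  (forall x, a <= x <= b -> f x <= g x) ->
  \int[leb]_(x in `[a, b]) f x <= \int[leb]_(x in `[a, b]) g x.
Proof.
move=> cf cg fg; apply: le_Rintegral;
  [exact: measurable_itv|exact: integrable_itv|exact: integrable_itv|].
by move=> x /=; rewrite in_itv/=; exact: fg.
Qed.

Lemma Rintegral_affine f a b : a <= b -> continuous f ->
  \int[leb]_(x in `[a, b]) f x =
  (b - a) * \int[leb]_(t in `[0, 1]) f (a + t * (b - a)).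
Proof.
rewrite le_eqVlt => /predU1P[<-|ab] cf.
  by rewrite set_itv1 Rintegral_set1 subrr mul0r.
pose F t := a + t * (b - a).
have cF : continuous F by rewrite /F; continuity.
have dF (x : R) : is_derive x 1 F (b - a).
  rewrite /F -[b - a]add0r; apply: is_deriveD.
  rewrite (_ : (fun t => _) = (fun t => t) * cst (0 + (b - a))); last first.
    by apply/funext => t; rewrite /= add0r.
  by apply: is_derive_eq; rewrite /= scaler0 add0r add0r /GRing.scale/= mulr1.
have F' : derive1 F = cst (b - a).
  by apply/funext => x; rewrite derive1E; exact: derive_val.
have ba0 : 0 < b - a by rewrite subr_gt0.
have := @integration_by_substitution_increasing R F f 0 1 ler01.
have F0 : F 0 = a by rewrite /F mul0r addr0.
have F1 : F 1 = b by rewrite /F mul1r addrC subrK.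
rewrite F' F0 F1 => sub.
rewrite -RintegralZl//; last by apply: integrable_itv; continuity.
rewrite /Rintegral sub//.
- by congr fine; apply: eq_integral => x _; rewrite /= mulrC.
- by move=> x y _ _ xy; rewrite ltrD2l ltr_pM2r.
- by move=> x _; exact: cvg_cst.
- exact: is_cvg_cst.
- exact: is_cvg_cst.
- split => //.
  + by apply: cvg_at_right_filter; exact: cF.
  + by apply: cvg_at_left_filter; exact: cF.
- exact: continuous_subspaceT.
Qed.

Lemma Rintegral_flip f : continuous f ->
  \int[leb]_(t in `[0, 1]) f (1 - t) = \int[leb]_(t in `[0, 1]) f t.
Proof.
move=> cf.
have E : 0 <= (1 : R) <= 1 -> {within `[0, 1], continuous f} ->
    \int[leb]_(t in `[0, 1]) f t = \int[leb]_(t in `[1 - 1, 1]) f (1 - t).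
  exact: Rintegration_by_substitution_onem.
by rewrite E ?subrr ?ler01 ?lexx//; exact: continuous_subspaceT.
Qed.

Lemma inbox_section_integrable Phi A (s : R -> R * R) : continuous Phi ->
  measurable (A : set P) -> inbox A -> continuous s ->
  (forall M y, sqbox M (s y) -> y \in `[- M, M]) ->
  leb.-integrable setT (EFin \o ((Phi \_ A) \o s : measurableTypeR R -> R)).
Proof.
move=> cPhi mA [M AM] cs sM.
have ms : measurable_fun setT (s : measurableTypeR R -> P).
  apply/measurable_fun_pairP; split; apply: continuous_measurable_fun => y.
    by apply: continuous_comp; [exact: cs|exact: cvg_fst].
  by apply: continuous_comp; [exact: cs|exact: cvg_snd].
have [B hB] := bounded_on_sqbox M cPhi.
have mPA : measurable_fun setT (Phi \_ A : P -> R).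
  apply: (iffLR (measurable_restrictT (Phi : P -> measurableTypeR R) mA)).
  by apply: measurable_funTS; exact: continuous_measurable2.
have -> : EFin \o ((Phi \_ A) \o s) = (EFin \o ((Phi \_ A) \o s)) \_ `[- M, M].
  apply/funext => y; rewrite patchE; case: ifPn => // yM.
  rewrite /= patchE ifF//; apply/negbTE; apply: contra yM; rewrite inE => /AM /sM.
  by rewrite inE.
have mI : measurable (`[- M, M] : set (measurableTypeR R)) by exact: measurable_itv.
apply: (iffLR (integrable_mkcond _ mI)).
apply: measurable_bounded_integrable mI _ _ _.
- rewrite /= lebesgue_measure_itv/=; case: ifPn => // _; exact: ltry.
- apply: measurable_funTS; exact: measurableT_comp mPA ms.
exists `|B|; split; first exact: num_real.
move=> z Bz y _ /=; rewrite patchE; case: ifPn => [|_]; last first.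
  by rewrite normr0 (le_trans _ (ltW Bz)).
rewrite inE => /AM /hB /le_trans; apply.
by rewrite (le_trans (ler_norm _))// ltW.
Qed.

Lemma fubini_xy Phi A : continuous Phi -> measurable (A : set P) -> inbox A ->
  \int[area]_(z in A) Phi z = \int[leb]_x \int[leb]_y (Phi \_ A) (x, y).
Proof.
move=> cPhi mA bA; rewrite /Rintegral; congr fine.
have iA : area.-integrable setT (EFin \o (Phi \_ A : P -> R)).
  rewrite -restrict_EFin; apply: (iffLR (integrable_mkcond _ mA)).
  exact: integrable_area.
rewrite integral_mkcond restrict_EFin /area -(integral12_prod_meas1 iA).
apply: eq_integral => x _; rewrite /fubini_F /=.
have hx := @inbox_section_integrable Phi A (fun y => (x, y)) cPhi mA bA.
apply/esym/fineK; apply: (integrable_fin_num measurableT); apply: hx.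
  by apply: continuous_pair => t; [exact: cvg_cst|exact: cvg_id].
by move=> M y [].
Qed.

Lemma fubini_yx Phi A : continuous Phi -> measurable (A : set P) -> inbox A ->
  \int[area]_(z in A) Phi z = \int[leb]_y \int[leb]_x (Phi \_ A) (x, y).
Proof.
move=> cPhi mA bA; rewrite /Rintegral; congr fine.
have iA : area.-integrable setT (EFin \o (Phi \_ A : P -> R)).
  rewrite -restrict_EFin; apply: (iffLR (integrable_mkcond _ mA)).
  exact: integrable_area.
rewrite integral_mkcond restrict_EFin /area -(integral21_prod_meas1 iA).
apply: eq_integral => y _; rewrite /fubini_G /=.
have hy := @inbox_section_integrable Phi A (fun x => (x, y)) cPhi mA bA.
apply/esym/fineK; apply: (integrable_fin_num measurableT); apply: hy.
  by apply: continuous_pair => t; [exact: cvg_id|exact: cvg_cst].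
by move=> M x [].
Qed.

End Integrals.

(** * Barycentric coordinates *)

Section Triangle.
Context {R : realType}.
Implicit Types (p : 'I_3 -> R * R) (x y z : R * R) (a b c : 'I_3).

Lemma pairE x y : x.1 = y.1 -> x.2 = y.2 -> x = y.
Proof. by case: x y => [? ?] [? ?] /= -> ->. Qed.

Lemma I3_cases a b : [\/ b = a, b = a + 1 | b = a + 2%:R].
Proof.
by case: a b => -[|[|[|//]]] ia [[|[|[|//]]]] ib;
  [constructor 1|constructor 2|constructor 3|constructor 3|constructor 1|
   constructor 2|constructor 2|constructor 3|constructor 1]; apply/val_inj.
Qed.

Lemma addI3 a : [/\ a + 1 + 1 = a + 2%:R, a + 1 + 2%:R = a,
  a + 2%:R + 1 = a & a + 2%:R + 2%:R = a + 1].
Proof. by case: a => -[|[|[|//]]] ia; split; apply/val_inj. Qed.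

Lemma neqI3 a : [/\ a + 1 != a, a + 2%:R != a & a + 1 != a + 2%:R].
Proof. by case: a => -[|[|[|//]]] ia. Qed.

Lemma sumI3 (M : zmodType) (F : 'I_3 -> M) a :
  \sum_b F b = F a + F (a + 1) + F (a + 2%:R).
Proof.
have S0 : \sum_b F b = F 0 + F 1 + F 2%:R.
  rewrite !big_ord_recl big_ord0 addr0 addrA.
  by congr (F _ + F _ + F _); apply/val_inj.
rewrite S0; case: (I3_cases 0 a) => ->.
- by rewrite !add0r.
- have [-> -> _ _] := addI3 0.
  by rewrite !add0r -addrA addrC.
- have [_ _ -> ->] := addI3 0.
  by rewrite !add0r addrC addrA.
Qed.

Definition tdet p := cross (p 1 - p 0) (p 2%:R - p 0).

Lemma tdetE p a : tdet p = cross (p (a + 1) - p a) (p (a + 2%:R) - p a).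
Proof.
rewrite /tdet; case: (I3_cases 0 a) => ->.
- by rewrite !add0r.
- have [-> -> _ _] := addI3 0; rewrite !add0r /cross /=; ring.
- have [_ _ -> ->] := addI3 0; rewrite !add0r /cross /=; ring.
Qed.

Definition lam p a x := cross (p (a + 1) - x) (p (a + 2%:R) - x) / tdet p.

Lemma lam_sum p x : tdet p != 0 -> \sum_a lam p a x = 1.
Proof.
move=> D0; rewrite (sumI3 _ 0) /lam; have [-> -> -> ->] := addI3 0.
rewrite -!mulrDl; apply: (mulIf D0); rewrite divfK// mul1r.
by rewrite !add0r /tdet /cross /=; ring.
Qed.

Lemma lam_combination p x : tdet p != 0 -> \sum_a lam p a x *: p a = x.
Proof.
move=> D0; rewrite (sumI3 _ 0) /lam; have [-> -> -> ->] := addI3 0.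
have E (u v w a b c d : R) : a * u + b * v + c * w = d * tdet p ->
    (a / tdet p) * u + (b / tdet p) * v + (c / tdet p) * w = d.
  move=> h; apply: (mulIf D0); rewrite -h !mulrDl.
  by congr (_ + _ + _); rewrite mulrAC divfK.
rewrite !add0r; apply: pairE; rewrite /GRing.scale /= /GRing.scale /=;
  apply: E; rewrite /tdet /cross /=; ring.
Qed.

Lemma lam_affine p (I : finType) (q : I -> R * R) (w : I -> R) a : \sum_i w i = 1 ->
  lam p a (\sum_i w i *: q i) = \sum_i w i * lam p a (q i).
Proof.
move=> w1; rewrite /lam.
have -> : cross (p (a + 1) - \sum_i w i *: q i) (p (a + 2%:R) - \sum_i w i *: q i) =
    \sum_i w i * cross (p (a + 1) - q i) (p (a + 2%:R) - q i).
  have E (u v x : R * R) : cross (u - x) (v - x) = cross u v + cross (v - u) x.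
    by rewrite /cross /=; ring.
  rewrite E; under [RHS]eq_bigr do rewrite E mulrDr.
  rewrite big_split/= -mulr_suml w1 mul1r; congr (_ + _).
  rewrite /cross; under [RHS]eq_bigr do rewrite mulrBr.
  rewrite sumrB.
  have -> : (\sum_i w i *: q i).1 = \sum_i w i * (q i).1.
    by apply: (big_morph fst).
  have -> : (\sum_i w i *: q i).2 = \sum_i w i * (q i).2.
    by apply: (big_morph snd).
  by rewrite !mulr_sumr; congr (_ - _); apply: eq_bigr => i _; ring.
by rewrite mulr_suml; apply: eq_bigr => i _; rewrite mulrA.
Qed.

Lemma lam_vertex p a b : tdet p != 0 -> lam p a (p b) = (a == b)%:R.
Proof.
move=> D0; rewrite /lam; have [n1 n2 n3] := neqI3 a.
case: (I3_cases a b) => ->.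
- by rewrite -tdetE divff// eqxx.
- by rewrite eq_sym (negbTE n1) subrr /cross/= !mul0r subrr mul0r.
- by rewrite eq_sym (negbTE n2) subrr /cross/= !mulr0 subrr mul0r.
Qed.

Lemma lam_unique p (w : 'I_3 -> R) a : tdet p != 0 -> \sum_b w b = 1 ->
  lam p a (\sum_b w b *: p b) = w a.
Proof.
move=> D0 w1; rewrite lam_affine//.
under eq_bigr do rewrite lam_vertex//.
rewrite (bigD1 a)//= eqxx mulr1 big1 ?addr0// => b ba.
by rewrite eq_sym (negbTE ba) mulr0.
Qed.

Lemma faceP p (S : {set 'I_3}) x : tdet p != 0 ->
  face p S x <-> (forall a, 0 <= lam p a x) /\
                 (forall a, a \notin S -> lam p a x = 0).
Proof.
move=> D0; split=> [[w [w0 wS w1 ->]]|[l0 lS]].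
  by split=> a; rewrite lam_unique//; exact: wS.
exists (fun a => lam p a x); split => //; first exact: lam_sum.
by rewrite lam_combination.
Qed.

Lemma vertex_inj p : tdet p != 0 -> injective p.
Proof.
move=> D0 a b pab; apply/eqP; have := lam_vertex a a D0.
rewrite pab lam_vertex// eqxx; case: eqP => // _ /eqP.
by rewrite eq_sym oner_eq0.
Qed.

Lemma continuous_lam p a : continuous (lam p a).
Proof. by rewrite /lam /cross; continuity. Qed.

Lemma continuous_cross v y : continuous (fun x => cross v (x - y)).
Proof. by rewrite /cross; continuity. Qed.

End Triangle.

(** * The mesh and the sides of the polygon *)

Lemma closed_nonneg {R : realType} {X : topologicalType} (f : X -> R) :
  continuous f -> closed [set x | 0 <= f x].
Proof.
move=> cf; apply: (@preimage_closed _ _ f [set r | 0 <= r]).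
  by move=> x _; exact: cf.
exact: closed_ge.
Qed.

Lemma near_pos {R : realType} {X : topologicalType} (f : X -> R) x :
  continuous f -> 0 < f x -> \forall y \near x, 0 < f y.
Proof.
move=> cf fx; have : nbhs (f x) [set r | 0 < r].
  by apply: open_nbhs_nbhs; split => //; exact: open_gt.
by move/(cf x).
Qed.

Section Mesh.
Context {R : realType} {m : nat} (V : 'I_m -> R * R) (Om : set (R * R)).
Context (hOm : convex_polygonal_domain V Om).
Context {n : nat} (T : 'I_n -> 'I_3 -> R * R) (hT : triangulation Om T).
Implicit Types (x y z : R * R) (i j : 'I_m) (K L : 'I_n) (a b c : 'I_3)
  (f g : 'I_n * 'I_3).

Definition ell i x := cross (side_vec V i) (x - V i).

Lemma continuous_ell i : continuous (ell i).
Proof. exact: continuous_cross. Qed.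

Lemma ell_affine i (I : finType) (q : I -> R * R) (w : I -> R) :
  \sum_k w k = 1 -> ell i (\sum_k w k *: q k) = \sum_k w k * ell i (q k).
Proof.
move=> w1; rewrite /ell.
have E x : cross (side_vec V i) (x - V i) =
    cross (side_vec V i) x - cross (side_vec V i) (V i).
  by rewrite /cross /=; ring.
rewrite E; under [RHS]eq_bigr do rewrite E mulrBr.
rewrite sumrB -mulr_suml w1 mul1r; congr (_ - _).
rewrite /cross; under [RHS]eq_bigr do rewrite mulrBr.
rewrite sumrB.
have -> : (\sum_k w k *: q k).1 = \sum_k w k * (q k).1 by apply: (big_morph fst).
have -> : (\sum_k w k *: q k).2 = \sum_k w k * (q k).2 by apply: (big_morph snd).
by rewrite !mulr_sumr; congr (_ - _); apply: eq_bigr => k _; ring.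
Qed.

Lemma tdet_neq0 K : tdet (T K) != 0.
Proof. by have [/(_ K)] := hT. Qed.

Lemma ell_lam i K x : ell i x = \sum_a lam (T K) a x * ell i (T K a).
Proof.
rewrite -{1}(lam_combination x (tdet_neq0 K)) ell_affine//.
exact: lam_sum (tdet_neq0 K).
Qed.

Lemma lam_lam K L a x : lam (T K) a x = \sum_b lam (T L) b x * lam (T K) a (T L b).
Proof.
rewrite -{1}(lam_combination x (tdet_neq0 L)) lam_affine//.
exact: lam_sum (tdet_neq0 L).
Qed.

Lemma eltP K x : elt T K x <-> forall a, 0 <= lam (T K) a x.
Proof.
rewrite /elt faceP; last exact: tdet_neq0.
by split=> [[]//|h]; split=> // a; rewrite inE.
Qed.

Lemma vertex_elt K a : elt T K (T K a).
Proof. by apply/eltP => b; rewrite lam_vertex ?tdet_neq0. Qed.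

Lemma lam_le1 K a x : elt T K x -> lam (T K) a x <= 1.
Proof.
move=> /eltP l0; rewrite -(lam_sum x (tdet_neq0 K)) (bigD1 a)//= lerDl.
exact: sumr_ge0.
Qed.

Lemma closed_elt K : closed (elt T K).
Proof.
have -> : elt T K = \bigcap_(a in [set: 'I_3]) [set x | 0 <= lam (T K) a x].
  apply/seteqP; split=> x; first by move=> /eltP h a _; exact: h.
  by move=> h; apply/eltP => a; exact: h.
apply: closed_bigI => a _; apply: closed_nonneg; exact: continuous_lam.
Qed.

Definition open_elt K : set (R * R) := [set x | forall a, 0 < lam (T K) a x].

Lemma open_open_elt K : open (open_elt K).
Proof.
rewrite openE => x h.
suff : \forall y \near x, forall a, 0 < lam (T K) a y by [].
apply: (filter_forall (nbhs_filter x)) => a.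
by apply: (@near_pos _ _ (lam (T K) a)); [exact: continuous_lam|exact: h].
Qed.

Lemma open_elt_sub K : open_elt K `<=` elt T K.
Proof. by move=> x h; apply/eltP => a; exact: ltW. Qed.

Lemma open_Om : open Om. Proof. by have [[]] := hOm. Qed.

Lemma ell_gt0 i x : Om x -> 0 < ell i x.
Proof. by have [_ [_ _ + _]] := hOm; apply. Qed.

Lemma ell_ge0 i x : closure Om x -> 0 <= ell i x.
Proof.
have /closure_id cl : closed [set y | 0 <= ell i y].
  by apply: closed_nonneg; exact: continuous_ell.
suff: closure Om `<=` [set y | 0 <= ell i y] by apply.
by rewrite cl; apply: closureS => y /(ell_gt0 i) /ltW.
Qed.

Lemma closureD_side x : closure Om x -> ~ Om x -> exists i, side V i x.
Proof.
move=> cx nx; have [_ [frE _ _ _]] := hOm.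
have : frontier Om x.
  by split => //; rewrite (iffLR (interior_id _) open_Om).
by rewrite frE => -[i _ ix]; exists i.
Qed.

Lemma side_closure i x : side V i x -> closure Om x /\ ~ Om x.
Proof.
move=> ix; have [_ [frE _ _ _]] := hOm.
have : frontier Om x by rewrite frE; exists i.
by move=> []; rewrite (iffLR (interior_id _) open_Om).
Qed.

Lemma ell_param i j t : ell i (side_param V j t) = ell i (V j) + t * cross (side_vec V i) (side_vec V j).
Proof. by rewrite /ell /side_param /cross /GRing.scale /= /GRing.scale /=; ring. Qed.

Lemma ell_param0 i t : ell i (side_param V i t) = 0.
Proof. by rewrite /ell /side_param /cross /GRing.scale /= /GRing.scale /=; ring. Qed.

Lemma ell_side i x : side V i x -> ell i x = 0.
Proof. by move=> [t _ <-]; rewrite ell_param0. Qed.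

Lemma corner_cross i : cross (side_vec V i) (side_vec V (ordS i)) != 0.
Proof. by have [_ [_ _ _]] := hOm; exact. Qed.

Definition len2 i := (side_vec V i).1 ^+ 2 + (side_vec V i).2 ^+ 2.

Lemma len2_gt0 i : 0 < len2 i.
Proof.
rewrite lt_neqAle addr_ge0 ?sqr_ge0// andbT eq_sym; apply: contra (corner_cross i).
rewrite paddr_eq0 ?sqr_ge0// !sqrf_eq0 /cross => /andP[/eqP -> /eqP ->].
by rewrite !mul0r subrr.
Qed.

(** Affine coordinate along a side, extended to the plane by orthogonal
    projection. *)
Definition tpos i x : R :=
  ((x - V i).1 * (side_vec V i).1 + (x - V i).2 * (side_vec V i).2) / len2 i.

Lemma tpos_param i t : tpos i (side_param V i t) = t.
Proof.
rewrite /tpos; apply: (mulIf (lt0r_neq0 (len2_gt0 i))).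
rewrite divfK ?lt0r_neq0 ?len2_gt0//.
by rewrite /side_param /len2 /GRing.scale /= /GRing.scale /=; ring.
Qed.

Lemma param_tpos i x : ell i x = 0 -> side_param V i (tpos i x) = x.
Proof.
move=> e0; have l0 := lt0r_neq0 (len2_gt0 i).
have h (v u c e d : R) : d != 0 -> u * c = (e - v) * d -> v + u / d * c = e.
  by move=> d0 uc; rewrite mulrAC uc mulfK// addrC subrK.
apply: pairE; rewrite /side_param /tpos /GRing.scale /= /GRing.scale /=;
  apply: h => //; apply/eqP; rewrite -subr_eq0; apply/eqP; rewrite /len2.
- transitivity ((side_vec V i).2 * ell i x); last by rewrite e0 mulr0.
  by rewrite /ell /cross /=; ring.
- transitivity (- (side_vec V i).1 * ell i x); last by rewrite e0 mulr0.
  by rewrite /ell /cross /=; ring.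
Qed.

(** Beyond an end point of a side the half-plane of the adjacent side is left. *)
Lemma line_closure_side i x : closure Om x -> ell i x = 0 -> side V i x.
Proof.
move=> cx e0; set t := tpos i x.
have xE : side_param V i t = x by exact: param_tpos.
exists t; last by [].
have sideT j s : 0 <= s <= 1 -> closure Om (side_param V j s).
  move=> s01; suff /side_closure[] : side V j (side_param V j s) by [].
  by exists s => //; rewrite /= in_itv.
rewrite /= in_itv/=; apply/andP; split; rewrite leNgt; apply/negP => t01.
  pose j := ord_pred i; have ij : i = ordS j by rewrite /j ord_predK.
  have Vj : V i = side_param V j 1.
    by rewrite /side_param scale1r /side_vec addrC subrK ij.
  have ej0 : ell j (V i) = 0 by rewrite Vj ell_param0.
  have := ell_ge0 j cx; rewrite -xE ell_param ej0 add0r.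
  have := ell_ge0 j (sideT i 1 _); rewrite ell_param ej0 add0r mul1r ler01 lexx => /(_ isT) h1 h2.
  have := corner_cross j; rewrite -ij; move: h1; rewrite le_eqVlt => /predU1P[<-|h1 _].
    by rewrite eqxx.
  by move: h2; rewrite leNgt nmulr_rlt0 ?h1.
pose j := ordS i.
have Vj : V j = side_param V i 1 by rewrite /side_param scale1r /side_vec addrC subrK.
have E s : ell j (side_param V i s) = (1 - s) * cross (side_vec V i) (side_vec V j).
  rewrite /ell Vj /side_param /cross /GRing.scale /= /GRing.scale /=; ring.
have := ell_ge0 j cx; rewrite -xE E.
have := ell_ge0 j (sideT i 0 _); rewrite E subr0 mul1r lexx ler01 => /(_ isT) h1 h2.
have := corner_cross i; move: h1; rewrite le_eqVlt => /predU1P[<-|h1 _].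
  by rewrite eqxx.
by move: h2; rewrite leNgt nmulr_rlt0 ?h1 ?subr_lt0.
Qed.

Lemma elt_closure K x : elt T K x -> closure Om x.
Proof. by have [_ <- _] := hT => Kx; exists K. Qed.

Lemma closure_elt x : closure Om x -> exists K, elt T K x.
Proof. by have [_ <- _] := hT => -[K _ Kx]; exists K. Qed.

Lemma conform K L : K != L -> exists S S' : {set 'I_3},
  [/\ S \proper [set: 'I_3]%SET, S' \proper [set: 'I_3]%SET,
      elt T K `&` elt T L = face (T K) S & elt T K `&` elt T L = face (T L) S'].
Proof. by have [_ _] := hT; apply. Qed.

Lemma open_elt_disjoint K L x : open_elt K x -> elt T L x -> K = L.
Proof.
move=> Kx Lx; apply/eqP; apply: contraT => KL.
have [S [_ [pS _ ES _]]] := conform KL.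
have : face (T K) S x by rewrite -ES; split => //; exact: open_elt_sub.
move=> /faceP -/(_ (tdet_neq0 K))[_ h].
have [a aS] : exists a, a \notin S.
  by move: pS; rewrite properE => /andP[_ /subsetPn[a _ aS]]; exists a.
by have := Kx a; rewrite (h a aS) ltxx.
Qed.

Lemma elt_ell_ge0 i K a : 0 <= ell i (T K a).
Proof. by apply: ell_ge0; apply: elt_closure; exact: vertex_elt. Qed.

Lemma elt_nonflat i K : exists a, ell i (T K a) != 0.
Proof.
apply/existsP; apply: contraT; rewrite negb_exists => /forallP h.
have e0 a : ell i (T K a) = 0 by have := h a; rewrite negbK => /eqP.
have := tdet_neq0 K; rewrite /tdet.
suff -> : cross (T K 1 - T K 0) (T K 2%:R - T K 0) = 0 by rewrite eqxx.
have := param_tpos (e0 0); have := param_tpos (e0 1); have := param_tpos (e0 2%:R).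
move=> <- <- <-; rewrite /side_param /cross /GRing.scale /= /GRing.scale /=; ring.
Qed.

Lemma open_elt_Om K x : open_elt K x -> Om x.
Proof.
move=> Kx; apply: contrapT => nx.
have cx : closure Om x by apply: elt_closure; exact: open_elt_sub Kx.
have [i ix] := closureD_side cx nx.
have := ell_side ix; rewrite (ell_lam i K) => /eqP.
rewrite psumr_eq0 => [/allP h|a _]; last by rewrite mulr_ge0// ?elt_ell_ge0 ?ltW.
have [a] := elt_nonflat i K; have := h a (mem_index_enum _).
by rewrite mulf_eq0 gt_eqF//= => /eqP ->; rewrite eqxx.
Qed.

End Mesh.

Lemma ray_near {R : realType} (U : set (R * R)) (x v : R * R) : nbhs x U ->
  exists2 e : R, 0 < e & forall t, 0 <= t <= e -> U (x + t *: v).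
Proof.
move=> Ux.
have c : continuous (fun t : R => x + t *: v).
  apply: continuous_pair; rewrite /GRing.scale /= /GRing.scale /=; continuity.
have : nbhs (x + 0 *: v) U by rewrite scale0r addr0.
move=> /(c 0)/nbhs_ballP[e /= e0 eU]; exists (e / 2); first by rewrite divr_gt0.
move=> t /andP[t0 te]; apply: eU; rewrite /ball/= sub0r normrN ger0_norm//.
by rewrite (le_lt_trans te)// ltr_pdivrMr// mulr_natr mulr2n ltrDl.
Qed.

(** * Edges and their neighbours *)

Section Flags.
Context {R : realType} {m : nat} (V : 'I_m -> R * R) (Om : set (R * R)).
Context (hOm : convex_polygonal_domain V Om).
Context {n : nat} (T : 'I_n -> 'I_3 -> R * R) (hT : triangulation Om T).
Implicit Types (x y z : R * R) (i j : 'I_m) (K L : 'I_n) (a b c : 'I_3)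
  (f g : 'I_n * 'I_3).
Let D0 K := tdet_neq0 hT K.

(** A flag is an element with one of its vertices; it stands for the edge
    opposite to that vertex. *)
Definition ea f := T f.1 (f.2 + 1).
Definition eb f := T f.1 (f.2 + 2%:R).
Definition apex f := T f.1 f.2.

Definition neighbours f g := (f.1 != g.1) &&
  ((ea f == ea g) && (eb f == eb g) || (ea f == eb g) && (eb f == ea g)).

Definition onside i f := (ell V i (ea f) == 0) && (ell V i (eb f) == 0).

Lemma neighbours_sym f g : neighbours f g = neighbours g f.
Proof.
rewrite /neighbours eq_sym (eq_sym (ea g)) (eq_sym (eb g)) (eq_sym (ea g)) (eq_sym (eb g)).
by congr (_ && (_ || _)); rewrite andbC.
Qed.

(** By conformity the vertex is a combination of vertices of [L] that lie in
    [K], and it is an extreme point of [K]. *)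
Lemma vertex_of_both K L a : elt T L (T K a) -> exists b, T K a = T L b.
Proof.
have [->|KL] := eqVneq K L; first by exists a.
move=> La; have [S [S' [_ _ ES ES']]] := conform hT KL.
have : face (T L) S' (T K a) by rewrite -ES'; split => //; exact: vertex_elt hT _ _.
move=> /faceP -/(_ (D0 L))[l0 lS].
have sub b : lam (T L) b (T K a) != 0 -> elt T K (T L b).
  move=> lb; suff : face (T L) S' (T L b) by rewrite -ES' => -[].
  apply/faceP => //; split=> c; rewrite lam_vertex// => cS.
  case: eqP => // cb; move: lb; rewrite -cb lS ?eqxx//.
have := lam_lam hT K L a (T K a); rewrite lam_vertex// eqxx => E.
have E0 : \sum_b lam (T L) b (T K a) * (1 - lam (T K) a (T L b)) = 0.
  under eq_bigr do rewrite mulrBr mulr1.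
  by rewrite sumrB lam_sum// -E subrr.
have [b lb] : exists b, lam (T L) b (T K a) != 0.
  apply/existsP; apply: contraT; rewrite negb_exists => /forallP h.
  have := lam_sum (T K a) (D0 L); rewrite big1 => [/eqP|b _].
    by rewrite eq_sym oner_eq0.
  by have := h b; rewrite negbK => /eqP.
exists b.
have l1 : lam (T K) a (T L b) = 1.
  move: E0 => /eqP; rewrite psumr_eq0 => [/allP/(_ b (mem_index_enum _))|c _].
    by rewrite mulf_eq0 (negbTE lb)/= subr_eq0 => /eqP.
  have [->|lc] := eqVneq (lam (T L) c (T K a)) 0; first by rewrite mul0r.
  by rewrite mulr_ge0// subr_ge0; apply: (lam_le1 hT); exact: sub.
rewrite -{1}(lam_combination (T L b) (D0 K)) (bigD1 a)//= l1 scale1r.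
have k0 := iffLR (eltP hT _ _) (sub b lb).
have := lam_sum (T L b) (D0 K); rewrite (bigD1 a)//= l1.
move=> /(canRL (addKr _)); rewrite addNr => /eqP.
rewrite psumr_eq0 => [/allP h|c _]; last exact: k0.
rewrite big1 ?addr0// => c ca.
by have := h c (mem_index_enum _); rewrite ca => /eqP ->; rewrite scale0r.
Qed.

Lemma edge_exists L b c : b != c -> exists a, [\/ b = a + 1 /\ c = a + 2%:R |
  b = a + 2%:R /\ c = a + 1] /\ a != b.
Proof.
move=> bc; case: (I3_cases b c) => cE; first by rewrite cE eqxx in bc.
- exists (b + 2%:R); have [h1 h2 h3 h4] := addI3 b; have [_ n2 _] := neqI3 b.
  by split; [constructor 1; rewrite h3 h4|].
- exists (b + 1); have [h1 h2 h3 h4] := addI3 b; have [n1 _ _] := neqI3 b.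
  by split; [constructor 2; rewrite h1 h2|].
Qed.

(** A point with two positive coordinates cannot lie in a smaller face than
    the edge, so by conformity both end points of the edge belong to the other
    element and are vertices of it. *)
Lemma common_edge f L x : f.1 != L -> elt T f.1 x -> elt T L x ->
  0 < lam (T f.1) (f.2 + 1) x -> 0 < lam (T f.1) (f.2 + 2%:R) x ->
  exists b, neighbours f (L, b).
Proof.
case: f => K a /= KL Kx Lx l1 l2.
have [S [S' [_ _ ES ES']]] := conform hT KL.
have : face (T K) S x by rewrite -ES; split.
move=> /faceP -/(_ (D0 K))[_ lS].
have sub c : 0 < lam (T K) c x -> elt T L (T K c).
  move=> lc; suff : face (T K) S (T K c) by rewrite -ES => -[].
  apply/faceP => //; split=> d; rewrite lam_vertex// => dS.
  by case: eqP => // dc; move: lc; rewrite -dc lS ?ltxx.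
have [b1 e1] := vertex_of_both (sub _ l1).
have [b2 e2] := vertex_of_both (sub _ l2).
have b12 : b1 != b2.
  apply/eqP => b12; have := vertex_inj (D0 K) (etrans e1 (etrans (f_equal (T L) b12) (esym e2))).
  by have [_ _ /eqP] := neqI3 a.
have [b [hb _]] := edge_exists L b12.
exists b; rewrite /neighbours /ea /eb /= KL /= e1 e2.
by case: hb => -[-> ->]; rewrite !eqxx ?orbT.
Qed.

Lemma neighbours_lam0 f g : neighbours f g ->
  lam (T f.1) f.2 (ea g) = 0 /\ lam (T f.1) f.2 (eb g) = 0.
Proof.
have [n1 n2 _] := neqI3 f.2.
have l1 : lam (T f.1) f.2 (ea f) = 0 by rewrite lam_vertex// eq_sym (negbTE n1).
have l2 : lam (T f.1) f.2 (eb f) = 0 by rewrite lam_vertex// eq_sym (negbTE n2).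
by move=> /andP[_ /orP[]] /andP[/eqP <- /eqP <-].
Qed.

Lemma neighbours_lam f g x : neighbours f g ->
  lam (T f.1) f.2 x = lam (T g.1) g.2 x * lam (T f.1) f.2 (apex g).
Proof.
move=> fg; have [h1 h2] := neighbours_lam0 fg.
rewrite (lam_lam hT f.1 g.1) (sumI3 _ g.2) -/(ea g) -/(eb g) h1 h2.
by rewrite !mulr0 !addr0.
Qed.

(** The apexes of two distinct elements with a common edge lie on opposite
    sides of that edge: otherwise the open elements would overlap. *)
Lemma neighbours_opposite f g : neighbours f g -> lam (T f.1) f.2 (apex g) < 0.
Proof.
case: f g => K a [L b] fg; rewrite ltNge; apply/negP => /= lg.
have [KL e12] := andP fg; move: e12 => /= e12.
set s := `|lam (T K) (a + 1) (T L b)| + `|lam (T K) (a + 2%:R) (T L b)|.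
have s0 : 0 <= s by rewrite addr_ge0.
pose e := (2 + 2 * s)^-1.
have e0 : 0 < e by rewrite invr_gt0 ltr_wpDr// mulr_ge0.
have es : e * (2 + 2 * s) = 1 by rewrite mulVf// gt_eqF// ltr_wpDr// mulr_ge0.
have e1 : e < 1.
  by rewrite -es ltr_pMr// (lt_le_trans (_ : 1 < 2))// ?ltr1n// lerDl mulr_ge0.
pose w c : R := if c == b then e else (1 - e) / 2.
have [n1 n2 n3] := neqI3 b.
have w1 : \sum_c w c = 1.
  by rewrite (sumI3 _ b) /w eqxx (negbTE n1) (negbTE n2); field.
pose z := \sum_c w c *: T L c.
have Lz : open_elt T L z.
  move=> c; rewrite lam_unique// /w; case: ifP => // _.
  by rewrite divr_gt0// subr_gt0.
suff Kz : elt T K z by have := open_elt_disjoint hT Lz Kz => E; rewrite E eqxx in KL.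
have zE c : lam (T K) c z = e * lam (T K) c (T L b) +
    (1 - e) / 2 * (lam (T K) c (ea (K, a)) + lam (T K) c (eb (K, a))).
  rewrite lam_affine// (sumI3 _ b) /w eqxx (negbTE n1) (negbTE n2) -addrA -mulrDr.
  congr (_ + _ * _).
  case/orP: e12 => /andP[/eqP h1 /eqP h2]; rewrite -/(ea (L, b)) -/(eb (L, b)) -h1 -h2//.
  by rewrite addrC.
have [m1 m2 m3] := neqI3 a.
apply/(eltP hT) => c; rewrite zE /ea /eb /= !lam_vertex//.
have small u : `|u| <= s -> 0 <= e * u + (1 - e) / 2.
  move=> us; have : - s <= u by rewrite lerNl (le_trans _ us)// -normrN ler_norm.
  move=> us'; have : e * (- s) <= e * u by rewrite ler_pM2l.
  move: es e1; rewrite mulrDr; nra.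
case: (I3_cases a c) => ->.
- by rewrite eq_sym (negbTE m1) eq_sym (negbTE m2) addr0 mulr0 addr0 mulr_ge0// ltW.
- rewrite eqxx (negbTE m3) addr0 mulr1; apply: small.
  by rewrite lerDl.
- rewrite eqxx eq_sym (negbTE m3) add0r mulr1; apply: small.
  by rewrite lerDr.
Qed.

Lemma neighbours_uniq f g g' : neighbours f g -> neighbours f g' -> g = g'.
Proof.
move=> fg fg'.
have [E|N] := eqVneq g.1 g'.1.
  case: g g' E fg fg' => L b [L' b'] /= E; rewrite -{}E {L'} => fg fg'.
  congr pair; apply/eqP; apply: contraT => bb'.
  have /neighbours_lam0 [h1 h2] : neighbours (L, b') f by rewrite neighbours_sym.
  move: fg => /andP[_ e12].
  have [n1 n2 _] := neqI3 b.
  have [] : lam (T L) b' (ea (L, b)) = 0 /\ lam (T L) b' (eb (L, b)) = 0.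
    by case/orP: e12 => /andP[/eqP <- /eqP <-].
  rewrite /ea /eb /= !lam_vertex//.
  case: (I3_cases b b') bb' => ->; first by rewrite eqxx.
    by rewrite eqxx => _ /eqP; rewrite oner_eq0.
  by rewrite eqxx => _ _ /eqP; rewrite oner_eq0.
have gg' : neighbours g g'.
  move: fg fg' => /andP[_ e] /andP[_ e']; rewrite /neighbours N /=.
  case/orP: e => /andP[/eqP <- /eqP <-]; case/orP: e' => /andP[/eqP <- /eqP <-];
    by rewrite !eqxx ?orbT.
have := neighbours_opposite fg'; rewrite (neighbours_lam _ fg).
by rewrite nmulr_rlt0 ?neighbours_opposite// ltNge => /negP[]; apply/ltW/neighbours_opposite.
Qed.

Lemma onside_apex i f : onside i f -> 0 < ell V i (apex f).
Proof.
move=> /andP[/eqP h1 /eqP h2]; rewrite lt_neqAle (elt_ell_ge0 hOm hT) andbT eq_sym.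
have [b hb] := elt_nonflat hOm hT i f.1; move: hb.
by case: (I3_cases f.2 b) => -> //; rewrite -/(ea f) -/(eb f) ?h1 ?h2 eqxx.
Qed.

Lemma onside_ell i f x : onside i f ->
  ell V i x = lam (T f.1) f.2 x * ell V i (apex f).
Proof.
move=> /andP[/eqP h1 /eqP h2].
by rewrite (ell_lam V hT i f.1) (sumI3 _ f.2) -/(ea f) -/(eb f) h1 h2 !mulr0 !addr0.
Qed.

Lemma onside_no_neighbour i f g : onside i f -> ~~ neighbours f g.
Proof.
move=> fi; apply/negP => fg.
have := elt_ell_ge0 hOm hT i g.1 g.2; rewrite -/(apex g) (onside_ell _ fi).
by rewrite leNgt pmulr_llt0 ?onside_apex// neighbours_opposite.
Qed.

Lemma flag_dichotomy f : (exists g, neighbours f g) \/ (exists i, onside i f).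
Proof.
case: f => K a; pose f := (K, a).
pose w c : R := if c == a then 0 else 2^-1.
have [n1 n2 n3] := neqI3 a.
have w1 : \sum_c w c = 1.
  by rewrite (sumI3 _ a) /w eqxx (negbTE n1) (negbTE n2); field.
pose x := \sum_c w c *: T K c.
have lx c : lam (T K) c x = w c by exact: lam_unique.
have Kx : elt T K x by apply/(eltP hT) => c; rewrite lx /w; case: ifP.
have cx := elt_closure hT Kx.
have [Ox|nx] := pselect (Om x); last first.
  right; have [i ix] := closureD_side hOm cx nx; exists i.
  have := ell_side ix; rewrite (ell_lam V hT i K) (sumI3 _ a) !lx /w eqxx.
  rewrite (negbTE n1) (negbTE n2) mul0r add0r => /eqP.
  rewrite paddr_eq0 ?mulr_ge0 ?(elt_ell_ge0 hOm hT)// !mulf_eq0 invr_eq0.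
  by rewrite pnatr_eq0.
left.
pose U := [set y | Om y /\ forall L, elt T L y -> elt T L x].
have Ux : nbhs x U.
  apply: filterI; first by apply: open_nbhs_nbhs; split => //; exact: open_Om hOm.
  suff : \forall y \near x, forall L, elt T L y -> elt T L x by [].
  apply: (filter_forall (nbhs_filter x)) => L.
  have [Lx|Lx] := pselect (elt T L x); first exact: nearW.
  have : nbhs x (~` elt T L).
    by apply: open_nbhs_nbhs; split => //; rewrite openC; exact: (closed_elt hT).
  by apply: filterS => y.
have [e e0 he] := ray_near (x - T K a) Ux.
have [Oy hy] := he e ltac:(by rewrite lexx ltW).
set y := x + e *: (x - T K a) in Oy hy.
have [L Ly] := closure_elt hT (subset_closure Oy).
have Lx := hy _ Ly.
have lay : lam (T K) a y < 0.
  pose v (b : bool) := if b then x else T K a.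
  pose u (b : bool) := if b then 1 + e else - e.
  have -> : y = \sum_b u b *: v b.
    by rewrite big_bool /= scalerDl scale1r scaleNr -addrA -scalerBr.
  rewrite lam_affine; last by rewrite big_bool /= addrK.
  by rewrite big_bool /= lx /w eqxx mulr0 add0r lam_vertex// eqxx mulr1 oppr_lt0.
have KL : K != L.
  by apply/eqP => E; have := iffLR (eltP hT _ _) Ly a; rewrite -E leNgt lay.
have [||b fb] := @common_edge (K, a) L x KL Kx Lx.
- by rewrite /= lx /w (negbTE n1).
- by rewrite /= lx /w (negbTE n2).
by exists (L, b).
Qed.

Lemma onside_uniq i j f : onside i f -> onside j f -> i = j.
Proof.
move=> fi fj.
have side_ij k l : onside k f -> onside l f -> forall x, side V k x -> side V l x.
  move=> fk fl x kx; apply: (line_closure_side hOm).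
    by have [] := side_closure hOm kx.
  rewrite (onside_ell x fl); have := ell_side kx; rewrite (onside_ell x fk) => /eqP.
  by rewrite mulf_eq0 (gt_eqF (onside_apex fk)) orbF => /eqP ->; rewrite mul0r.
have V0 k : V k = side_param V k 0 by rewrite /side_param scale0r addr0.
have Vk k l : onside k f -> onside l f -> 0 <= tpos V l (V k).
  move=> fk fl; have /(side_ij _ _ fk fl) : side V k (V k).
    by exists 0 => //; rewrite /= in_itv /= lexx ler01.
  by move=> [t /= + <-]; rewrite in_itv/= (tpos_param hOm) => /andP[].
have [_ [_ injV _ _]] := hOm; apply: injV.
(* both sides are traversed in the same direction *)
have dE : cross (side_vec V i) (side_vec V j) = 0.
  have h1 : ell V i (V j) = 0.
    apply: ell_side; apply: (side_ij _ _ fj fi); exists 0; rewrite -?V0 //=.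
    by rewrite in_itv /= lexx ler01.
  have h2 : ell V i (side_param V j 1) = 0.
    apply: ell_side; apply: (side_ij _ _ fj fi); exists 1 => //=.
    by rewrite in_itv /= lexx ler01.
  by move: h2; rewrite ell_param h1 add0r mul1r.
have := Vk i j fi fj; have := Vk j i fj fi; move=> h1 h2.
pose s := tpos V i (V j).
have VjE : V j = V i + s *: side_vec V i.
  rewrite -/(side_param V i s) (param_tpos hOm)//.
  apply: ell_side; apply: (side_ij _ _ fj fi); exists 0; rewrite -?V0 //=.
  by rewrite in_itv /= lexx ler01.
pose p := (side_vec V i).1 * (side_vec V j).1 + (side_vec V i).2 * (side_vec V j).2.
have p0 : 0 < p.
  have : len2 V i * ell V j (apex f) = p * ell V i (apex f).
    apply/eqP; rewrite -subr_eq0; apply/eqP; rewrite /ell VjE.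
    transitivity (cross (side_vec V i) (side_vec V j) * (s * len2 V i -
      (side_vec V i).1 * ((apex f).1 - (V i).1) -
      (side_vec V i).2 * ((apex f).2 - (V i).2))); last by rewrite dE mul0r.
    rewrite /cross /len2 /p /GRing.scale /= /GRing.scale /=; ring.
  move=> E; have : 0 < p * ell V i (apex f) 
    by rewrite -E; apply: mulr_gt0; [exact: (len2_gt0 hOm)|exact: onside_apex].
  by rewrite pmulr_lgt0// onside_apex.
have sE : tpos V j (V i) = - (s * p) / len2 V j.
  rewrite /tpos {1 2}VjE; congr (_ / _).
  by rewrite /p /GRing.scale /= /GRing.scale /=; ring.
have s0 : s = 0.
  apply/eqP; rewrite eq_le h1 andbT; move: h2; rewrite sE.
  by rewrite pmulr_lge0 ?invr_gt0 ?(len2_gt0 hOm)// oppr_ge0 pmulr_lle0.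
by rewrite VjE s0 scale0r addr0.
Qed.

End Flags.

(** * Sums over edges *)

Section Counting.
Context {R : realType}.

Lemma sum_bool (I : finType) (p : pred I) (F : I -> R) :
  \sum_(i | p i) F i = \sum_i (p i)%:R * F i.
Proof.
by rewrite big_mkcond; apply: eq_bigr => i _; case: (p i); rewrite ?mul1r ?mul0r.
Qed.

Lemma count_one (I : finType) (p : pred I) (i0 : I) : p i0 -> (forall i : I, p i -> i = i0) ->
  \sum_i (p i)%:R = 1 :> R.
Proof.
move=> pi u; rewrite (bigD1 i0)//= pi big1 ?addr0// => i ii0.
by case: (boolP (p i)) => // /u ie; rewrite ie eqxx in ii0.
Qed.

Lemma count_zero (I : finType) (p : pred I) : (forall i : I, ~~ p i) ->
  \sum_i (p i)%:R = 0 :> R.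
Proof. by move=> h; rewrite big1// => i _; rewrite (negbTE (h i)). Qed.

End Counting.

Section FlagSums.
Context {R : realType} {m : nat} (V : 'I_m -> R * R) (Om : set (R * R)).
Context (hOm : convex_polygonal_domain V Om).
Context {n : nat} (T : 'I_n -> 'I_3 -> R * R) (hT : triangulation Om T).
Implicit Types (x y z : R * R) (i j : 'I_m) (K L : 'I_n) (a b c : 'I_3)
  (f g : 'I_n * 'I_3).
Let D0 K := tdet_neq0 hT K.

Lemma flag_count f :
  \sum_g (neighbours T f g)%:R + \sum_i (onside V T i f)%:R = 1 :> R.
Proof.
have [[g fg]|[i fi]] := flag_dichotomy hOm hT f.
  rewrite (count_one fg) ?count_zero ?addr0// => [i|g' fg'].
    by apply/negP => fi; have := onside_no_neighbour hOm hT g fi; rewrite fg.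
  exact: (neighbours_uniq hT fg' fg).
rewrite (count_one (p := fun j => onside V T j f) fi) ?count_zero ?add0r// => [g|j fj].
  exact: (onside_no_neighbour hOm hT g fi).
exact: (onside_uniq hOm hT fj fi).
Qed.

(** An edge either has exactly one neighbour or lies on exactly one side, so
    what remains after pairing the neighbours is the boundary. *)
Lemma flag_sum (F : 'I_n * 'I_3 -> R) :
  (forall f g, neighbours T f g -> F f = - F g) ->
  \sum_f F f = \sum_i \sum_(f | onside V T i f) F f.
Proof.
move=> hF; pose X := \sum_f \sum_g (neighbours T f g)%:R * F f.
have X0 : X = 0.
  have : X = - X.
    rewrite {1}/X exchange_big/= /X -sumrN; apply: eq_bigr => g _.
    rewrite -sumrN; apply: eq_bigr => f _; rewrite neighbours_sym.
    by case: (boolP (neighbours T g f)) => [/hF ->|_]; rewrite ?mul1r ?mul0r ?oppr0 ?opprK.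
  by move=> /eqP; rewrite -addr_eq0 -mulr2n mulrn_eq0/= => /eqP.
under [RHS]eq_bigr do rewrite sum_bool.
rewrite [RHS]exchange_big/=; transitivity (\sum_f F f - X); first by rewrite X0 subr0.
rewrite /X -sumrB; apply: eq_bigr => f _.
rewrite -!mulr_suml; apply/eqP; rewrite subr_eq -mulrDl [X in X * _]addrC.
by rewrite flag_count mul1r.
Qed.

(** An edge lies on at most one side. *)
Lemma sum_onside_le (F : 'I_n * 'I_3 -> R) : (forall f, 0 <= F f) ->
  \sum_i \sum_(f | onside V T i f) F f <= \sum_f F f.
Proof.
move=> F0; under eq_bigr do rewrite sum_bool.
rewrite exchange_big/=; apply: ler_sum => f _; rewrite -mulr_suml ler_piMl//.
by rewrite -[leRHS](flag_count f) lerDr; apply: sumr_ge0.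
Qed.

(** End points of an edge in counterclockwise order around the element. *)
Definition src f := if 0 < tdet (T f.1) then ea T f else eb T f.
Definition tgt f := if 0 < tdet (T f.1) then eb T f else ea T f.

Lemma neighbours_reverse f g : neighbours T f g ->
  src f = tgt g /\ tgt f = src g.
Proof.
move=> fg; have := neighbours_opposite hT fg; rewrite /lam.
have Df := D0 f.1; have Dg := D0 g.1.
rewrite -/(ea T f) -/(eb T f) /src /tgt.
have gE : tdet (T g.1) = cross (ea T g - apex T g) (eb T g - apex T g).
  by rewrite (tdetE _ g.2).
move: fg => /andP[_ /orP[]] /andP[/eqP hA /eqP hB]; rewrite hA hB.
  rewrite -gE; have [f0|f0] := ltrP 0 (tdet (T f.1)).
    by rewrite pmulr_llt0 ?invr_gt0// ltNge => g0; rewrite (lt_gtF (_ : tdet (T g.1) < 0)) ?ltNge.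
  have f1 : tdet (T f.1) < 0 by rewrite lt_neqAle Df.
  by rewrite nmulr_llt0 ?invr_lt0// => ->.
have -> : cross (eb T g - apex T g) (ea T g - apex T g) = - tdet (T g.1).
  by rewrite gE /cross; ring.
have [f0|f0] := ltrP 0 (tdet (T f.1)).
  by rewrite pmulr_llt0 ?invr_gt0// oppr_lt0 => ->.
have f1 : tdet (T f.1) < 0 by rewrite lt_neqAle Df.
by rewrite nmulr_llt0 ?invr_lt0// oppr_gt0 => g1; rewrite lt_gtF.
Qed.

Definition tm i f := tpos V i (src f).
Definition tp i f := tpos V i (tgt f).

Lemma vertex_closure K a : closure Om (T K a).
Proof. by apply: (elt_closure hT); exact: (vertex_elt hT). Qed.

Lemma onside_src i f : onside V T i f -> ell V i (src f) = 0 /\ ell V i (tgt f) = 0.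
Proof. by rewrite /src /tgt => /andP[/eqP h1 /eqP h2]; case: ifP. Qed.

Lemma src_param i f : onside V T i f -> side_param V i (tm i f) = src f.
Proof. by move=> /onside_src[h _]; exact: (param_tpos hOm h). Qed.

Lemma tgt_param i f : onside V T i f -> side_param V i (tp i f) = tgt f.
Proof. by move=> /onside_src[_ h]; exact: (param_tpos hOm h). Qed.

Lemma on_side_tpos i x : closure Om x -> ell V i x = 0 -> 0 <= tpos V i x <= 1.
Proof.
move=> cx e0; have [t /= + <-] := line_closure_side hOm cx e0.
by rewrite in_itv/= (tpos_param hOm).
Qed.

Lemma tm_ge0 i f : onside V T i f -> 0 <= tm i f /\ tp i f <= 1.
Proof.
move=> fi; have [h1 h2] := onside_src fi; split.
  have /andP[] // : 0 <= tpos V i (src f) <= 1.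
  by apply: on_side_tpos => //; rewrite /src; case: ifP => _; exact: vertex_closure.
have /andP[] // : 0 <= tpos V i (tgt f) <= 1.
by apply: on_side_tpos => //; rewrite /tgt; case: ifP => _; exact: vertex_closure.
Qed.

(** The domain lies to the left of its sides, so counterclockwise edges run in
    the direction of the side. *)
Lemma tm_lt_tp i f : onside V T i f -> tm i f < tp i f.
Proof.
move=> fi; have e0 := onside_apex hOm hT fi.
have sE := src_param fi; have tE := tgt_param fi.
have : 0 < cross (tgt f - src f) (apex T f - src f).
  have -> : cross (tgt f - src f) (apex T f - src f) = `|tdet (T f.1)|.
    rewrite /src /tgt; have DE : tdet (T f.1) = cross (ea T f - apex T f) (eb T f - apex T f).
      by rewrite (tdetE _ f.2).
    case: ltrP => h; [rewrite gtr0_norm//|rewrite ler0_norm//]; rewrite DE /cross /=; ring.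
  by rewrite normr_gt0.
have -> : cross (tgt f - src f) (apex T f - src f) = (tp i f - tm i f) * ell V i (apex T f).
  by rewrite -sE -tE /ell /side_param /cross /GRing.scale /= /GRing.scale /=; ring.
by rewrite pmulr_lgt0// subr_gt0.
Qed.

Lemma lam_side_param K c i (s t u : R) :
  lam (T K) c (side_param V i (s + u * (t - s))) =
  (1 - u) * lam (T K) c (side_param V i s) + u * lam (T K) c (side_param V i t).
Proof.
pose w (b : bool) := if b then u else 1 - u.
pose q (b : bool) := side_param V i (if b then t else s).
have -> : side_param V i (s + u * (t - s)) = \sum_b w b *: q b.
  rewrite big_bool /w /q /side_param; apply: pairE;
    rewrite /GRing.scale /= /GRing.scale /=; ring.
rewrite lam_affine; first by rewrite big_bool /= addrC.
by rewrite big_bool /= addrC subrK.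
Qed.

Lemma lam_src_tgt f c : lam (T f.1) c (src f) + lam (T f.1) c (tgt f) =
  (c != f.2)%:R /\ 0 <= lam (T f.1) c (src f) /\ 0 <= lam (T f.1) c (tgt f).
Proof.
have [n1 n2 n3] := neqI3 f.2.
suff H : lam (T f.1) c (ea T f) + lam (T f.1) c (eb T f) = (c != f.2)%:R.
  rewrite /src /tgt; case: ifP => _; (split; [by rewrite ?H// addrC H|]);
    by rewrite !lam_vertex//.
rewrite !lam_vertex//; case: (I3_cases f.2 c) => ->.
- by rewrite eqxx/= !(eq_sym f.2) (negbTE n1) (negbTE n2) addr0.
- by rewrite eqxx n1 (negbTE n3) addr0.
- by rewrite eqxx n2 eq_sym (negbTE n3) add0r.
Qed.

Lemma onside_lam_apex i f t : onside V T i f ->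
  lam (T f.1) f.2 (side_param V i t) = 0.
Proof.
move=> fi; have := onside_ell hT (side_param V i t) fi; rewrite ell_param0.
move=> /esym/eqP; rewrite mulf_eq0 (gt_eqF (onside_apex hOm hT fi)) orbF.
by move=> /eqP.
Qed.

Lemma edge_inner i f t : onside V T i f -> tm i f < t < tp i f ->
  forall c, c != f.2 -> 0 < lam (T f.1) c (side_param V i t).
Proof.
move=> fi /andP[t1 t2] c cf; have d0 : 0 < tp i f - tm i f by rewrite subr_gt0 tm_lt_tp.
pose u := (t - tm i f) / (tp i f - tm i f).
have tE : t = tm i f + u * (tp i f - tm i f) by rewrite divfK ?gt_eqF// addrC subrK.
have u0 : 0 < u by rewrite divr_gt0// subr_gt0.
have u1 : u < 1 by rewrite ltr_pdivrMr// mul1r ltrD2r.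
rewrite tE lam_side_param src_param// tgt_param//.
have [h1 [h2 h3]] := lam_src_tgt f c; rewrite cf in h1.
have [e|e] := eqVneq (lam (T f.1) c (src f)) 0.
  rewrite e mulr0 add0r; move: h1; rewrite e add0r => ->.
  by rewrite mulr1.
apply: ltr_wpDr; first by rewrite mulr_ge0// ltW.
by rewrite mulr_gt0 ?subr_gt0// lt_neqAle eq_sym e.
Qed.

Lemma src_elt f : elt T f.1 (src f).
Proof.
by rewrite /src; case: (0 < tdet (T f.1)); exact: (vertex_elt hT).
Qed.

Lemma tgt_elt f : elt T f.1 (tgt f).
Proof.
by rewrite /tgt; case: (0 < tdet (T f.1)); exact: (vertex_elt hT).
Qed.

Lemma edge_elt i f t : onside V T i f -> tm i f <= t <= tp i f ->
  elt T f.1 (side_param V i t).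
Proof.
move=> fi /andP[t1 t2].
move: t1; rewrite le_eqVlt => /predU1P[<-|t1].
  by rewrite src_param//; exact: src_elt.
move: t2; rewrite le_eqVlt => /predU1P[->|t2].
  by rewrite tgt_param//; exact: tgt_elt.
apply/(eltP hT) => c; have [->|cf] := eqVneq c f.2; first by rewrite (onside_lam_apex t fi).
by apply/ltW/(edge_inner fi) => //; rewrite t1.
Qed.

(** Some element covers the point; the point is no vertex of it and the
    element cannot cross the side, so it is an inner point of an edge. *)
Lemma side_covered i t : 0 <= t <= 1 ->
  (forall K a, side_param V i t <> T K a) ->
  exists f, onside V T i f /\ tm i f < t < tp i f.
Proof.
move=> t01 nv; set x := side_param V i t.
have sx : side V i x by exists t => //; rewrite /= in_itv.
have [K Kx] := closure_elt hT (side_closure hOm sx).1.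
have l0 := iffLR (eltP hT _ _) Kx.
have [a ha] := elt_nonflat hOm hT i K.
have z c : lam (T K) c x = 0 \/ ell V i (T K c) = 0.
  have := ell_side sx; rewrite (ell_lam V hT i K) => /eqP.
  rewrite psumr_eq0 => [/allP/(_ c (mem_index_enum _))|d _]; last first.
    by rewrite mulr_ge0// (elt_ell_ge0 hOm hT).
  by rewrite mulf_eq0 => /orP[] /eqP ->; [left|right].
have la : lam (T K) a x = 0 by case: (z a) => // e; rewrite e eqxx in ha.
have s1 := lam_sum x (D0 K); rewrite (sumI3 _ a) la add0r in s1.
have [n1 n2 n3] := neqI3 a.
have xE := lam_combination x (D0 K); rewrite (sumI3 _ a) la scale0r add0r in xE.
have l1 : lam (T K) (a + 1) x != 0.
  apply/eqP => e; rewrite e add0r in s1; rewrite e s1 scale0r add0r scale1r in xE.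
  exact: (nv K (a + 2%:R)).
have l2 : lam (T K) (a + 2%:R) x != 0.
  apply/eqP => e; rewrite e addr0 in s1; rewrite e s1 scale0r addr0 scale1r in xE.
  exact: (nv K (a + 1)).
have fi : onside V T i (K, a).
  rewrite /onside /ea /eb /=; case: (z (a + 1)) => [/eqP|->]; first by rewrite (negbTE l1).
  by case: (z (a + 2%:R)) => [/eqP|->]; rewrite ?(negbTE l2)// eqxx.
exists (K, a); split => //.
have t12 := tm_lt_tp fi.
have tE : t = lam (T K) (a + 1) x * tpos V i (ea T (K, a)) +
              lam (T K) (a + 2%:R) x * tpos V i (eb T (K, a)).
  rewrite -[LHS](tpos_param hOm i) -/x -{1}xE /tpos -/(ea T (K, a)).
  rewrite -/(eb T (K, a)) !mulrA -mulrDl; congr (_ / _).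
  have -> : lam (T K) (a + 2%:R) x = 1 - lam (T K) (a + 1) x by rewrite -s1 addrAC subrr add0r.
  by rewrite /GRing.scale /= /GRing.scale /=; ring.
move: t12; rewrite tE /tm /tp /src /tgt.
have p1 : 0 < lam (T K) (a + 1) x by rewrite lt_neqAle eq_sym l1 l0.
have p2 : 0 < lam (T K) (a + 2%:R) x by rewrite lt_neqAle eq_sym l2 l0.
have e2 : lam (T K) (a + 2%:R) x = 1 - lam (T K) (a + 1) x by rewrite -s1 addrAC subrr add0r.
rewrite !e2 in p2 *; move: p1 p2.
by case: ifP => _; set u := lam _ _ _; set A := tpos _ _ _; set B := tpos _ _ _;
  move=> p1 p2 AB; apply/andP; split; nra.
Qed.

Lemma side_cover_uniq i f g t : onside V T i f -> onside V T i g ->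
  (forall K a, side_param V i t <> T K a) ->
  tm i f <= t <= tp i f -> tm i g <= t <= tp i g -> f = g.
Proof.
move=> fi gi nv tf tg.
have [E|N] := eqVneq f.1 g.1.
  case: f g E fi gi tf tg => K a [L b] /= E; rewrite -{}E {L} => fi gi _ _.
  congr pair; apply/eqP; apply: contraT => ab.
  have := onside_apex hOm hT gi; rewrite /apex /=.
  move: fi => /andP[]; rewrite /ea /eb /=.
  case: (I3_cases a b) ab => ->; first by rewrite eqxx.
    by move=> _ /eqP -> _; rewrite ltxx.
  by move=> _ _ /eqP ->; rewrite ltxx.
have strict : tm i f < t < tp i f.
  move: tf => /andP[]; rewrite le_eqVlt => /predU1P[E|->] /=.
    exfalso; move: (src_param fi); rewrite E /src; case: ifP => _ h; exact: (nv _ _ h).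
  rewrite le_eqVlt => /predU1P[E|//].
  exfalso; move: (tgt_param fi); rewrite -E /tgt; case: ifP => _ h; exact: (nv _ _ h).
have [n1 n2 n3] := neqI3 f.2.
have [b fb] := common_edge hT N (edge_elt fi tf) (edge_elt gi tg)
  (edge_inner fi strict n1) (edge_inner fi strict n2).
by have := onside_no_neighbour hOm hT (g.1, b) fi; rewrite fb.
Qed.

(** This is where the patches enter: their traces partition the sides. A
    boundary edge of an element lies in the trace of the patch of that
    element. A third vertex on the boundary would belong to this trace, hence
    to the same side, and the element would be flat. *)
Lemma apex_interior n_min n_max (c_1 c_2 : R) i f :
  patch_assumption V Om T n_min n_max c_1 c_2 ->
  onside V T i f -> Om (apex T f).
Proof.
move=> [P [_ _ _ hP]] fi; have t12 := tm_lt_tp fi.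
pose t := (tm i f + tp i f) / 2; set x := side_param V i t.
have tt : tm i f < t < tp i f.
  by rewrite /t ltr_pdivlMr// ltr_pdivrMr//; apply/andP; split; lra.
have [t0 t1] := tm_ge0 fi.
have sx : side V i x.
  exists t => //; rewrite /= in_itv/=; move: tt => /andP[h1 h2].
  by rewrite (le_trans t0 (ltW h1)) (le_trans (ltW h2) t1).
have [J [_ _ sE _]] := hP i.
have : (\bigcup_(B in [set` J]) patch_trace Om T B) x by rewrite -sE.
move=> [B BJ [[cB _] _]].
have clB : closed (Defs.patch T B).
  apply: closed_bigcup => [|K _]; last exact: (closed_elt hT).
  exact: finite_finset.
have [L LB Lx] : Defs.patch T B x by rewrite (iffLR (closure_id _) clB).
have tt' : tm i f <= t <= tp i f by case/andP: tt => h1 h2; rewrite !ltW.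
have fB : f.1 \in B.
  have [->//|N] := eqVneq f.1 L.
  have [n1 n2 n3] := neqI3 f.2.
  have [b fb] := common_edge hT N (edge_elt fi tt') Lx
    (edge_inner fi tt n1) (edge_inner fi tt n2).
  by have := onside_no_neighbour hOm hT (L, b) fi; rewrite fb.
apply: contrapT => nO.
have ca : closure Om (apex T f) by exact: vertex_closure.
have [j sj] := closureD_side hOm ca nO.
suff /ell_side : side V i (apex T f).
  by have := onside_apex hOm hT fi => /[swap] ->; rewrite ltxx.
rewrite sE; exists B => //; split; last first.
  by split => //; rewrite (iffLR (interior_id _) (open_Om hOm)).
split; first by apply: subset_closure; exists f.1 => //; exact: (vertex_elt hT).
(* the half-plane of the side [j] is left along its outward normal *)
move=> na; have [e e0 he] := ray_near ((side_vec V j).2, - (side_vec V j).1) na.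
have [L' _ /(elt_closure hT)/(ell_ge0 hOm j)] := he e ltac:(by rewrite lexx ltW).
have -> : ell V j (apex T f + e *: ((side_vec V j).2, - (side_vec V j).1)) =
    ell V j (apex T f) - e * len2 V j.
  by rewrite /ell /len2 /cross /GRing.scale /= /GRing.scale /=; ring.
by rewrite (ell_side sj) sub0r oppr_ge0 leNgt mulr_gt0// (len2_gt0 hOm).
Qed.

End FlagSums.

(** * Polynomials in two variables *)

Section Derivatives.
Context {R : realType}.
Implicit Types f g : R -> R.

Definition dv f (f' : R -> R) := forall t : R, is_derive t 1 f (f' t).

Lemma dv_eq f g (f' g' : R -> R) : (forall t, f t = g t) -> (forall t, f' t = g' t) ->
  dv f f' -> dv g g'.
Proof. by move=> /funext -> /funext ->. Qed.

Lemma dv_cst (c : R) : dv (fun _ => c) (fun _ => 0).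
Proof. by move=> t; exact: is_derive_cst. Qed.

Lemma dv_id : dv (fun t => t) (fun _ => 1).
Proof. by move=> t; exact: is_derive_id. Qed.

Lemma dv_add f g (f' g' : R -> R) : dv f f' -> dv g g' ->
  dv (fun t => f t + g t) (fun t => f' t + g' t).
Proof. by move=> hf hg t; apply: is_deriveD. Qed.

Lemma dv_mul f g (f' g' : R -> R) : dv f f' -> dv g g' ->
  dv (fun t => f t * g t) (fun t => f' t * g t + f t * g' t).
Proof.
move=> hf hg t; apply: (is_derive_eq (is_deriveM (hf t) (hg t))).
by rewrite addrC /GRing.scale /= [g t * _]mulrC.
Qed.

Lemma dv_exp f f' n : dv f f' ->
  dv (fun t => f t ^+ n) (fun t => n%:R * f t ^+ n.-1 * f' t).
Proof.
move=> hf; elim: n => [|n IH].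
  apply: (dv_eq _ _ (dv_cst 1)) => t; rewrite ?expr0 ?mul0r//.
apply: (dv_eq _ _ (dv_mul hf IH)) => t; first by rewrite exprS.
rewrite /=; case: n {IH} => [|n]; rewrite ?expr0 ?mul0r ?mulr0 ?addr0 ?mul1r ?mulr1//.
by rewrite /= exprS [n.+2%:R]mulrS; ring.
Qed.

Lemma dv_sum (I : Type) (s : seq I) (F F' : I -> R -> R) :
  (forall i, dv (F i) (F' i)) ->
  dv (fun t => \sum_(i <- s) F i t) (fun t => \sum_(i <- s) F' i t).
Proof.
move=> h; elim: s => [|i s IH].
  by apply: (dv_eq _ _ (dv_cst 0)) => t; rewrite big_nil.
by apply: (dv_eq _ _ (dv_add (h i) IH)) => t; rewrite big_cons.
Qed.

Lemma dv_continuous f f' : dv f f' -> continuous f.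
Proof.
move=> h x; apply: differentiable_continuous; apply/derivable1_diffP.
by have := h x.
Qed.

End Derivatives.

Section Polynomials.
Context {R : realType}.
Implicit Types (k : nat) (c d : nat -> nat -> R) (x y v : R * R) (f g : R * R -> R).

(** Bounding the degree in each coordinate separately is stable under partial
    derivatives, and the restrictions to lines parallel to the axes have
    degree at most [k]. *)
Definition pol k c x : R := \sum_(i < k.+1) \sum_(j < k.+1) c i j * x.1 ^+ i * x.2 ^+ j.

Definition p2 k f := exists c, f = pol k c.

Lemma p2_add k f g : p2 k f -> p2 k g -> p2 k (fun x => f x + g x).
Proof.
move=> [c ->] [d ->]; exists (fun i j => c i j + d i j); apply/funext => x.
rewrite /pol -big_split; apply: eq_bigr => i _; rewrite -big_split.
by apply: eq_bigr => j _; rewrite !mulrDl.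
Qed.

Lemma p2_scale k (r : R) f : p2 k f -> p2 k (fun x => r * f x).
Proof.
move=> [c ->]; exists (fun i j => r * c i j); apply/funext => x.
rewrite /pol mulr_sumr; apply: eq_bigr => i _; rewrite mulr_sumr.
by apply: eq_bigr => j _; rewrite !mulrA.
Qed.

Lemma poly_on_p2 k (A : set (R * R)) f : poly_on k A f ->
  exists2 g, p2 k g & forall x, A x -> f x = g x.
Proof.
move=> [c hc]; exists (pol k (fun i j => if (i + j <= k)%N then c i j else 0)).
  by eexists.
move=> x Ax; rewrite hc// /pol; apply: eq_bigr => i _; rewrite big_mkcond.
by apply: eq_bigr => j _; case: ifP; rewrite ?mul0r.
Qed.

Lemma pol_continuous k c : continuous (pol k c).
Proof.
rewrite /pol; apply: ct_sum => i; apply: ct_sum => j; continuity.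
Qed.

Lemma p2_continuous k f : p2 k f -> continuous f.
Proof. by move=> [c ->]; exact: pol_continuous. Qed.

Definition cdx k c i j : R := if (i < k)%N then i.+1%:R * c i.+1 j else 0.
Definition cdy k c i j : R := if (j < k)%N then j.+1%:R * c i j.+1 else 0.

Lemma cdxy k c : cdx k (cdy k c) = cdy k (cdx k c).
Proof.
apply/funext => i; apply/funext => j; rewrite /cdx /cdy.
by case: ifP => _; case: ifP => _; rewrite ?mulr0//; ring.
Qed.

Lemma sum_shift k (u : R) (w : nat -> R) :
  \sum_(i < k.+1) w i * (i%:R * u ^+ i.-1) =
  \sum_(i < k.+1) (if (i < k)%N then i.+1%:R * w i.+1 else 0) * u ^+ i.
Proof.
rewrite big_ord_recl mul0r mulr0 add0r big_ord_recr /= ltnn mul0r addr0.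
by apply: eq_bigr => i _; rewrite ltn_ord /= /bump /= add1n /= mulrCA mulrA.
Qed.

Lemma pol_line k c x v :
  dv (fun t => pol k c (x.1 + t * v.1, x.2 + t * v.2))
     (fun t => v.1 * pol k (cdx k c) (x.1 + t * v.1, x.2 + t * v.2) +
               v.2 * pol k (cdy k c) (x.1 + t * v.1, x.2 + t * v.2)).
Proof.
have line (a b : R) : dv (fun t => a + t * b) (fun _ => b).
  apply: (dv_eq _ _ (dv_add (dv_cst a) (dv_mul dv_id (dv_cst b)))) => t //.
  by rewrite mulr0 addr0 add0r mul1r.
have lx := line x.1 v.1; have ly := line x.2 v.2.
have H := dv_sum (index_enum 'I_k.+1) (fun i => dv_sum (index_enum 'I_k.+1) (fun j =>
  dv_mul (dv_mul (dv_cst (c i j)) (dv_exp i lx)) (dv_exp j ly))).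
apply: (dv_eq _ _ H) => t //; rewrite /pol /=.
set X := x.1 + _; set Y := x.2 + _.
transitivity (v.1 * (\sum_(j < k.+1) (\sum_(i < k.+1) c i j * (i%:R * X ^+ i.-1)) * Y ^+ j) +
              v.2 * (\sum_(i < k.+1) X ^+ i * \sum_(j < k.+1) c i j * (j%:R * Y ^+ j.-1))).
  under [X in v.1 * X + _]eq_bigr do rewrite mulr_suml.
  under [X in _ + v.2 * X]eq_bigr do rewrite mulr_sumr.
  rewrite [X in v.1 * X]exchange_big/= !mulr_sumr -big_split; apply: eq_bigr => i _.
  rewrite /= !mulr_sumr -big_split; apply: eq_bigr => j _ /=; ring.
congr (v.1 * _ + v.2 * _).
  rewrite exchange_big/=; apply: eq_bigr => j _.
  by rewrite (sum_shift k X (c ^~ j)) mulr_suml.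
apply: eq_bigr => i _; rewrite (sum_shift k Y (c i)) mulr_sumr.
by apply: eq_bigr => j _; rewrite /cdy; ring.
Qed.

Lemma is_derive_line f x v (l : R) :
  is_derive (0 : R) 1 (fun t => f (x.1 + t * v.1, x.2 + t * v.2)) l ->
  is_derive x v f l.
Proof.
move=> h; have E : (fun t : R => t^-1 *: ((f \o shift x) (t *: v) - f x)) =
  (fun t : R => t^-1 *: (((fun t => f (x.1 + t * v.1, x.2 + t * v.2)) \o shift (0 : R)) (t *: (1 : R)) -
     f (x.1 + 0 * v.1, x.2 + 0 * v.2))).
  apply/funext => t; congr (_ *: (f _ - f _)); apply: pairE;
    rewrite /GRing.scale /= /GRing.scale /=; ring.
case: h => h1 h2; constructor; first by rewrite /derivable E.
by rewrite /derive E.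
Qed.

Lemma partial0_pol k c x : is_derive x (unit_vec 0) (pol k c) (pol k (cdx k c) x).
Proof.
apply: is_derive_line; apply: (is_derive_eq (pol_line k c x (unit_vec 0) 0)).
by rewrite /unit_vec /= mul1r !mul0r !addr0 -surjective_pairing.
Qed.

Lemma partial1_pol k c x : is_derive x (unit_vec 1) (pol k c) (pol k (cdy k c) x).
Proof.
apply: is_derive_line; apply: (is_derive_eq (pol_line k c x (unit_vec 1) 0)).
by rewrite /unit_vec /= mul1r !mul0r !addr0 add0r -surjective_pairing.
Qed.

Lemma partial_p2 k f j : p2 k f -> p2 k (partial j f) /\
  forall x, is_derive x (unit_vec j) f (partial j f x).
Proof.
move=> [c ->]; have [->|->] : j = 0 \/ j = 1.
  by case: j => -[|[|//]] ij; [left|right]; apply/val_inj.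
  have D := partial0_pol k c; split.
    exists (cdx k c); apply/funext => x; rewrite /partial.
    by have := D x => ?; exact: derive_val.
  by move=> x; rewrite /partial; have := D x => ?; rewrite derive_val.
have D := partial1_pol k c; split.
  exists (cdy k c); apply/funext => x; rewrite /partial.
  by have := D x => ?; exact: derive_val.
by move=> x; rewrite /partial; have := D x => ?; rewrite derive_val.
Qed.

Lemma partial_comm k f x : p2 k f -> partial 1 (partial 0 f) x = partial 0 (partial 1 f) x.
Proof.
move=> [c ->].
have E0 d : partial 0 (pol k d) = pol k (cdx k d).
  by apply/funext => y; rewrite /partial; have := partial0_pol k d y => ?; exact: derive_val.
have E1 d : partial 1 (pol k d) = pol k (cdy k d).
  by apply/funext => y; rewrite /partial; have := partial1_pol k d y => ?; exact: derive_val.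
by rewrite !(E0, E1) cdxy.
Qed.

Lemma p2_line k f x v : p2 k f ->
  dv (fun t => f (x.1 + t * v.1, x.2 + t * v.2))
     (fun t => v.1 * partial 0 f (x.1 + t * v.1, x.2 + t * v.2) +
               v.2 * partial 1 f (x.1 + t * v.1, x.2 + t * v.2)).
Proof.
move=> [c ->]; apply: (dv_eq _ _ (pol_line k c x v)) => t //.
rewrite /partial; congr (_ * _ + _ * _).
  by have := partial0_pol k c (x.1 + t * v.1, x.2 + t * v.2) => ?; rewrite derive_val.
by have := partial1_pol k c (x.1 + t * v.1, x.2 + t * v.2) => ?; rewrite derive_val.
Qed.

Lemma p2_row k f (y : R) : p2 k f ->
  exists2 q : {poly R}, (size q <= k.+1)%N & forall t, f (t, y) = q.[t].
Proof.
move=> [c ->]; exists (\poly_(i < k.+1) (\sum_(j < k.+1) c i j * y ^+ j)).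
  exact: size_poly.
move=> t; rewrite horner_poly /pol /=; apply: eq_bigr => i _.
by rewrite mulr_suml; apply: eq_bigr => j _; ring.
Qed.

Lemma p2_col k f (x : R) : p2 k f ->
  exists2 q : {poly R}, (size q <= k.+1)%N & forall t, f (x, t) = q.[t].
Proof.
move=> [c ->]; exists (\poly_(j < k.+1) (\sum_(i < k.+1) c i j * x ^+ i)).
  exact: size_poly.
move=> t; rewrite horner_poly /pol /= exchange_big /=; apply: eq_bigr => j _.
by rewrite mulr_suml; apply: eq_bigr => i _; ring.
Qed.

End Polynomials.

(** * Inverse inequality for polynomials *)

Section InverseInequality.
Context {R : realType}.
Local Notation P := (measurableTypeR R * measurableTypeR R)%type.
Local Notation leb := (@lebesgue_measure R).

(** Newton interpolation: dividing out one node at a time, the separation of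
    the nodes controls the divided differences. *)
Lemma interpolation_bound k (d M : R) : 0 < d -> 0 <= M ->
  exists2 C : R, 0 < C & forall (q : {poly R}), (size q <= k.+1)%N ->
  forall (s : R) (t : nat -> R) (y e : R), 0 < s -> 0 <= e ->
    (forall i j, (i < j <= k)%N -> d * s <= `|t j - t i|) ->
    (forall i, (i <= k)%N -> `|y - t i| <= M * s) ->
    (forall i, (i <= k)%N -> `|q.[t i]| <= e) -> `|q.[y]| <= C * e.
Proof.
move=> d0 M0; elim: k => [|k [C C0 IH]].
  exists 1; first exact: ltr01.
  move=> q /size1_polyC -> s t y e _ _ _ _ /(_ 0%N isT).
  by rewrite !hornerC mul1r.
exists (1 + M * (C * (2 / d))) => [|q sq s t y e s0 e0 td ty qe].
  by rewrite ltr_wpDr// mulr_ge0// mulr_ge0 ?divr_ge0// ltW.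
have : root (q - (q.[t 0%N])%:P) (t 0%N) by rewrite /root !hornerE subrr.
move=> /factor_theorem[q1 qE].
have sq1 : (size q1 <= k.+1)%N.
  have [->|q10] := eqVneq q1 0; first by rewrite size_poly0.
  have : (size (q - (q.[t 0%N])%:P)%R <= k.+2)%N.
    by rewrite (leq_trans (size_polyD _ _))// geq_max sq size_polyN (leq_trans (size_polyC_leq1 _)).
  by rewrite qE size_Mmonic ?monicXsubC// size_XsubC addn2.
have qh x : q.[x] = q.[t 0%N] + q1.[x] * (x - t 0%N).
  by have := congr1 (horner^~ x) qE; rewrite !hornerE => <-; rewrite addrC subrK.
have e1 : 0 <= 2 * e / (d * s) by rewrite divr_ge0 ?mulr_ge0// ltW// mulr_gt0.
have := IH q1 sq1 s (fun i => t i.+1) y _ s0 e1.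
have h1 i j : (i < j <= k)%N -> d * s <= `|t j.+1 - t i.+1| by move=> ij; exact: td.
have h2 i : (i <= k)%N -> `|y - t i.+1| <= M * s by move=> ik; exact: ty.
move=> /(_ h1 h2) H.
have {}H : `|q1.[y]| <= C * (2 * e / (d * s)).
  apply: H => i ik; have := td 0%N i.+1 ik.
  have ds : 0 < d * s by rewrite mulr_gt0.
  move=> dist; rewrite ler_pdivlMr//; apply: (@le_trans _ _ (`|q1.[t i.+1] * (t i.+1 - t 0%N)|)).
    by rewrite normrM ler_wpM2l.
  have -> : q1.[t i.+1] * (t i.+1 - t 0%N) = q.[t i.+1] - q.[t 0%N] by rewrite (qh (t i.+1)) addrAC subrr add0r.
  by rewrite (le_trans (ler_normB _ _))// mulr_natl mulr2n lerD ?qe.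
rewrite (qh y) (le_trans (ler_normD _ _))// mulrDl mul1r lerD ?qe// normrM.
have yt := ty 0%N isT.
apply: (@le_trans _ _ (C * (2 * e / (d * s)) * (M * s))); first by rewrite ler_pM.
by rewrite le_eqVlt; apply/orP; left; apply/eqP; field; rewrite !gt_eqF.
Qed.

Lemma poly_continuous (q : {poly R}) : continuous (fun t => q.[t]).
Proof.
under eq_fun do rewrite horner_coef.
by apply: ct_sum => i; continuity.
Qed.

(** Take [k.+1] separated subintervals. Unless the polynomial stays comparable
    with its value at [y] on one of them, each contains a point where it is
    much smaller, and interpolating at these points bounds the value at [y] by
    half of itself. *)
Lemma inverse_1d k (M : R) : 0 <= M -> exists2 C : R, 0 < C &
  forall (q : {poly R}), (size q <= k.+1)%N -> forall (a s y : R), 0 < s ->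
    `|y - a| <= M * s ->
    s * q.[y] ^+ 2 <= C * \int[leb]_(t in `[a, a + s]) (q.[t] ^+ 2).
Proof.
move=> M0; pose N : R := (2 * k + 2)%:R.
have N0 : 0 < N by rewrite ltr0n addn2.
have Ni0 : 0 < N^-1 by rewrite invr_gt0.
have M1 : 0 <= M + 1 by rewrite addr_ge0.
have [C C0 hC] := interpolation_bound k Ni0 M1.
exists (N * (2 * C) ^+ 2); first by rewrite mulr_gt0// exprn_gt0// mulr_gt0.
move=> q sq a s y s0 ya; set S := `|q.[y]|.
have Sge0 : 0 <= S by exact: normr_ge0.
have cq : continuous (fun t => q.[t] ^+ 2).
  by apply: ct_exp; exact: poly_continuous.
pose lo i : R := a + (2 * i)%:R * s / N.
pose hi i : R := a + (2 * i + 1)%:R * s / N.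
have [i [ik hi0]] : exists i, (i <= k)%N /\
    forall t, lo i <= t <= hi i -> S <= 2 * C * `|q.[t]|.
  apply: contrapT => no.
  have ex i : exists t, (i <= k)%N -> lo i <= t <= hi i /\ 2 * C * `|q.[t]| < S.
    have [ik|ik] := boolP (i <= k)%N; last by exists 0.
    apply: contrapT => nt; apply: no; exists i; split => // t ti.
    by rewrite leNgt; apply/negP => h; apply: nt; exists t.
  have [t ht] := choice ex.
  have S0 : 0 < S.
    have [_] := ht 0%N isT; apply: le_lt_trans.
    by rewrite mulr_ge0// mulr_ge0// ltW.
  have C2 : 0 < 2 * C by rewrite mulr_gt0.
  have : S <= C * (S / (2 * C)).
    apply: (hC q sq s t y _ s0).
    - by rewrite divr_ge0// ltW.
    - move=> i j /andP[ij jk]; have [/andP[ti1 ti2] _] := ht i (ltnW (leq_trans ij jk)).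
      have [/andP[tj1 tj2] _] := ht j jk.
      apply: (@le_trans _ _ (t j - t i)); last exact: ler_norm.
      have : (2 * i + 1)%:R + 1 <= (2 * j)%:R :> R.
        by rewrite natr1 ler_nat addn1 -[(2 * i).+2]add2n -mulnS leq_mul2l.
      have sN : 0 < s / N by rewrite divr_gt0.
      rewrite mulrC; move: ti2 tj1; rewrite /lo /hi -!mulrA; nra.
    - move=> i ik; have [/andP[t1 t2] _] := ht i ik.
      rewrite (_ : y - t i = (y - a) + (a - t i)); last by rewrite addrA subrK.
      rewrite (le_trans (ler_normD _ _))// mulrDl lerD// mul1r.
      have l1 : a <= lo i by rewrite lerDl divr_ge0 ?(ltW N0)// mulr_ge0// ltW.
      have l2 : hi i <= a + s.
        rewrite lerD2l ler_pdivrMr// mulrC ler_wpM2l ?(ltW s0)// /N ler_nat.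
        by rewrite leq_add// leq_mul.
      by rewrite ler0_norm ?subr_le0 ?(le_trans l1)// opprB lerBlDr (le_trans t2)// addrC.
    - move=> i ik; have [_ h] := ht i ik.
      by rewrite ler_pdivlMr// mulrC ltW.
  by rewrite (_ : C * (S / (2 * C)) = S / 2); [lra|field; rewrite gt_eqF].
have l1 : a <= lo i by rewrite lerDl divr_ge0 ?(ltW N0)// mulr_ge0// ltW.
have l2 : hi i <= a + s.
  rewrite lerD2l ler_pdivrMr// mulrC ler_wpM2l ?(ltW s0)// /N ler_nat.
  by rewrite leq_add// leq_mul.
have lh : lo i <= hi i.
  by rewrite lerD2l ler_pM2r ?invr_gt0// ler_wpM2r ?(ltW s0)// ler_nat leq_addr.
have ge0 b c : 0 <= \int[leb]_(t in `[b, c]) (q.[t] ^+ 2).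
  by apply: Rintegral_ge0 => t _; exact: sqr_ge0.
rewrite (@Rintegral_itv_split _ _ a (lo i))//; last exact: le_trans l2.
rewrite (@Rintegral_itv_split _ _ (lo i) (hi i) (a + s))//.
have main : (hi i - lo i) * (S / (2 * C)) ^+ 2 <= \int[leb]_(t in `[lo i, hi i]) (q.[t] ^+ 2).
  have := @Rintegral_le_itv R (fun _ => (S / (2 * C)) ^+ 2) _ (lo i) (hi i) (@ct_cst _ _ _) cq.
  rewrite Rintegral_cst//= lebesgue_measure_itv/= lte_fin.
  have -> : fine (if lo i < hi i then ((hi i)%:E - (lo i)%:E)%E else 0%E) = hi i - lo i.
    case: ifP => //= /negbT; rewrite -leNgt => h.
    by apply/esym/eqP; rewrite subr_eq0 eq_le h lh.
  move=> H; rewrite mulrC; apply: H => t ti.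
  rewrite -[leRHS](real_normK (num_real _)) ler_pXn2r ?nnegrE ?divr_ge0 ?mulr_ge0 ?(ltW C0)//.
  by rewrite ler_pdivrMr ?mulr_gt0// mulrC hi0.
have -> : s * q.[y] ^+ 2 = N * (2 * C) ^+ 2 * ((hi i - lo i) * (S / (2 * C)) ^+ 2).
  rewrite /S expr_div_n (real_normK (num_real _)) /hi /lo natrD.
  have C1 := lt0r_neq0 C0; have N1 := lt0r_neq0 N0; clearbody N S.
  by field; rewrite C1 N1.
rewrite ler_pM2l; last by rewrite mulr_gt0// exprn_gt0// mulr_gt0.
by rewrite (le_trans main)// addrCA lerDl addr_ge0.
Qed.

Lemma le_fubini (Phi : R * R -> R) (A : set (R * R)) (g : R -> R) (a b c d : R) :
  continuous Phi -> (forall x, 0 <= Phi x) -> measurable (A : set P) -> inbox A ->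
  (forall x y, a <= x <= b -> c <= y <= d -> A (x, y)) -> continuous g ->
  (forall x, a <= x <= b -> g x <= \int[leb]_(y in `[c, d]) Phi (x, y)) ->
  \int[leb]_(x in `[a, b]) g x <= \int[area]_(z in A) Phi z.
Proof.
move=> cPhi P0 mA bA sA cg gle.
have iA : area.-integrable setT (EFin \o (Phi \_ A : P -> R)).
  rewrite -restrict_EFin; apply: (iffLR (integrable_mkcond _ mA)).
  exact: integrable_area.
have iF := integrable_fubini_F iA.
rewrite /Rintegral fine_le//.
- apply: integrable_fin_num => //; exact: integrable_itv.
- apply: integrable_fin_num => //; exact: integrable_area.
rewrite [leRHS]integral_mkcond restrict_EFin /area -(integral12_prod_meas1 iA).
rewrite integral_mkcond; apply: le_integral => //.
  apply: (iffLR (integrable_mkcond _ _)) => //.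
  exact: integrable_itv.
move=> x _; rewrite patchE /fubini_F; case: ifPn => [|_]; last first.
  by apply: integral_ge0 => y _; rewrite lee_fin patchE; case: ifP.
rewrite inE /= in_itv/= => xab.
have cx : continuous (fun y => Phi (x, y)).
  by apply: ct_comp => //; apply: continuous_pair; [move=> ?; exact: cvg_cst|exact: ct_id].
have if1 : (\int[leb]_(y in `[c, d]) (Phi (x, y))%:E)%E \is a fin_num.
  by apply: integrable_fin_num => //; exact: (integrable_itv c d cx).
apply: (@le_trans _ _ (\int[leb]_(y in `[c, d]) (Phi (x, y))%:E)%E).
  by rewrite -(fineK if1) lee_fin; exact: gle.
rewrite integral_mkcond; apply: ge0_le_integral => //.
- by move=> y _; rewrite patchE; case: ifP => // _; rewrite lee_fin.
- apply: (iffLR (measurable_restrictT _ _)) => //.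
  apply/measurable_EFinP; apply: measurable_funTS; exact: continuous_measurable_fun.
- have mx := measurable_int _ iA.
  exact: (measurableT_comp mx (measurable_pair1 x)).
move=> y _; rewrite patchE; case: ifPn => [|_].
  rewrite inE /= in_itv/= => ycd; rewrite lee_fin patchE ifT//.
  by rewrite inE; exact: sA.
by rewrite lee_fin patchE; case: ifP.
Qed.

(** The estimate in one variable, used along both coordinate directions. *)
Lemma inverse_2d k (M : R) : 0 <= M -> exists2 C : R, 0 < C &
  forall f, p2 k f -> forall (A : set (R * R)) (a b s : R) y,
    measurable (A : set P) -> inbox A -> 0 < s ->
    (forall u v, a <= u <= a + s -> b <= v <= b + s -> A (u, v)) ->
    `|y.1 - a| <= M * s -> `|y.2 - b| <= M * s ->
    s ^+ 2 * f y ^+ 2 <= C * \int[area]_(z in A) (f z ^+ 2).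
Proof.
move=> M0; have [C C0 hC] := inverse_1d k M0.
exists (C ^+ 2); first exact: exprn_gt0.
move=> f pf A a b s y mA bA s0 sA y1 y2.
have cf := p2_continuous pf.
have cf2 : continuous (fun z => f z ^+ 2) by continuity.
have [qy sqy hqy] := p2_row y.2 pf.
have h1 : s * f y ^+ 2 <= C * \int[leb]_(t in `[a, a + s]) (f (t, y.2) ^+ 2).
  rewrite [y]surjective_pairing hqy /=.
  under eq_Rintegral do rewrite hqy.
  exact: hC.
have h2 : \int[leb]_(t in `[a, a + s]) (s * C^-1 * f (t, y.2) ^+ 2) <=
    \int[area]_(z in A) (f z ^+ 2).
  apply: (@le_fubini _ _ _ a (a + s) b (b + s)) => //.
  - by move=> z; exact: sqr_ge0.
  - continuity.
  move=> x xa; have [qx sqx hqx] := p2_col x pf.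
  under eq_Rintegral do rewrite hqx.
  rewrite hqx mulrAC ler_pdivrMr// mulrC [leRHS]mulrC.
  by rewrite [leLHS]mulrC; exact: hC.
rewrite RintegralZl// in h2; last first.
  apply: (@integrable_itv _ (fun t => f (t, y.2) ^+ 2)).
  continuity.
apply: (@le_trans _ _ (s * (C * \int[leb]_(t in `[a, a + s]) (f (t, y.2) ^+ 2)))).
  by rewrite expr2 -mulrA ler_pM2l.
apply: (@le_trans _ _ (C ^+ 2 * (s * C^-1 * \int[leb]_(t in `[a, a + s]) (f (t, y.2) ^+ 2)))).
  rewrite le_eqVlt; apply/orP; left; apply/eqP.
  by field; rewrite gt_eqF.
by rewrite ler_pM2l// exprn_gt0.
Qed.

End InverseInequality.

(** * Green's formula on a triangle *)

Section GreenTriangle.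
Context {R : realType}.
Local Notation P := (measurableTypeR R * measurableTypeR R)%type.
Local Notation leb := (@lebesgue_measure R).
Implicit Types (p q r : R * R) (Phi dPhi : R * R -> R).

Definition eint Phi p q : R :=
  \int[leb]_(t in `[0, 1]) Phi (p.1 + t * (q.1 - p.1), p.2 + t * (q.2 - p.2)).

Lemma eint_sym Phi p q : continuous Phi -> eint Phi q p = eint Phi p q.
Proof.
move=> cPhi; rewrite /eint -[RHS]Rintegral_flip; last by continuity.
by apply: eq_Rintegral => t _; congr (Phi (_, _)); ring.
Qed.

(** Dividing by the determinant makes the definition independent of the
    orientation of the corners. *)
Definition otri p q r : set (R * R) := [set x |
  [/\ 0 < cross (q - x) (r - x) / cross (q - p) (r - p),
      0 < cross (r - x) (p - x) / cross (q - p) (r - p) &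
      0 < cross (p - x) (q - x) / cross (q - p) (r - p)]].

Lemma otri_rot p q r : otri p q r = otri q r p.
Proof.
rewrite /otri; have -> : cross (r - q) (p - q) = cross (q - p) (r - p) by rewrite /cross /=; ring.
by apply/seteqP; split => x [h1 h2 h3].
Qed.

Lemma otri_swap p q r : otri p q r = otri q p r.
Proof.
rewrite /otri; have -> : cross (p - q) (r - q) = - cross (q - p) (r - p) by rewrite /cross /=; ring.
have E x u v : cross (u - x) (v - x) / - cross (q - p) (r - p) =
    cross (v - x) (u - x) / cross (q - p) (r - p).
  by rewrite invrN mulrN -mulNr /cross /=; congr (_ / _); ring.
by apply/seteqP; split => x /=; rewrite !E => -[h1 h2 h3].
Qed.

Definition lineat p q (x : R) : R := p.2 + (x - p.1) / (q.1 - p.1) * (q.2 - p.2).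

Lemma cross_lineat p q x y : q.1 != p.1 ->
  cross (p - (x, y)) (q - (x, y)) = (q.1 - p.1) * (y - lineat p q x).
Proof. by move=> pq; rewrite /cross /lineat /=; field; rewrite subr_eq0. Qed.

Lemma lineat_int Phi p q : continuous Phi -> p.1 <= q.1 ->
  \int[leb]_(x in `[p.1, q.1]) Phi (x, lineat p q x) = (q.1 - p.1) * eint Phi p q.
Proof.
move=> cPhi; rewrite le_eqVlt => /predU1P[<-|pq].
  by rewrite set_itv1 Rintegral_set1 subrr mul0r.
rewrite Rintegral_affine ?ltW//; last by rewrite /lineat; continuity.
congr (_ * _); apply: eq_Rintegral => t _; congr (Phi (_, _)).
by rewrite /lineat; field; rewrite subr_eq0 gt_eqF.
Qed.

Lemma slice_int Phi dPhi (A : set (R * R)) (x lo hi : R) :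
  continuous dPhi -> dv (fun y => Phi (x, y)) (fun y => dPhi (x, y)) ->
  lo <= hi -> (forall y, A (x, y) <-> lo < y < hi) ->
  \int[leb]_y (dPhi \_ A) (x, y) = Phi (x, hi) - Phi (x, lo).
Proof.
move=> cd dP lohi hA.
have cdx : continuous (fun y => dPhi (x, y)) by continuity.
rewrite -(FTC lohi cdx dP) [RHS]Rintegral_mkcond.
apply: (@Rintegral_off_null _ _ _ leb ([set lo; hi] : set (measurableTypeR R)) setT).
- by apply: measurableU; exact: measurable_set1.
- apply/eqP; rewrite eq_le measure_ge0 andbT.
  apply: (le_trans (measureU2 _ _ _)); try exact: measurable_set1.
  by rewrite /= !lebesgue_measure_set1 adde0.
move=> y _ /= ny; rewrite !patchE.
have [yl|yl] := eqVneq y lo; first by exfalso; apply: ny; left.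
have [yh|yh] := eqVneq y hi; first by exfalso; apply: ny; right.
have -> // : ((x, y) \in A) = (y \in `[lo, hi]%classic).
apply/idP/idP; rewrite !inE /= in_itv/=.
  by move=> /hA /andP[h1 h2]; rewrite !ltW.
by move=> /andP[h1 h2]; apply/hA; rewrite !lt_neqAle h1 h2 yh eq_sym yl.
Qed.

Lemma otri_combo p q r x : cross (q - p) (r - p) != 0 -> otri p q r x ->
  exists a b c : R, [/\ 0 < a, 0 < b, 0 < c, a + b + c = 1 &
    x.1 = a * p.1 + b * q.1 + c * r.1].
Proof.
move=> D0 [h1 h2 h3]; do 3 eexists; split; [exact: h1|exact: h2|exact: h3|..].
  rewrite -!mulrDl; apply: (mulIf D0); rewrite divfK// mul1r /cross /=; ring.
have E (u v w a b c d : R) : a * u + b * v + c * w = d * cross (q - p) (r - p) ->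
    d = (a / cross (q - p) (r - p)) * u + (b / cross (q - p) (r - p)) * v + (c / cross (q - p) (r - p)) * w.
  move=> h; apply: (mulIf D0); rewrite -h !mulrDl.
  by congr (_ + _ + _); rewrite mulrAC divfK.
by apply: E; rewrite /cross /=; ring.
Qed.

Lemma affine_div (A B C c d D : R) : D != 0 -> A * c = B * D + C * d ->
  A * (c / D) = B + C * (d / D).
Proof. by move=> D0 h; rewrite !mulrA h mulrDl mulfK. Qed.

(** With the corners sorted from left to right, a vertical slice of the
    triangle is an interval between two edges. *)
Lemma slice_left Phi dPhi p q r x : continuous dPhi ->
  dv (fun y => Phi (x, y)) (fun y => dPhi (x, y)) ->
  cross (q - p) (r - p) != 0 -> q.1 <= r.1 -> p.1 < x < q.1 ->
  Num.sg (cross (q - p) (r - p)) * \int[leb]_y (dPhi \_ (otri p q r)) (x, y) =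
  Phi (x, lineat p r x) - Phi (x, lineat p q x).
Proof.
move=> cd dP D0 qr /andP[px xq].
have pq : 0 < q.1 - p.1 by rewrite subr_gt0 (lt_trans px).
have pr : 0 < r.1 - p.1 by rewrite subr_gt0 (lt_le_trans (lt_trans px xq)).
have pq' : q.1 != p.1 by rewrite -subr_eq0 gt_eqF.
have pr' : r.1 != p.1 by rewrite -subr_eq0 gt_eqF.
have gap : lineat p r x - lineat p q x =
    (x - p.1) / (r.1 - p.1) / (q.1 - p.1) * cross (q - p) (r - p).
  by rewrite /lineat /cross /=; field; rewrite !subr_eq0 pq' pr'.
have inO y : otri p q r (x, y) <->
    0 < (lineat p r x - y) / cross (q - p) (r - p) /\
    0 < (y - lineat p q x) / cross (q - p) (r - p).
  have E2 : cross (r - (x, y)) (p - (x, y)) / cross (q - p) (r - p) =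
      (r.1 - p.1) * ((lineat p r x - y) / cross (q - p) (r - p)).
    rewrite mulrA; congr (_ / _); rewrite -[RHS]opprK -mulrN opprB -cross_lineat//.
    by rewrite /cross; ring.
  have E3 : cross (p - (x, y)) (q - (x, y)) / cross (q - p) (r - p) =
      (q.1 - p.1) * ((y - lineat p q x) / cross (q - p) (r - p)).
    by rewrite mulrA; congr (_ / _); rewrite cross_lineat.
  rewrite /otri /= E2 E3 !(pmulr_rgt0 _ pr, pmulr_rgt0 _ pq).
  split => [[_ h2 h3]//|[h2 h3]]; split => //.
  have : 0 < (q.1 - p.1) * (cross (q - (x, y)) (r - (x, y)) / cross (q - p) (r - p)).
    have -> : (q.1 - p.1) * (cross (q - (x, y)) (r - (x, y)) / cross (q - p) (r - p)) =
        (q.1 - x) + (r.1 - q.1) * (cross (p - (x, y)) (q - (x, y)) / cross (q - p) (r - p)).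
      by apply: affine_div => //; rewrite /cross /=; ring.
    rewrite E3 ltr_pwDl ?subr_gt0// mulr_ge0 ?subr_ge0// mulr_ge0 ?ltW//.
  by rewrite pmulr_rgt0.
have w0 : 0 < (x - p.1) / (r.1 - p.1) / (q.1 - p.1) by rewrite !divr_gt0// subr_gt0.
have [Dp|Dm] := ltrP 0 (cross (q - p) (r - p)).
  rewrite gtr0_sg// mul1r; apply: slice_int => //.
    by rewrite -subr_ge0 gap ltW// mulr_gt0.
  move=> y; rewrite inO !pmulr_lgt0 ?invr_gt0// !subr_gt0.
  by split => [[-> ->]|/andP[]].
have {}Dm : cross (q - p) (r - p) < 0 by rewrite lt_neqAle D0.
rewrite ltr0_sg// mulN1r -[RHS]opprB; congr (- _); apply: slice_int => //.
  by rewrite -subr_le0 gap nmulr_lle0// ltW.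
move=> y; rewrite inO !nmulr_lgt0 ?invr_lt0// !subr_lt0.
by split => [[-> ->]|/andP[]].
Qed.

Lemma slice_right Phi dPhi p q r x : continuous dPhi ->
  dv (fun y => Phi (x, y)) (fun y => dPhi (x, y)) ->
  cross (q - p) (r - p) != 0 -> p.1 <= q.1 -> q.1 < x < r.1 ->
  Num.sg (cross (q - p) (r - p)) * \int[leb]_y (dPhi \_ (otri p q r)) (x, y) =
  Phi (x, lineat p r x) - Phi (x, lineat q r x).
Proof.
move=> cd dP D0 pq /andP[qx xr].
have qr : 0 < r.1 - q.1 by rewrite subr_gt0 (lt_trans qx).
have pr : 0 < r.1 - p.1 by rewrite subr_gt0 (le_lt_trans pq)// (lt_trans qx).
have qr' : r.1 != q.1 by rewrite -subr_eq0 gt_eqF.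
have pr' : r.1 != p.1 by rewrite -subr_eq0 gt_eqF.
have gap : lineat p r x - lineat q r x =
    (r.1 - x) / (r.1 - p.1) / (r.1 - q.1) * cross (q - p) (r - p).
  by rewrite /lineat /cross /=; field; rewrite !subr_eq0 qr' pr'.
have inO y : otri p q r (x, y) <->
    0 < (lineat p r x - y) / cross (q - p) (r - p) /\
    0 < (y - lineat q r x) / cross (q - p) (r - p).
  have E2 : cross (r - (x, y)) (p - (x, y)) / cross (q - p) (r - p) =
      (r.1 - p.1) * ((lineat p r x - y) / cross (q - p) (r - p)).
    rewrite mulrA; congr (_ / _); rewrite -[RHS]opprK -mulrN opprB -cross_lineat//.
    by rewrite /cross; ring.
  have E3 : cross (q - (x, y)) (r - (x, y)) / cross (q - p) (r - p) =
      (r.1 - q.1) * ((y - lineat q r x) / cross (q - p) (r - p)).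
    by rewrite mulrA; congr (_ / _); rewrite cross_lineat.
  rewrite /otri /= E2 E3 !(pmulr_rgt0 _ pr, pmulr_rgt0 _ qr).
  split => [[h3 h2 _]//|[h2 h3]]; split => //.
  have : 0 < (r.1 - q.1) * (cross (p - (x, y)) (q - (x, y)) / cross (q - p) (r - p)).
    have -> : (r.1 - q.1) * (cross (p - (x, y)) (q - (x, y)) / cross (q - p) (r - p)) =
        (x - q.1) + (q.1 - p.1) * (cross (q - (x, y)) (r - (x, y)) / cross (q - p) (r - p)).
      by apply: affine_div => //; rewrite /cross /=; ring.
    rewrite E3 ltr_pwDl ?subr_gt0// mulr_ge0 ?subr_ge0// mulr_ge0 ?ltW//.
  by rewrite pmulr_rgt0.
have w0 : 0 < (r.1 - x) / (r.1 - p.1) / (r.1 - q.1) by rewrite !divr_gt0// subr_gt0.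
have [Dp|Dm] := ltrP 0 (cross (q - p) (r - p)).
  rewrite gtr0_sg// mul1r; apply: slice_int => //.
    by rewrite -subr_ge0 gap ltW// mulr_gt0.
  move=> y; rewrite inO !pmulr_lgt0 ?invr_gt0// !subr_gt0.
  by split => [[-> ->]|/andP[]].
have {}Dm : cross (q - p) (r - p) < 0 by rewrite lt_neqAle D0.
rewrite ltr0_sg// mulN1r -[RHS]opprB; congr (- _); apply: slice_int => //.
  by rewrite -subr_le0 gap nmulr_lle0// ltW.
move=> y; rewrite inO !nmulr_lgt0 ?invr_lt0// !subr_lt0.
by split => [[-> ->]|/andP[]].
Qed.

Lemma restricted_int (F : R -> R) (a b : R) : continuous F ->
  \int[leb]_x (F \_ `[a, b]) x = \int[leb]_(x in `[a, b]) F x /\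
  leb.-integrable setT (EFin \o (F \_ `[a, b] : measurableTypeR R -> R)).
Proof.
move=> cF; split; first by rewrite [RHS]Rintegral_mkcond.
rewrite -restrict_EFin; apply: (iffLR (integrable_mkcond _ _)) => //.
exact: integrable_itv.
Qed.

Definition edge_sum Phi p q r : R :=
  (q.1 - p.1) * eint Phi p q + (r.1 - q.1) * eint Phi q r + (p.1 - r.1) * eint Phi r p.

(** The fundamental theorem of calculus on every vertical slice, integrated
    over the abscissa. *)
Lemma green_sorted Phi dPhi p q r : continuous Phi -> continuous dPhi ->
  (forall x, dv (fun y => Phi (x, y)) (fun y => dPhi (x, y))) ->
  cross (q - p) (r - p) != 0 -> p.1 <= q.1 -> q.1 <= r.1 ->
  Num.sg (cross (q - p) (r - p)) * \int[leb]_x \int[leb]_y (dPhi \_ (otri p q r)) (x, y) =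
  - edge_sum Phi p q r.
Proof.
move=> cP cd dP D0 pq qr.
have cl a b : continuous (fun x => Phi (x, lineat a b x)) by rewrite /lineat; continuity.
have [i1 j1] := restricted_int p.1 r.1 (cl p r).
have [i2 j2] := restricted_int p.1 q.1 (cl p q).
have [i3 j3] := restricted_int q.1 r.1 (cl q r).
pose H x := ((fun x => Phi (x, lineat p r x)) \_ `[p.1, r.1]) x -
  ((fun x => Phi (x, lineat p q x)) \_ `[p.1, q.1]) x -
  ((fun x => Phi (x, lineat q r x)) \_ `[q.1, r.1]) x.
have jH : leb.-integrable setT (EFin \o (H : measurableTypeR R -> R)).
  rewrite (_ : _ \o _ = ((EFin \o ((fun x => Phi (x, lineat p r x)) \_ `[p.1, r.1])) \-
    (EFin \o ((fun x => Phi (x, lineat p q x)) \_ `[p.1, q.1])) \-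
    (EFin \o ((fun x => Phi (x, lineat q r x)) \_ `[q.1, r.1])))%E)//.
  by apply: integrableB => //; exact: integrableB.
have H_int : \int[leb]_x H x = - edge_sum Phi p q r.
  have jj : leb.-integrable setT (EFin \o (fun x : measurableTypeR R =>
      ((fun x => Phi (x, lineat p r x)) \_ `[p.1, r.1]) x -
      ((fun x => Phi (x, lineat p q x)) \_ `[p.1, q.1]) x)).
    rewrite (_ : _ \o _ = ((EFin \o ((fun x => Phi (x, lineat p r x)) \_ `[p.1, r.1])) \-
      (EFin \o ((fun x => Phi (x, lineat p q x)) \_ `[p.1, q.1])))%E)//.
    exact: integrableB.
  rewrite /H RintegralB// RintegralB// i1 i2 i3 !lineat_int//; last exact: le_trans qr.
  by rewrite /edge_sum (eint_sym p r cP); ring.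
pose s := Num.sg (cross (q - p) (r - p)).
have s2 : s * s = 1 by rewrite /s; case: sgrP D0 => // _ _; ring.
rewrite -H_int.
have -> : \int[leb]_x \int[leb]_y (dPhi \_ (otri p q r)) (x, y) =
    \int[leb]_x (s * H x).
  apply: (@Rintegral_off_null _ _ _ leb
    ([set p.1; q.1] `|` [set r.1] : set (measurableTypeR R)) setT).
  - by apply: measurableU; [apply: measurableU|]; exact: measurable_set1.
  - apply/eqP; rewrite eq_le measure_ge0 andbT.
    apply: (le_trans (measureU2 _ _ _)); try exact: measurable_set1.
      by apply: measurableU; exact: measurable_set1.
    rewrite /= lebesgue_measure_set1 adde0.
    apply: (le_trans (measureU2 _ _ _)); try exact: measurable_set1.
    by rewrite /= !lebesgue_measure_set1 adde0.
  move=> x _ /= nx.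
  have [xp|xp] := eqVneq x p.1; first by exfalso; apply: nx; left; left.
  have [xq|xq] := eqVneq x q.1; first by exfalso; apply: nx; left; right.
  have [xr|xr] := eqVneq x r.1; first by exfalso; apply: nx; right.
  have outside : ~ (p.1 < x < r.1) -> \int[leb]_y (dPhi \_ (otri p q r)) (x, y) = 0.
    move=> no; under eq_Rintegral => y _.
      rewrite patchE ifF; first over.
      apply/negbTE/negP; rewrite inE => /(otri_combo D0)[a [b [c [a0 b0 c0 abc /= xE]]]].
      apply: no; rewrite xE; apply/andP; split.
        have : p.1 < r.1.
          rewrite lt_neqAle (le_trans pq qr) andbT; apply: contra D0 => /eqP e.
          have e2 : q.1 = p.1 by apply/eqP; rewrite eq_le pq e qr.
          by rewrite /cross /= e2 -e !subrr !mul0r ?mulr0 subrr.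
        by move: abc; nra.
      have : p.1 < r.1.
        rewrite lt_neqAle (le_trans pq qr) andbT; apply: contra D0 => /eqP e.
        have e2 : q.1 = p.1 by apply/eqP; rewrite eq_le pq e qr.
        by rewrite /cross /= e2 -e !subrr !mul0r ?mulr0 subrr.
      by move: abc; nra.
    by rewrite Rintegral_cst// mul0r.
  have mem a b : (x \in `[a, b]%classic) = (a <= x <= b).
    by apply/idP/idP; rewrite inE /= in_itv.
  rewrite /H !patchE !mem.
  have [xp'|px] := ltP x p.1.
    rewrite outside; last by rewrite lt_gtF.
    have -> : q.1 <= x = false by apply/negbTE; rewrite -ltNge (lt_le_trans xp').
    by rewrite !subr0 mulr0.
  have [rx|xr'] := ltP r.1 x.
    rewrite outside; last by rewrite [x < _]lt_gtF ?andbF.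
    have -> : x <= q.1 = false by apply/negbTE; rewrite -ltNge (le_lt_trans qr).
    by rewrite !andbF !subr0 mulr0.
  have px' : p.1 < x by rewrite lt_neqAle eq_sym xp.
  have [qx|xq'] := ltP q.1 x.
    rewrite (ltW qx) /= subr0 -(@slice_right _ dPhi)//.
      by rewrite mulrA s2 mul1r.
    by rewrite qx lt_neqAle xr xr'.
  have -> : q.1 <= x = false by apply/negbTE; rewrite -ltNge lt_neqAle xq.
  rewrite /= subr0 -(@slice_left _ dPhi)//.
    by rewrite mulrA s2 mul1r.
  by rewrite px' lt_neqAle xq.
by rewrite RintegralZl// mulrA s2 mul1r.
Qed.

End GreenTriangle.

Section GreenElement.
Context {R : realType}.
Local Notation P := (measurableTypeR R * measurableTypeR R)%type.
Local Notation leb := (@lebesgue_measure R).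
Implicit Types (p q r : R * R) (Phi dPhi : R * R -> R).

Lemma green_iterated Phi dPhi p q r : continuous Phi -> continuous dPhi ->
  (forall x, dv (fun y => Phi (x, y)) (fun y => dPhi (x, y))) ->
  cross (q - p) (r - p) != 0 ->
  Num.sg (cross (q - p) (r - p)) * \int[leb]_x \int[leb]_y (dPhi \_ (otri p q r)) (x, y) =
  - edge_sum Phi p q r.
Proof.
move=> cP cd dP.
pose G p q r := cross (q - p) (r - p) != 0 ->
  Num.sg (cross (q - p) (r - p)) * \int[leb]_x \int[leb]_y (dPhi \_ (otri p q r)) (x, y) =
  - edge_sum Phi p q r.
have rot a b c : G a b c -> G b c a.
  rewrite /G (otri_rot a b c); have -> : cross (c - b) (a - b) = cross (b - a) (c - a).
    by rewrite /cross /=; ring.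
  by move=> h /h ->; rewrite /edge_sum; ring.
have swap a b c : G a b c -> G b a c.
  rewrite /G (otri_swap a b c); have -> : cross (a - b) (c - b) = - cross (b - a) (c - a).
    by rewrite /cross /=; ring.
  rewrite oppr_eq0 sgrN mulNr => h /h ->; rewrite /edge_sum.
  by rewrite (eint_sym a b cP) (eint_sym b c cP) (eint_sym c a cP); ring.
have sorted a b c : a.1 <= b.1 -> b.1 <= c.1 -> G a b c.
  by move=> ab bc D0; exact: green_sorted.
suff : G p q r by [].
have [pq|/ltW qp] := lerP p.1 q.1; have [qr|/ltW rq] := lerP q.1 r.1;
  have [pr|/ltW rp] := lerP p.1 r.1.
- exact: sorted.
- exact: sorted.
- by apply: (rot r p q); apply: swap; exact: sorted.
- by apply: (rot r p q); exact: sorted.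
- by apply: swap; exact: sorted.
- by apply: (rot r p q); apply: (rot q r p); exact: sorted.
- exact: (rot r p q (rot q r p (swap r q p (sorted _ _ _ rq qp)))).
- by apply: (rot r p q); apply: (rot q r p); apply: swap; exact: sorted.
Qed.

Definition flip (x : R * R) : R * R := (x.2, x.1).

Lemma otri_flip p q r x : otri (flip p) (flip q) (flip r) (flip x) <-> otri p q r x.
Proof.
have E a b c d : cross (flip a - flip b) (flip c - flip d) = - cross (a - b) (c - d).
  by rewrite /cross /flip /=; ring.
by rewrite /otri /= !E !invrN !mulrNN.
Qed.

Context {n : nat} (T : 'I_n -> 'I_3 -> R * R).
Hypothesis T0 : forall K, tdet (T K) != 0.

Lemma open_elt_otri K : open_elt T K = otri (T K 0) (T K 1) (T K 2%:R).
Proof.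
have [e1 e2 e3 e4] := addI3 0; rewrite !add0r in e1 e2 e3 e4.
have e5 : 2%:R + 1 = 0 :> 'I_3 by [].
rewrite /open_elt /otri; apply/seteqP; split => x /=.
  move=> h; split; [have := h 0|have := h 1|have := h 2%:R]; rewrite /lam /tdet.
  - by rewrite !add0r.
  - by rewrite e1 e2.
  - by rewrite e3 e4.
move=> [h1 h2 h3] a; rewrite /lam -/(tdet _) in h1 h2 h3 *.
by case: (I3_cases 0 a) => ->; rewrite !add0r ?e1 ?e2 ?e3 ?e4.
Qed.

Lemma elt_inbox K : inbox (elt T K).
Proof.
pose M : R := \sum_a (`|(T K a).1| + `|(T K a).2|).
exists M => x [w [w0 _ w1 ->]].
have w_le1 a : w a <= 1 by rewrite -w1 (bigD1 a)//= lerDl sumr_ge0.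
have fst1 : (\sum_a w a *: T K a).1 = \sum_a w a * (T K a).1 by apply: (big_morph fst).
have snd1 : (\sum_a w a *: T K a).2 = \sum_a w a * (T K a).2 by apply: (big_morph snd).
split; rewrite /= in_itv/= -ler_norml ?fst1 ?snd1.
  rewrite (le_trans (ler_norm_sum _ _ _))//; apply: ler_sum => a _.
  by rewrite normrM (ger0_norm (w0 a)) ler_wpDr// ler_piMl.
rewrite (le_trans (ler_norm_sum _ _ _))//; apply: ler_sum => a _.
by rewrite normrM (ger0_norm (w0 a)) ler_wpDl// ler_piMl.
Qed.

Lemma open_elt_subset K : open_elt T K `<=` elt T K.
Proof.
move=> x h; rewrite /elt; apply/faceP => //; split=> a; first exact: ltW (h a).
by rewrite inE.
Qed.

Lemma open_elt_inbox K : inbox (open_elt T K).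
Proof. by have [M hM] := elt_inbox K; exists M => x /open_elt_subset /hM. Qed.

Lemma measurable_open_elt K : measurable (open_elt T K : set P).
Proof.
apply: open_measurable2; rewrite openE => x h.
suff : \forall y \near x, forall a, 0 < lam (T K) a y by [].
apply: (filter_forall (nbhs_filter x)) => a.
by apply: (@near_pos _ _ (lam (T K) a)); [exact: continuous_lam|exact: h].
Qed.

Lemma sum_edges K (F : R * R -> R * R -> R) :
  (forall x y, F x y = - F y x) ->
  \sum_a F (src T (K, a)) (tgt T (K, a)) =
  Num.sg (tdet (T K)) * (F (T K 0) (T K 1) + F (T K 1) (T K 2%:R) + F (T K 2%:R) (T K 0)).
Proof.
move=> aF; rewrite (sumI3 _ 0) /src /tgt /ea /eb /=.
have [e1 e2 e3 e4] := addI3 0; rewrite !add0r in e1 e2 e3 e4 *.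
rewrite e1 e2 e3 e4; have [D|D] := ltrP 0 (tdet (T K)).
  by rewrite gtr0_sg// mul1r addrC addrA.
have {}D : tdet (T K) < 0 by rewrite lt_neqAle T0.
rewrite ltr0_sg// mulN1r (aF (T K 2%:R)) (aF (T K 0) (T K 2%:R)) (aF (T K 1) (T K 0)).
by ring.
Qed.

Let sg2 K : Num.sg (tdet (T K)) * Num.sg (tdet (T K)) = 1.
Proof. by have := T0 K; case: sgrP => // _ _; ring. Qed.

(** Sorting the corners by abscissa reduces every triangle to [green_sorted]. *)
Lemma green_y Phi dPhi K : continuous Phi -> continuous dPhi ->
  (forall x, dv (fun y => Phi (x, y)) (fun y => dPhi (x, y))) ->
  \int[area]_(z in open_elt T K) dPhi z = - \sum_a
    ((tgt T (K, a)).1 - (src T (K, a)).1) * eint Phi (src T (K, a)) (tgt T (K, a)).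
Proof.
move=> cP cd dP.
rewrite fubini_xy//; [|exact: measurable_open_elt|exact: open_elt_inbox].
rewrite (sum_edges K (F := fun x y => (y.1 - x.1) * eint Phi x y)); last first.
  by move=> x y; rewrite (eint_sym x y cP); ring.
rewrite open_elt_otri -/(edge_sum _ _ _ _) -mulrN.
rewrite -(green_iterated cP cd dP) ?T0// -/(tdet (T K)).
by rewrite mulrA sg2 mul1r.
Qed.

Lemma green_x Phi dPhi K : continuous Phi -> continuous dPhi ->
  (forall y, dv (fun x => Phi (x, y)) (fun x => dPhi (x, y))) ->
  \int[area]_(z in open_elt T K) dPhi z = \sum_a
    ((tgt T (K, a)).2 - (src T (K, a)).2) * eint Phi (src T (K, a)) (tgt T (K, a)).
Proof.
move=> cP cd dP.
rewrite fubini_yx//; [|exact: measurable_open_elt|exact: open_elt_inbox].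
rewrite (sum_edges K (F := fun x y => (y.2 - x.2) * eint Phi x y)); last first.
  by move=> x y; rewrite (eint_sym x y cP); ring.
pose Phi' x := Phi (flip x); pose dPhi' x := dPhi (flip x).
have cflip : continuous flip by apply: continuous_pair; [exact: ct_snd|exact: ct_fst].
have cP' : continuous Phi' by apply: ct_comp.
have cd' : continuous dPhi' by apply: ct_comp.
have DE : cross (flip (T K 1) - flip (T K 0)) (flip (T K 2%:R) - flip (T K 0)) = - tdet (T K).
  by rewrite /tdet /cross /flip /=; ring.
have D' : cross (flip (T K 1) - flip (T K 0)) (flip (T K 2%:R) - flip (T K 0)) != 0.
  by rewrite DE oppr_eq0.
have := green_iterated cP' cd' dP D'; rewrite DE sgrN mulNr => /oppr_inj E.
have -> : \int[leb]_y \int[leb]_x (dPhi \_ (open_elt T K)) (x, y) =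
    \int[leb]_x \int[leb]_y (dPhi' \_ (otri (flip (T K 0)) (flip (T K 1)) (flip (T K 2%:R)))) (x, y).
  rewrite open_elt_otri; apply: eq_Rintegral => y _; apply: eq_Rintegral => x _.
  rewrite !patchE; congr (if _ then _ else _).
  apply/idP/idP; rewrite !inE => h.
    by have := iffRL (otri_flip (T K 0) (T K 1) (T K 2%:R) (x, y)) h.
  by apply/otri_flip.
have -> : (T K 1).2 - (T K 0).2 = (flip (T K 1)).1 - (flip (T K 0)).1 by [].
rewrite -[LHS]mul1r -(sg2 K) -mulrA E /edge_sum; congr (_ * _).
Qed.

End GreenElement.

(** * Integrals over the mesh *)

Section Decomposition.
Context {R : realType} {m : nat} (V : 'I_m -> R * R) (Om : set (R * R)).
Context (hOm : convex_polygonal_domain V Om).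
Context {n : nat} (T : 'I_n -> 'I_3 -> R * R) (hT : triangulation Om T).
Local Notation P := (measurableTypeR R * measurableTypeR R)%type.
Local Notation leb := (@lebesgue_measure R).
Implicit Types (Phi Psi : R * R -> R) (K : 'I_n) (i : 'I_m) (f : 'I_n * 'I_3).
Let T0 K : tdet (T K) != 0 := tdet_neq0 hT K.

Lemma closed_line (u v : R * R) : closed [set x | cross (u - x) (v - x) = 0].
Proof.
have c : continuous (fun x : R * R => cross (u - x) (v - x)) by rewrite /cross; continuity.
have -> : [set x | cross (u - x) (v - x) = 0] =
    [set x | 0 <= cross (u - x) (v - x)] `&` [set x | 0 <= - cross (u - x) (v - x)].
  apply/seteqP; split => x /=; first by move=> ->; rewrite oppr0.
  by rewrite oppr_ge0 => -[h1 h2]; apply/eqP; rewrite eq_le h1 h2.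
by apply: closedI; apply: closed_nonneg => //; exact: ct_opp.
Qed.

Lemma area_line (u v : R * R) : u != v ->
  area ([set x | cross (u - x) (v - x) = 0] : set P) = 0%E.
Proof.
move=> uv; set A := [set x | _].
have mA : measurable (A : set P) by apply: closed_measurable2; exact: closed_line.
rewrite /area /product_measure1.
rewrite (@integral_off_null _ _ _ leb ([set u.1] : set (measurableTypeR R)) setT _ (cst 0%E)).
- by rewrite integral0.
- exact: measurable_set1.
- exact: lebesgue_measure_set1.
move=> x _ /= xu; have [e|e] := eqVneq u.1 v.1.
  rewrite (_ : xsection A x = set0) ?measure0//.
  apply/seteqP; split => y //; rewrite /xsection /= inE /A /= /cross /= e => h.
  have /eqP : (v.1 - x) * (v.2 - u.2) = 0 by rewrite -h; ring.
  rewrite mulf_eq0 !subr_eq0 => /orP[/eqP h1|/eqP h1]; first by apply: xu; rewrite e h1.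
  by move/negP: uv; apply; apply/eqP/pairE.
rewrite (_ : xsection A x = [set (u.2 * (v.1 - x) - (u.1 - x) * v.2) / (v.1 - u.1)]).
  exact: lebesgue_measure_set1.
have d0 : v.1 - u.1 != 0 by rewrite subr_eq0 eq_sym.
apply/seteqP; split => y; rewrite /xsection /= inE /A /= /cross /=.
  by move=> h; apply: (mulIf d0); rewrite divfK//; lra.
move=> ->; apply: (mulIf d0); field.
by [].
Qed.

Definition mesh_lines : set (R * R) := [set x | exists K a, lam (T K) a x = 0].

Lemma lam_line K a : [set x | lam (T K) a x = 0] =
  [set x | cross (T K (a + 1) - x) (T K (a + 2%:R) - x) = 0].
Proof.
apply/seteqP; split => x /=; rewrite /lam; last by move=> ->; rewrite mul0r.
by move=> /eqP; rewrite mulf_eq0 invr_eq0 (negbTE (T0 K)) orbF => /eqP.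
Qed.

Lemma mesh_linesE : mesh_lines =
  \big[setU/set0]_(f : 'I_n * 'I_3) [set x | lam (T f.1) f.2 x = 0].
Proof.
rewrite -bigcup_seq; apply/seteqP; split => x.
  by move=> [K [a h]]; exists (K, a) => //=; exact: mem_index_enum.
by move=> [[K a] _ h]; exists K, a.
Qed.

Lemma measurable_mesh_lines : measurable (mesh_lines : set P).
Proof.
rewrite mesh_linesE; apply: bigsetU_measurable => f _.
by rewrite lam_line; apply: closed_measurable2; exact: closed_line.
Qed.

Lemma area_mesh_lines : area (mesh_lines : set P) = 0%E.
Proof.
rewrite mesh_linesE; apply/eqP; rewrite eq_le measure_ge0 andbT.
elim: (index_enum _) => [|f s IH]; first by rewrite big_nil measure0.
rewrite big_cons.
have mf g : measurable ([set x | lam (T g.1) g.2 x = 0] : set P).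
  by rewrite lam_line; apply: closed_measurable2; exact: closed_line.
apply: (le_trans (measureU2 _ _ _)) => //.
  by apply: bigsetU_measurable => g _; exact: mf.
have h0 : (area ([set x | lam (T f.1) f.2 x = 0%R] : set P) <= 0)%E.
  rewrite lam_line area_line//.
  by apply/eqP => /(vertex_inj (T0 f.1)) e; have [_ _ /eqP] := neqI3 f.2; exact.
by apply: (le_trans (leeD h0 IH)); rewrite adde0.
Qed.

Lemma open_elt_integrable K Phi : continuous Phi ->
  area.-integrable (open_elt T K) (EFin \o (Phi : P -> R)).
Proof.
move=> cPhi; apply: integrable_area => //; first exact: measurable_open_elt.
exact: open_elt_inbox.
Qed.

(** The mesh lines form a null set, so the values of the integrand there do
    not matter. *)
Lemma Om_integral (F : R * R -> R) (G : 'I_n -> R * R -> R) :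
  (forall K, continuous (G K)) ->
  (forall K x, open_elt T K x -> F x = G K x) ->
  \int[area]_(x in Om) F x = \sum_K \int[area]_(x in open_elt T K) G K x.
Proof.
move=> cG FG; rewrite Rintegral_mkcond.
rewrite (@Rintegral_off_null _ _ _ area (mesh_lines : set P) setT _
  (fun x => \sum_K (G K \_ (open_elt T K)) x)).
- have H K : area.-integrable setT (EFin \o (G K \_ (open_elt T K) : P -> R)).
    rewrite -restrict_EFin; apply: (iffLR (integrable_mkcond _ _)).
      exact: measurable_open_elt.
    exact: open_elt_integrable.
  have [-> _] := @Rintegral_sum _ _ _ area setT _ (index_enum 'I_n) xpredT
    (fun K => G K \_ (open_elt T K)) measurableT H.
  by apply: eq_bigr => K _; rewrite [RHS]Rintegral_mkcond.
- exact: measurable_mesh_lines.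
- exact: area_mesh_lines.
move=> x _ nx.
have inK K : elt T K x -> open_elt T K x.
  move=> /(eltP hT) l0 a; rewrite lt_neqAle l0 andbT; apply/eqP => e.
  by apply: nx; exists K, a.
rewrite patchE; case: ifPn => [|xO].
  rewrite inE => Ox; have [K Kx] := closure_elt hT (subset_closure Ox).
  rewrite (bigD1 K)//= patchE mem_set; last exact: inK.
  rewrite big1 ?addr0 => [|L LK]; first by rewrite (FG K)//; exact: inK.
  rewrite patchE; case: ifPn => //; rewrite inE => Lx.
  by have e := open_elt_disjoint hT Lx Kx; rewrite e eqxx in LK.
rewrite big1// => K _; rewrite patchE; case: ifPn => //; rewrite inE => Kx.
by exfalso; move/negP: xO; apply; rewrite inE; exact: (open_elt_Om hOm hT Kx).
Qed.

Lemma elt_integral K Phi :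
  \int[area]_(x in elt T K) Phi x = \int[area]_(x in open_elt T K) Phi x.
Proof.
rewrite Rintegral_mkcond [RHS]Rintegral_mkcond.
apply: (@Rintegral_off_null _ _ _ area (mesh_lines : set P) setT).
- exact: measurable_mesh_lines.
- exact: area_mesh_lines.
move=> x _ nx; rewrite !patchE; congr (if _ then _ else _).
apply/idP/idP; rewrite !inE => Kx; last exact: (open_elt_sub hT Kx).
move=> a; have := iffLR (eltP hT _ _) Kx a.
by rewrite le_eqVlt => /predU1P[e|//]; exfalso; apply: nx; exists K, a.
Qed.

Lemma finite_null (s : seq R) : leb ([set` s] : set (measurableTypeR R)) = 0%E /\
  measurable ([set` s] : set (measurableTypeR R)).
Proof.
elim: s => [|a s [IH1 IH2]].
  have -> : ([set` [::]] : set R) = set0 by apply/seteqP; split => x.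
  by rewrite measure0.
have -> : ([set` a :: s] : set R) = [set a] `|` [set` s].
  apply/seteqP; split => x /=; rewrite inE; first by move=> /predU1P[->|]; [left|right].
  by move=> [->|->]; rewrite ?eqxx ?orbT.
have m1 : measurable ([set a] : set (measurableTypeR R)) by exact: measurable_set1.
split; last exact: (measurableU _ _ m1 IH2).
have h0 : (leb ([set a] : set (measurableTypeR R)) <= 0)%E by rewrite lebesgue_measure_set1.
apply/eqP; rewrite eq_le measure_ge0 andbT.
apply: (le_trans (measureU2 _ m1 IH2)).
have h1 : (leb ([set` s] : set (measurableTypeR R)) <= 0)%E by move: IH1 => ->.
by apply: (le_trans (leeD h0 h1)); rewrite adde0.
Qed.

(** The end points of the edges form a finite set; every other point of the
    side lies on exactly one boundary edge. *)
Lemma side_integral i (F : R -> R) (G : 'I_n * 'I_3 -> R -> R) :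
  (forall f, continuous (G f)) ->
  (forall f t, onside V T i f -> tm V T i f < t < tp V T i f -> F t = G f t) ->
  \int[leb]_(t in `[0, 1]) F t =
  \sum_(f | onside V T i f) \int[leb]_(t in `[tm V T i f, tp V T i f]) G f t.
Proof.
move=> cG FG; rewrite Rintegral_mkcond.
pose s := [seq tpos V i (T f.1 f.2) | f <- enum [set: 'I_n * 'I_3]%SET].
have [s0 ms] := finite_null s.
rewrite (@Rintegral_off_null _ _ _ leb ([set` s] : set (measurableTypeR R)) setT _
  (fun t => \sum_(f | onside V T i f) (G f \_ `[tm V T i f, tp V T i f]) t))//.
  have H f := (restricted_int (tm V T i f) (tp V T i f) (cG f)).2.
  have [-> _] := @Rintegral_sum _ _ _ leb setT _ (index_enum _) (onside V T i)
    (fun f => G f \_ `[tm V T i f, tp V T i f]) measurableT H.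
  by apply: eq_bigr => f _; rewrite [RHS]Rintegral_mkcond.
move=> t _ /= nt.
have nv K a : side_param V i t <> T K a.
  move=> e; apply: nt; apply/mapP; exists (K, a); first by rewrite mem_enum inE.
  by rewrite /= -e (tpos_param hOm).
have mem a b : (t \in `[a, b]%classic) = (a <= t <= b).
  by apply/idP/idP; rewrite inE /= in_itv.
rewrite patchE mem; case: ifPn => [t01|t01].
  have [f [fi ft]] := side_covered hOm hT t01 nv.
  have ft' : tm V T i f <= t <= tp V T i f by case/andP: ft => h1 h2; rewrite !ltW.
  rewrite (bigD1 f)//= patchE mem ft' big1 ?addr0 ?(FG f)// => g /andP[gi gf].
  rewrite patchE mem; case: ifPn => // gt.
  by have e := side_cover_uniq hOm hT fi gi nv ft' gt; rewrite e eqxx in gf.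
rewrite big1// => f fi; rewrite patchE mem; case: ifPn => // /andP[h1 h2].
have [l0 l1] := tm_ge0 hOm hT fi.
by move/negP: t01; case; rewrite (le_trans l0)// (le_trans h2).
Qed.

End Decomposition.

(** * Weak derivatives of piecewise polynomials *)

Section Lines.
Context {R : realType}.
Implicit Types (x : R * R) (phi : R * R -> R).

Lemma dv_col phi (a : R) : (forall x, derivable phi x (unit_vec 1)) ->
  dv (fun y => phi (a, y)) (fun y => partial 1 phi (a, y)).
Proof.
move=> h y; have E : (fun t : R => t^-1 *: (((fun y => phi (a, y)) \o shift y) (t *: (1 : R)) - phi (a, y))) =
   (fun t : R => t^-1 *: ((phi \o shift (a, y)) (t *: unit_vec 1) - phi (a, y))).
  apply/funext => t; congr (_ *: (phi _ - _)); apply: pairE;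
    rewrite /GRing.scale /= /GRing.scale /=; ring.
have hy := h (a, y); constructor; first by rewrite /derivable E.
by rewrite /derive E.
Qed.

Lemma dv_row phi (b : R) : (forall x, derivable phi x (unit_vec 0)) ->
  dv (fun t => phi (t, b)) (fun t => partial 0 phi (t, b)).
Proof.
move=> h y; have E : (fun t : R => t^-1 *: (((fun y => phi (y, b)) \o shift y) (t *: (1 : R)) - phi (y, b))) =
   (fun t : R => t^-1 *: ((phi \o shift (y, b)) (t *: unit_vec 0) - phi (y, b))).
  apply/funext => t; congr (_ *: (phi _ - _)); apply: pairE;
    rewrite /GRing.scale /= /GRing.scale /=; ring.
have hy := h (y, b); constructor; first by rewrite /derivable E.
by rewrite /derive E.
Qed.

Lemma p2_derivable k (f : R * R -> R) j : p2 k f -> forall x, derivable f x (unit_vec j).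
Proof. by move=> /(partial_p2 j)[_ D] x; have [] := D x. Qed.

Lemma p2_partial k (f : R * R -> R) j : p2 k f -> p2 k (partial j f).
Proof. by move=> /(partial_p2 j)[]. Qed.

End Lines.

Section PiecewisePolynomials.
Context {R : realType} {m : nat} (V : 'I_m -> R * R) (Om : set (R * R)).
Context (hOm : convex_polygonal_domain V Om).
Context {n : nat} (T : 'I_n -> 'I_3 -> R * R) (hT : triangulation Om T).
Local Notation P := (measurableTypeR R * measurableTypeR R)%type.
Local Notation leb := (@lebesgue_measure R).
Implicit Types (K : 'I_n) (i : 'I_m) (f g : 'I_n * 'I_3) (k : nat).
Let T0 K : tdet (T K) != 0 := tdet_neq0 hT K.

Definition piecewise k (u : R * R -> R) (Q : 'I_n -> R * R -> R) :=
  forall K, p2 k (Q K) /\ forall x, elt T K x -> u x = Q K x.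

Lemma measurable_elt K : measurable (elt T K : set P).
Proof. by apply: closed_measurable2; exact: (closed_elt hT). Qed.

Lemma closure_inbox : inbox (closure Om).
Proof.
have [M hM] := choice (elt_inbox T).
exists (\sum_K `|M K|) => x cx; have [K Kx] := closure_elt hT cx.
have [h1 h2] := sqbox_bounds (hM K x Kx).
have le : M K <= \sum_K `|M K|.
  by rewrite (bigD1 K)//= (le_trans (ler_norm _))// lerDl sumr_ge0.
by split; rewrite /= in_itv/= -ler_norml (le_trans _ le).
Qed.

Lemma Om_inbox : inbox Om.
Proof. by have [M hM] := closure_inbox; exists M => x /subset_closure /hM. Qed.

Lemma measurable_Om : measurable (Om : set P).
Proof. by apply: open_measurable2; exact: open_Om hOm. Qed.

Lemma piecewise_L2 (u : R * R -> R) (W : 'I_n -> R * R -> R) :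
  (forall K, continuous (W K)) -> (forall K x, elt T K x -> u x = W K x) -> L2 Om u.
Proof.
move=> cW uW; have mu : measurable_fun (Om : set P) u.
  move=> _ Y mY; have -> : (Om : set P) `&` u @^-1` Y =
      \big[setU/set0]_K ((Om `&` elt T K) `&` W K @^-1` Y).
    rewrite -bigcup_seq; apply/seteqP; split => x.
      move=> [Ox uY]; have [K Kx] := closure_elt hT (subset_closure Ox).
      exists K; first exact: mem_index_enum.
      by split => //; rewrite /preimage /= -uW.
    by move=> [K _ [[Ox Kx] h]]; split => //; rewrite /preimage /= (uW K).
  apply: bigsetU_measurable => K _; apply: measurableI.
    by apply: measurableI; [exact: measurable_Om|exact: measurable_elt].
  rewrite -[_ @^-1` _]setTI; exact: (continuous_measurable2 (cW K)).
split => //.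
apply: (@measurable_bounded_integrable _ _ _ area (fun x => u x ^+ 2) Om).
- exact: measurable_Om.
- by apply: area_box_lt; [exact: measurable_Om|exact: Om_inbox].
- exact: measurable_funX.
have [M hM] := closure_inbox.
have [B hB] := choice (fun K => bounded_on_sqbox M (@ct_exp _ _ _ 2 (cW K))).
exists (\sum_K `|B K|); split; first exact: num_real.
move=> z Bz x Ox /=; have [K Kx] := closure_elt hT (subset_closure Ox).
rewrite (uW K)// (le_trans (hB K x _)) ?(le_trans _ (ltW Bz))//.
  exact/hM/subset_closure.
by rewrite (bigD1 K)//= (le_trans (ler_norm _))// lerDl sumr_ge0.
Qed.

Lemma segment_elt f t : 0 <= t <= 1 -> elt T f.1
  ((src T f).1 + t * ((tgt T f).1 - (src T f).1), (src T f).2 + t * ((tgt T f).2 - (src T f).2)).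
Proof.
move=> /andP[t0 t1]; apply/(eltP hT) => a.
pose w (b : bool) := if b then t else 1 - t.
pose q (b : bool) := if b then tgt T f else src T f.
rewrite (_ : (_, _) = \sum_b w b *: q b); last first.
  by rewrite big_bool /w /q; apply: pairE; rewrite /GRing.scale /= /GRing.scale /=; ring.
rewrite lam_affine; last by rewrite big_bool /= addrC subrK.
have [_ [h1 h2]] := lam_src_tgt hT f a.
by rewrite big_bool /= addr_ge0// mulr_ge0// subr_ge0.
Qed.

(** Both elements give the same values on the common edge. *)
Lemma neighbours_eint (G : 'I_n -> R * R -> R) (w : R * R -> R) f g :
  (forall K, continuous (G K)) -> (forall K x, elt T K x -> w x = G K x) ->
  neighbours T f g ->
  eint (G f.1) (src T f) (tgt T f) = eint (G g.1) (src T g) (tgt T g).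
Proof.
move=> cG wG fg; have [st ts] := neighbours_reverse hT fg.
rewrite (eint_sym (tgt T g) (src T g))// -st -ts.
apply: eq_Rintegral => t; rewrite inE /= in_itv/= => t01.
have t01' : 0 <= 1 - t <= 1 by case/andP: t01 => t0 t1; apply/andP; split; lra.
have hg := segment_elt g t01'; rewrite -st -ts in hg.
rewrite -(wG _ _ (segment_elt f t01)) -wG//.
by move: hg; congr (elt _ _ (_, _)); ring.
Qed.

(** Integration by parts on every element leaves edge integrals that cancel
    between neighbours and vanish on the boundary, where the test function
    does. *)
Lemma piecewise_H1 k u Q : piecewise k u Q -> H1 Om u.
Proof.
move=> pQ.
have cQ K : continuous (Q K) by have [/p2_continuous] := pQ K.
have uQ K x : elt T K x -> u x = Q K x by have [_] := pQ K; exact.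
split; first exact: piecewise_L2 cQ uQ.
move=> j; pose D K := partial j (Q K).
have pD K : p2 k (D K) by apply: p2_partial; have [] := pQ K.
have cD K := p2_continuous (pD K).
pose d x := \sum_K (D K \_ (open_elt T K)) x.
have dD K x : open_elt T K x -> d x = D K x.
  move=> Kx; rewrite /d (bigD1 K)//= patchE mem_set// big1 ?addr0// => L LK.
  rewrite patchE; case: ifPn => //; rewrite inE => Lx.
  by have e := open_elt_disjoint hT Lx (open_elt_sub hT Kx); rewrite e eqxx in LK.
exists d.
  have md : measurable_fun (Om : set P) d.
    apply: measurable_sum => K; apply: measurable_funTS.
    apply: (iffLR (measurable_restrictT _ (measurable_open_elt T K))).
    by apply: measurable_funTS; exact: (continuous_measurable2 (cD K)).
  split => //.
  apply: (@measurable_bounded_integrable _ _ _ area (fun x => d x ^+ 2) Om).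
  - exact: measurable_Om.
  - by apply: area_box_lt; [exact: measurable_Om|exact: Om_inbox].
  - exact: measurable_funX.
  have [M hM] := closure_inbox.
  have [B hB] := choice (fun K => bounded_on_sqbox M (cD K)).
  exists ((\sum_K `|B K|) ^+ 2); split; first exact: num_real.
  move=> z Bz x Ox /=; apply: le_trans (ltW Bz).
  rewrite normrX ler_pXn2r ?nnegrE ?sumr_ge0//.
  rewrite /d (le_trans (ler_norm_sum _ _ _))//; apply: ler_sum => K _.
  rewrite patchE; case: ifP => _; last by rewrite normr0.
  by rewrite (le_trans (hB K x _)) ?ler_norm//; exact/hM/subset_closure.
move=> phi [sphi [C [_ CO phi0]]].
have cphi : continuous phi by have [] := sphi [::].
have dphi l x : derivable phi x (unit_vec l) by have [_] := sphi [::]; exact.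
have cdphi l : continuous (partial l phi) by have [] := sphi [:: l].
pose G K x := Q K x * phi x.
have cG K : continuous (G K) by rewrite /G; have := cQ K => ?; continuity.
rewrite (Om_integral hOm hT (G := fun K x => Q K x * partial j phi x)); last 2 first.
- by move=> K; apply: ct_mul.
- by move=> K x /(open_elt_sub hT) /uQ ->.
rewrite (Om_integral hOm hT (G := fun K x => D K x * phi x)); last 2 first.
- by move=> K; apply: ct_mul.
- by move=> K x /dD ->.
apply/eqP; rewrite -addr_eq0 -big_split /=.
have -> : \sum_K (\int[area]_(x in open_elt T K) (Q K x * partial j phi x) +
    \int[area]_(x in open_elt T K) (D K x * phi x)) =
    \sum_K \int[area]_(x in open_elt T K) (D K x * phi x + Q K x * partial j phi x).
  apply: eq_bigr => K _; rewrite [RHS]RintegralD 1?addrC//.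
  - exact: measurable_open_elt.
  - by apply: (open_elt_integrable hT K); apply: ct_mul.
  - by apply: (open_elt_integrable hT K); apply: ct_mul.
have wG K x : elt T K x -> u x * phi x = G K x by move=> /uQ ->.
have zero f i : onside V T i f -> eint (G f.1) (src T f) (tgt T f) = 0.
  move=> fi; rewrite /eint.
  under eq_Rintegral => t.
    rewrite inE /= in_itv/= => t01; rewrite -wG; last exact: segment_elt.
    rewrite phi0; last first.
      move=> /CO /(ell_gt0 hOm i); have [e1 e2] := onside_src fi.
      rewrite (_ : ell V i _ = 0) ?ltxx//.
      transitivity ((1 - t) * ell V i (src T f) + t * ell V i (tgt T f)).
        by rewrite /ell /cross /=; ring.
      by rewrite e1 e2 !mulr0 addr0.
    rewrite mulr0; over.
  by rewrite Rintegral_cst// mul0r.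
have cS K : continuous (fun x => D K x * phi x + Q K x * partial j phi x).
  by apply: ct_add; apply: ct_mul.
have jE : j = 0 \/ j = 1.
  by case: (j) => -[|[|//]] ij; [left|right]; apply/val_inj.
have flags (c : R * R -> R) (s : R) :
    \sum_K (s * \sum_a (c (tgt T (K, a)) - c (src T (K, a))) *
      eint (G K) (src T (K, a)) (tgt T (K, a))) = 0.
  rewrite -mulr_sumr pair_bigA /=.
  pose F f := (c (tgt T f) - c (src T f)) * eint (G f.1) (src T f) (tgt T f).
  rewrite (eq_bigr F) => [|[K a] _]; last by [].
  rewrite (flag_sum hOm hT) => [|f g fg].
    by rewrite big1 ?mulr0// => i _; rewrite big1// => f fi; rewrite /F (zero f i fi) mulr0.
  rewrite /F (neighbours_eint cG wG fg); have [-> ->] := neighbours_reverse hT fg.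
  ring.
have dQ K l x : derivable (Q K) x (unit_vec l) by have [h _] := pQ K; exact: (@p2_derivable R k (Q K) l h x).
case: jE => jE; move: cS; rewrite /D jE => cS.
  apply/eqP; rewrite -[RHS](flags snd 1); apply: eq_bigr => K _; rewrite mul1r.
  apply: green_x => // y.
  exact: dv_mul (dv_row y (dQ K 0)) (dv_row y (dphi 0)).
apply/eqP; rewrite -[RHS](flags fst (-1)); apply: eq_bigr => K _; rewrite mulN1r.
apply: green_y => // x.
exact: dv_mul (dv_col x (dQ K 1)) (dv_col x (dphi 1)).
Qed.

End PiecewisePolynomials.

(** * The Jacobian determinant as a boundary term *)

Section Interpolation.
Context {R : realType}.

Lemma interpolate (s : seq R) (g : R -> R) :
  exists q : {poly R}, forall x, x \in s -> q.[x] = g x.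
Proof.
elim: s => [|x s [q hq]]; first by exists 0.
have [xs|xs] := boolP (x \in s).
  by exists q => y; rewrite inE => /predU1P[->|]; exact: hq.
pose w : {poly R} := \prod_(y <- s) ('X - y%:P).
have wx : w.[x] != 0 by have : ~~ root w x by rewrite root_prod_XsubC.
exists (q + ((g x - q.[x]) / w.[x])%:P * w) => y; rewrite inE !hornerE.
move=> /predU1P[->|ys]; first by rewrite divfK// addrC subrK.
have /eqP -> : root w y by rewrite /w root_prod_XsubC.
by rewrite mulr0 addr0 hq.
Qed.

Lemma dv_poly (q : {poly R}) : exists2 q' : R -> R, continuous q' &
  dv (fun x => q.[x]) q'.
Proof.
exists (fun t => \sum_(i <- index_enum 'I_(size q)) (0 * t ^+ i + q`_i * (i%:R * t ^+ i.-1 * 1))).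
  by apply: ct_sum => i; continuity.
have H := dv_sum (index_enum 'I_(size q)) (fun i => dv_mul (dv_cst q`_i) (dv_exp i (@dv_id R))).
by apply: (dv_eq _ _ H) => t //; rewrite horner_coef.
Qed.

Lemma dv_flip (b b' : R -> R) : dv b b' -> dv (fun t => b (1 - t)) (fun t => - b' (1 - t)).
Proof.
move=> h t; apply: (is_derive_eq (@is_derive1_comp _ b (fun t => 1 - t) t (b' (1 - t)) (-1) (h _) _)).
  have := dv_add (dv_cst 1) (dv_mul (dv_cst (-1)) (@dv_id R)).
  move=> /dv_eq H; apply: (H (fun t => 1 - t) (fun _ => -1)) => u.
    by rewrite mulN1r.
  by rewrite mul0r !add0r mulr1.
by rewrite mulrN1.
Qed.

Lemma dv_local (b c b' c' : R -> R) t : dv b b' -> dv c c' ->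
  (forall s, 0 <= s <= 1 -> b s = c s) -> 0 < t < 1 -> b' t = c' t.
Proof.
move=> hb hc bc t01.
have E : \near t, b t = c t.
  have : nbhs t `]0, 1[%classic.
    by apply: near_in_itvoo; rewrite in_itv.
  apply: filterS => s /=; rewrite in_itv/= => /andP[s0 s1].
  by apply: bc; rewrite !ltW.
have := near_eq_is_derive E (hb t) => h.
have <- := @derive_val _ _ _ _ _ _ _ h.
by have h2 := hc t; rewrite derive_val.
Qed.

Lemma Rintegral_comb (X Y : R -> R) (a b c d : R) : continuous X -> continuous Y ->
  c * \int[lebesgue_measure]_(t in `[a, b]) X t + d * \int[lebesgue_measure]_(t in `[a, b]) Y t =
  \int[lebesgue_measure]_(t in `[a, b]) (c * X t + d * Y t).
Proof.
move=> cX cY; have iX := integrable_itv a b cX; have iY := integrable_itv a b cY.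
have iX' := integrable_itv a b (ct_mul (@ct_cst _ _ c) cX).
have iY' := integrable_itv a b (ct_mul (@ct_cst _ _ d) cY).
have mI : measurable (`[a, b] : set (measurableTypeR R)) by exact: measurable_itv.
rewrite (RintegralD mI iX' iY').
by rewrite (RintegralZl _ mI iX) (RintegralZl _ mI iY).
Qed.

Lemma Rintegral_scale (X : R -> R) (a b c : R) : continuous X ->
  c * \int[lebesgue_measure]_(t in `[a, b]) X t =
  \int[lebesgue_measure]_(t in `[a, b]) (c * X t).
Proof.
move=> cX; have iX := integrable_itv a b cX.
have mI : measurable (`[a, b] : set (measurableTypeR R)) by exact: measurable_itv.
by rewrite (RintegralZl _ mI iX).
Qed.

End Interpolation.

Section DeterminantIdentity.
Context {R : realType} {m : nat} (V : 'I_m -> R * R) (Om : set (R * R)).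
Context (hOm : convex_polygonal_domain V Om).
Context {n : nat} (T : 'I_n -> 'I_3 -> R * R) (hT : triangulation Om T).
Local Notation P := (measurableTypeR R * measurableTypeR R)%type.
Local Notation leb := (@lebesgue_measure R).
Implicit Types (K : 'I_n) (i : 'I_m) (f g : 'I_n * 'I_3) (k : nat).
Let T0 K : tdet (T K) != 0 := tdet_neq0 hT K.

(** Replacing [g] by a polynomial with the same values at the finitely many
    end points turns the increments into integrals of a derivative, which
    [side_integral] adds up without ordering the edges. *)
Lemma side_telescope i (g : R -> R) :
  \sum_(f | onside V T i f) (g (tp V T i f) - g (tm V T i f)) = g 1 - g 0.
Proof.
pose s : seq R := [:: 0; 1] ++ [seq tm V T i f | f <- enum [set: 'I_n * 'I_3]%SET] ++
  [seq tp V T i f | f <- enum [set: 'I_n * 'I_3]%SET].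
have [q hq] := interpolate s g.
have [q' cq' dq] := dv_poly q.
have s0 : 0 \in s by rewrite inE eqxx.
have s1 : 1 \in s by rewrite !inE eqxx orbT.
have sm f : tm V T i f \in s.
  by rewrite !mem_cat map_f ?orbT// mem_enum inE.
have sp f : tp V T i f \in s.
  by rewrite !mem_cat [X in _ || (_ || X)]map_f ?orbT// mem_enum inE.
rewrite -(hq _ s0) -(hq _ s1) -(FTC ler01 cq' dq).
rewrite (side_integral hOm hT (i := i) (G := fun _ => q'))//.
apply: eq_bigr => f fi; rewrite (FTC _ cq' dq) ?hq//.
exact: ltW (tm_lt_tp hOm hT fi).
Qed.

Lemma side_ftc i (g : R -> R) (G G' : 'I_n * 'I_3 -> R -> R) :
  (forall f, dv (G f) (G' f)) -> (forall f, continuous (G' f)) ->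
  (forall f t, onside V T i f -> tm V T i f <= t <= tp V T i f -> g t = G f t) ->
  \sum_(f | onside V T i f) \int[leb]_(t in `[tm V T i f, tp V T i f]) G' f t = g 1 - g 0.
Proof.
move=> dG cG gG; rewrite -(side_telescope i g); apply: eq_bigr => f fi.
have lt := ltW (tm_lt_tp hOm hT fi).
by rewrite (FTC lt (cG f) (dG f)) -!gG// lexx lt.
Qed.

Variables (k : nat) (u v : R * R -> R) (A B : 'I_n -> R * R -> R).
Hypotheses (hA : piecewise T k u A) (hB : piecewise T k v B).

Definition jacobian (a b : R * R -> R) x : R :=
  partial 0 a x * partial 1 b x - partial 1 a x * partial 0 b x.

Let pA K : p2 k (A K). Proof. by have [] := hA K. Qed.
Let pB K : p2 k (B K). Proof. by have [] := hB K. Qed.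
Let cA K : continuous (A K). Proof. exact: p2_continuous (pA K). Qed.
Let cB j K : continuous (partial j (B K)).
Proof. exact: p2_continuous (p2_partial j (pB K)). Qed.

Arguments cA : clear implicits.
Arguments cB : clear implicits.

Lemma side_paramE i t : side_param V i t =
  ((V i).1 + t * (side_vec V i).1, (V i).2 + t * (side_vec V i).2).
Proof. exact: pairE. Qed.

Lemma edge_continuous (x y : R * R) :
  continuous (fun t : R => (x.1 + t * (y.1 - x.1), x.2 + t * (y.2 - x.2))).
Proof. continuity. Qed.

Definition edge_form f : R := \int[leb]_(t in `[0, 1])
  let x := ((src T f).1 + t * ((tgt T f).1 - (src T f).1),
            (src T f).2 + t * ((tgt T f).2 - (src T f).2)) in
  A f.1 x * (((tgt T f).1 - (src T f).1) * partial 0 (B f.1) x +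
             ((tgt T f).2 - (src T f).2) * partial 1 (B f.1) x).

Lemma jacobian_element K :
  \int[area]_(x in open_elt T K) jacobian (A K) (B K) x = \sum_a edge_form (K, a).
Proof.
have dA l x : derivable (A K) x (unit_vec l) by exact: (p2_derivable (pA K)).
have dB l l' x : derivable (partial l (B K)) x (unit_vec l').
  exact: (p2_derivable (p2_partial l (pB K))).
have cPA l := p2_continuous (p2_partial l (pA K)).
have cPB l l' := p2_continuous (p2_partial l (p2_partial l' (pB K))).
have mo := measurable_open_elt T K.
have h1 := @green_x R n T T0 (fun x => A K x * partial 1 (B K) x)
  (fun x => partial 0 (A K) x * partial 1 (B K) x + A K x * partial 0 (partial 1 (B K)) x) K
  (ct_mul (cA K) (cB 1 K)) (ct_add (ct_mul (cPA 0) (cB 1 K)) (ct_mul (cA K) (cPB 0 1)))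
  (fun y => dv_mul (dv_row y (dA 0)) (dv_row y (dB 1 0))).
have h2 := @green_y R n T T0 (fun x => A K x * partial 0 (B K) x)
  (fun x => partial 1 (A K) x * partial 0 (B K) x + A K x * partial 1 (partial 0 (B K)) x) K
  (ct_mul (cA K) (cB 0 K)) (ct_add (ct_mul (cPA 1) (cB 0 K)) (ct_mul (cA K) (cPB 1 0)))
  (fun y => dv_mul (dv_col y (dA 1)) (dv_col y (dB 0 1))).
transitivity (\int[area]_(x in open_elt T K)
    (partial 0 (A K) x * partial 1 (B K) x + A K x * partial 0 (partial 1 (B K)) x) -
  \int[area]_(x in open_elt T K)
    (partial 1 (A K) x * partial 0 (B K) x + A K x * partial 1 (partial 0 (B K)) x)).
  rewrite -(RintegralB mo (open_elt_integrable hT K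
      (ct_add (ct_mul (cPA 0) (cB 1 K)) (ct_mul (cA K) (cPB 0 1))))
    (open_elt_integrable hT K
      (ct_add (ct_mul (cPA 1) (cB 0 K)) (ct_mul (cA K) (cPB 1 0))))).
  apply: eq_Rintegral => x _; rewrite /jacobian (partial_comm x (pB K)).
  move: (partial 0 (A K) x) (partial 1 (A K) x) (partial 0 (B K) x) (partial 1 (B K) x)
    (A K x) (partial 0 (partial 1 (B K)) x) => a0 a1 b0 b1 a b01; ring.
rewrite [X in X - _]h1.
rewrite [X in _ - X]h2.
rewrite opprK.
rewrite -big_split /=.
apply: eq_bigr => a _.
have ce := @edge_continuous (src T (K, a)) (tgt T (K, a)).
have c1 l := ct_mul (ct_comp (cA K) ce) (ct_comp (cB l K) ce).
rewrite /eint /edge_form [LHS](Rintegral_comb _ _ _ _ (c1 1) (c1 0)).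
apply: eq_Rintegral => t _ /=.
move: (A K _) (partial 0 (B K) _) (partial 1 (B K) _) => x b0 b1; ring.
Qed.

Let uA K x : elt T K x -> u x = A K x. Proof. by have [_] := hA K; exact. Qed.
Let vB K x : elt T K x -> v x = B K x. Proof. by have [_] := hB K; exact. Qed.

Let dvB (f : 'I_n * 'I_3) (x w : R * R) := p2_line x w (pB f.1).

Lemma edge_form_neighbours f g : neighbours T f g -> edge_form f = - edge_form g.
Proof.
move=> fg; have [st ts] := neighbours_reverse hT fg.
have cint h : continuous (fun t : R =>
    let x := ((src T h).1 + t * ((tgt T h).1 - (src T h).1),
              (src T h).2 + t * ((tgt T h).2 - (src T h).2)) in
    A h.1 x * (((tgt T h).1 - (src T h).1) * partial 0 (B h.1) x +
               ((tgt T h).2 - (src T h).2) * partial 1 (B h.1) x)).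
  have ce := @edge_continuous (src T h) (tgt T h).
  have cBe l := ct_comp (cB l h.1) ce.
  exact: (ct_mul (ct_comp (cA h.1) ce) (ct_add (ct_mul (@ct_cst _ _ _) (cBe 0))
    (ct_mul (@ct_cst _ _ _) (cBe 1)))).
rewrite /edge_form -(Rintegral_flip (cint f)).
rewrite -[RHS]mulN1r [RHS](Rintegral_scale _ _ _ (cint g)).
apply: (@Rintegral_off_null _ _ _ leb ([set 0; 1] : set (measurableTypeR R)) `[0, 1]%classic).
- by apply: measurableU; exact: measurable_set1.
- apply/eqP; rewrite eq_le measure_ge0 andbT.
  apply: (le_trans (measureU2 _ _ _)); try exact: measurable_set1.
  by rewrite /= !lebesgue_measure_set1 adde0.
move=> t /=; rewrite in_itv/= => /andP[t0 t1] nt.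
have t01 : 0 < t < 1.
  by apply/andP; split; rewrite lt_neqAle ?t0 ?t1 andbT; apply/eqP => e; apply: nt;
    [left|right].
have t01' : 0 <= t <= 1 by rewrite t0 t1.
pose w := ((tgt T f).1 - (src T f).1, (tgt T f).2 - (src T f).2).
pose w' := ((tgt T g).1 - (src T g).1, (tgt T g).2 - (src T g).2).
have flipE s : ((src T g).1 + s * w'.1, (src T g).2 + s * w'.2) =
    ((src T f).1 + (1 - s) * w.1, (src T f).2 + (1 - s) * w.2).
  by rewrite /w /w' -st -ts /=; congr (_, _); ring.
have hu s : 0 <= s <= 1 -> A g.1 ((src T g).1 + s * w'.1, (src T g).2 + s * w'.2) =
    A f.1 ((src T f).1 + (1 - s) * w.1, (src T f).2 + (1 - s) * w.2).
  move=> s01; have s01' : 0 <= 1 - s <= 1 by case/andP: s01 => ? ?; apply/andP; split; lra.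
  by rewrite -(uA (segment_elt hT g s01)) -(uA (segment_elt hT f s01')) flipE.
have hv s : 0 <= s <= 1 -> B g.1 ((src T g).1 + s * w'.1, (src T g).2 + s * w'.2) =
    B f.1 ((src T f).1 + (1 - s) * w.1, (src T f).2 + (1 - s) * w.2).
  move=> s01; have s01' : 0 <= 1 - s <= 1 by case/andP: s01 => ? ?; apply/andP; split; lra.
  by rewrite -(vB (segment_elt hT g s01)) -(vB (segment_elt hT f s01')) flipE.
have d := dv_local (dvB g (src T g) w') (dv_flip (dvB f (src T f) w)) hv t01.
have e := hu t t01'.
rewrite /= in d e *; rewrite d e; ring.
Qed.

(** The Jacobian determinant is a divergence. Along an edge only the
    tangential derivative of the second function occurs, and the contributions
    of neighbours are opposite because both functions are continuous across
    their common edge. *)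
Lemma jacobian_boundary :
  \sum_K \int[area]_(x in open_elt T K) jacobian (A K) (B K) x =
  \sum_i \sum_(f | onside V T i f) \int[leb]_(t in `[tm V T i f, tp V T i f])
    (A f.1 (side_param V i t) *
     ((side_vec V i).1 * partial 0 (B f.1) (side_param V i t) +
      (side_vec V i).2 * partial 1 (B f.1) (side_param V i t))).
Proof.
have -> : \sum_K \int[area]_(x in open_elt T K) jacobian (A K) (B K) x =
    \sum_f edge_form f.
  transitivity (\sum_K \sum_a edge_form (K, a)).
    by apply: eq_bigr => K _; exact: jacobian_element.
  rewrite (pair_bigA _ (fun K a => edge_form (K, a))) /=.
  by apply: eq_bigr => -[K a] _.
transitivity (\sum_i \sum_(f | onside V T i f) edge_form f).
  exact: (flag_sum hOm hT edge_form_neighbours).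
apply: eq_bigr => i _; apply: eq_bigr => f fi.
have sE := src_param hOm fi; have tE := tgt_param hOm fi.
have lt := ltW (tm_lt_tp hOm hT fi).
have cAf := cA f.1; have cBf l := cB l f.1.
have cs : continuous (side_param V i).
  apply: continuous_pair; rewrite /GRing.scale /= /GRing.scale /=; continuity.
have cF := ct_mul (ct_comp cAf cs) (ct_add (ct_mul (@ct_cst _ _ (side_vec V i).1)
  (ct_comp (cBf 0) cs)) (ct_mul (@ct_cst _ _ (side_vec V i).2) (ct_comp (cBf 1) cs))).
rewrite (Rintegral_affine lt cF) Rintegral_scale; last first.
  by apply: (ct_comp cF); continuity.
apply: eq_Rintegral => t _.
have -> : side_param V i (tm V T i f + t * (tp V T i f - tm V T i f)) =
   ((src T f).1 + t * ((tgt T f).1 - (src T f).1),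
    (src T f).2 + t * ((tgt T f).2 - (src T f).2)).
  by rewrite -sE -tE !side_paramE /=; congr (_, _); ring.
set x := (_, _); rewrite /edge_form -/x.
have -> : (tgt T f).1 - (src T f).1 = (tp V T i f - tm V T i f) * (side_vec V i).1.
  by rewrite -sE -tE !side_paramE /=; ring.
have -> : (tgt T f).2 - (src T f).2 = (tp V T i f - tm V T i f) * (side_vec V i).2.
  by rewrite -sE -tE !side_paramE /=; ring.
move: (A f.1 x) (partial 0 (B f.1) x) (partial 1 (B f.1) x) (side_vec V i).1
  (side_vec V i).2 => a b0 b1 d1 d2; ring.
Qed.

End DeterminantIdentity.

(** * Forms and norms as sums over elements and edges *)

Section FormReduction.
Context {R : realType} {m : nat} (V : 'I_m -> R * R) (Om : set (R * R)).
Context (hOm : convex_polygonal_domain V Om).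
Context {n : nat} (T : 'I_n -> 'I_3 -> R * R) (hT : triangulation Om T).
Local Notation P2 := (measurableTypeR R * measurableTypeR R)%type.
Local Notation leb := (@lebesgue_measure R).
Implicit Types (K : 'I_n) (i : 'I_m) (f g : 'I_n * 'I_3) (k : nat) (x : R * R)
  (u v : R * R -> 'cV[R]_2) (P Q : 'I_2 -> 'I_n -> R * R -> R) (mu lam : R).

Definition pwfield k u P := forall j, piecewise T k (fun x => u x j 0) (P j).

(** Entries of the gradient of a pair of polynomials, row by row: [ga] and
    [gb] belong to the first component, [gc] and [gd] to the second. *)
Definition ga P K x := partial 0 (P 0 K) x.
Definition gb P K x := partial 1 (P 0 K) x.
Definition gc P K x := partial 0 (P 1 K) x.
Definition gd P K x := partial 1 (P 1 K) x.

Definition gradP P K x : 'M[R]_2 := \matrix_(i, j) partial j (P i K) x.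

Definition n1 i : R := (side_vec V i).2 / enorm (side_vec V i).
Definition n2 i : R := - (side_vec V i).1 / enorm (side_vec V i).

(** Densities: [qa] and [qb] of the two bilinear forms, [qG], [qE] and [qD] of
    the squared gradient, strain and divergence, [qB] and [qN] of the squared
    boundary value and of its normal component. *)
Definition qa mu lam P Q K x :=
  2 * mu * (ga P K x * ga Q K x + gd P K x * gd Q K x +
            (gb P K x + gc P K x) * (gb Q K x + gc Q K x) / 2) +
  lam * ((ga P K x + gd P K x) * (ga Q K x + gd Q K x)).

Definition qb mu lam P Q i f x :=
  2 * mu * ((ga P f.1 x * n1 i + (gb P f.1 x + gc P f.1 x) / 2 * n2 i) * Q 0 f.1 x +
            ((gb P f.1 x + gc P f.1 x) / 2 * n1 i + gd P f.1 x * n2 i) * Q 1 f.1 x) +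
  lam * ((ga P f.1 x + gd P f.1 x) * (Q 0 f.1 x * n1 i + Q 1 f.1 x * n2 i)).

Definition qG P K x := ga P K x ^+ 2 + gb P K x ^+ 2 + gc P K x ^+ 2 + gd P K x ^+ 2.
Definition qE P K x := ga P K x ^+ 2 + gd P K x ^+ 2 + (gb P K x + gc P K x) ^+ 2 / 2.
Definition qD P K x := (ga P K x + gd P K x) ^+ 2.
Definition qB P f x := P 0 f.1 x ^+ 2 + P 1 f.1 x ^+ 2.
Definition qN P i f x := (P 0 f.1 x * n1 i + P 1 f.1 x * n2 i) ^+ 2.

Definition sumK (q : 'I_n -> R * R -> R) : R := \sum_K \int[area]_(x in open_elt T K) q K x.

Definition sumF (q : 'I_m -> 'I_n * 'I_3 -> R * R -> R) : R :=
  \sum_i \sum_(f | onside V T i f) enorm (side_vec V i) *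
    \int[leb]_(t in `[tm V T i f, tp V T i f]) q i f (side_param V i t).

Lemma sumI2 (F : 'I_2 -> R) : \sum_i F i = F 0 + F 1.
Proof. by rewrite !big_ord_recl big_ord0 addr0; congr (_ + F _); apply/val_inj. Qed.

Section Fields.
Variables (k l : nat) (u v : R * R -> 'cV[R]_2) (P Q : 'I_2 -> 'I_n -> R * R -> R).
Hypotheses (hP : pwfield k u P) (hQ : pwfield l v Q).

Lemma field_val K x j : elt T K x -> u x j 0 = P j K x.
Proof. by have [_] := hP j K; exact. Qed.

Lemma field_continuous j K : continuous (P j K).
Proof. by have [/p2_continuous] := hP j K. Qed.

Lemma field_partial_continuous j j' K : continuous (partial j' (P j K)).
Proof. by have [h _] := hP j K; exact: p2_continuous (p2_partial j' h). Qed.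

Lemma grad_open K x : open_elt T K x -> grad u x = gradP P K x.
Proof.
move=> Kx; apply/matrixP => i j; rewrite !mxE /partial; apply: near_eq_derive.
have : nbhs x (open_elt T K).
  by apply: open_nbhs_nbhs; split => //; exact: open_open_elt.
by apply: filterS => y /(open_elt_sub hT); exact: field_val.
Qed.

(** Near an inner point of a boundary edge the domain consists of one element,
    which makes the trace of the gradient a polynomial value. *)
Lemma near_edge i f t : onside V T i f -> tm V T i f < t < tp V T i f ->
  \forall y \near within Om (nbhs (side_param V i t)), open_elt T f.1 y.
Proof.
move=> fi ft; set x := side_param V i t.
have : \forall y \near x, forall c, c != f.2 -> 0 < lam (T f.1) c y.
  apply: (filter_forall (nbhs_filter x)) => c.
  have [->|cf] := eqVneq c f.2; first by apply: nearW.
  have := @near_pos _ _ (lam (T f.1) c) x (@continuous_lam _ _ _) (edge_inner hOm hT fi ft cf).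
  by apply: filterS.
rewrite /within /prop_near1 /nbhs /=; apply: filterS => y hy Oy c.
have [->|cf] := eqVneq c f.2; last exact: hy.
have := ell_gt0 hOm i Oy; rewrite (onside_ell hT _ fi).
by rewrite pmulr_lgt0// (onside_apex hOm hT fi).
Qed.

Lemma trace_grad_edge i f t : onside V T i f -> tm V T i f < t < tp V T i f ->
  trace_grad Om u (side_param V i t) = gradP P f.1 (side_param V i t).
Proof.
move=> fi ft; set x := side_param V i t.
have cx : closure Om x.
  apply: (elt_closure hT (K := f.1)); apply: (edge_elt hOm hT fi).
  by case/andP: ft => h1 h2; rewrite !ltW.
have PF : ProperFilter (within Om (nbhs x)) by exact: within_nbhs_proper.
apply/matrixP => a b; rewrite !mxE; apply: cvg_lim => //.
apply: cvg_trans (_ : partial b (P a f.1) y @[y --> within Om (nbhs x)] --> _).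
  apply: near_eq_cvg; apply: filterS (near_edge fi ft) => y Ky.
  by rewrite (grad_open Ky) mxE.
by apply: cvg_within_filter; exact: field_partial_continuous.
Qed.

Lemma field_edge f i t j : onside V T i f -> tm V T i f < t < tp V T i f ->
  u (side_param V i t) j 0 = P j f.1 (side_param V i t).
Proof.
move=> fi ft; apply: field_val; apply: (edge_elt hOm hT fi).
by case/andP: ft => h1 h2; rewrite !ltW.
Qed.

End Fields.

Lemma side_param_continuous i : continuous (side_param V i).
Proof.
rewrite (_ : side_param V i = fun t =>
  ((V i).1 + t * (side_vec V i).1, (V i).2 + t * (side_vec V i).2)); last first.
  by apply/funext => t; exact: side_paramE.
apply: continuous_pair; continuity.
Qed.

Lemma sumK_add q q' : (forall K, continuous (q K)) -> (forall K, continuous (q' K)) ->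
  sumK q + sumK q' = sumK (fun K x => q K x + q' K x).
Proof.
move=> cq cq'; rewrite /sumK -big_split; apply: eq_bigr => K _ /=.
by rewrite (RintegralD (measurable_open_elt T K) (open_elt_integrable hT K (cq K))
  (open_elt_integrable hT K (cq' K))).
Qed.

Lemma sumK_scale (c : R) q : (forall K, continuous (q K)) ->
  c * sumK q = sumK (fun K x => c * q K x).
Proof.
move=> cq; rewrite /sumK mulr_sumr; apply: eq_bigr => K _.
by rewrite (RintegralZl _ (measurable_open_elt T K) (open_elt_integrable hT K (cq K))).
Qed.

Lemma sumK_le q q' : (forall K, continuous (q K)) -> (forall K, continuous (q' K)) ->
  (forall K x, elt T K x -> q K x <= q' K x) -> sumK q <= sumK q'.
Proof.
move=> cq cq' le; apply: ler_sum => K _; apply: le_Rintegral.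
- exact: measurable_open_elt.
- exact: (open_elt_integrable hT K (cq K)).
- exact: (open_elt_integrable hT K (cq' K)).
- by move=> x /(open_elt_sub hT); exact: le.
Qed.

Lemma sumF_add q q' : (forall i f, continuous (q i f)) -> (forall i f, continuous (q' i f)) ->
  sumF q + sumF q' = sumF (fun i f x => q i f x + q' i f x).
Proof.
move=> cq cq'; rewrite /sumF -big_split; apply: eq_bigr => i _ /=.
rewrite -big_split; apply: eq_bigr => f _ /=; rewrite -mulrDr; congr (_ * _).
have cs := @side_param_continuous i.
have := Rintegral_comb (tm V T i f) (tp V T i f) 1 1 (ct_comp (cq i f) cs) (ct_comp (cq' i f) cs).
by rewrite !mul1r => ->; apply: eq_Rintegral => t _; rewrite !mul1r.
Qed.

Lemma sumF_scale (c : R) q : (forall i f, continuous (q i f)) ->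
  c * sumF q = sumF (fun i f x => c * q i f x).
Proof.
move=> cq; rewrite /sumF mulr_sumr; apply: eq_bigr => i _ /=.
rewrite mulr_sumr; apply: eq_bigr => f _ /=; rewrite mulrCA; congr (_ * _).
exact: Rintegral_scale (ct_comp (cq i f) (@side_param_continuous i)).
Qed.

Lemma enorm_ge0 x : 0 <= enorm x. Proof. exact: sqrtr_ge0. Qed.

Lemma sumF_le q q' : (forall i f, continuous (q i f)) -> (forall i f, continuous (q' i f)) ->
  (forall i f t, onside V T i f -> tm V T i f <= t <= tp V T i f ->
    q i f (side_param V i t) <= q' i f (side_param V i t)) -> sumF q <= sumF q'.
Proof.
move=> cq cq' le; apply: ler_sum => i _; apply: ler_sum => f fi.
rewrite ler_wpM2l ?enorm_ge0//; have cs := @side_param_continuous i.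
by apply: (Rintegral_le_itv (ct_comp (cq i f) cs) (ct_comp (cq' i f) cs)) => t; exact: le.
Qed.

Lemma bintE (F : 'I_m -> R * R -> R) q : (forall i f, continuous (q i f)) ->
  (forall i f t, onside V T i f -> tm V T i f < t < tp V T i f ->
     F i (side_param V i t) = q i f (side_param V i t)) ->
  bint V F = sumF q.
Proof.
move=> cq Fq; rewrite /bint /sumF; apply: eq_bigr => i _; rewrite -mulr_sumr.
congr (_ * _); apply: (side_integral hOm hT (i := i)
  (F := fun t => F i (side_param V i t)) (G := fun f t => q i f (side_param V i t))).
  by move=> f; exact: (ct_comp (cq i f) (@side_param_continuous i)).
by move=> f t; exact: Fq.
Qed.

Lemma normalE i : normal V i 0 0 = n1 i /\ normal V i 1 0 = n2 i.
Proof. by rewrite /normal !mxE /n1 /n2 /= ![_^-1 * _]mulrC. Qed.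

Section Reductions.
Variables (k : nat) (u v : R * R -> 'cV[R]_2) (P Q : 'I_2 -> 'I_n -> R * R -> R).
Hypotheses (hP : pwfield k u P) (hQ : pwfield k v Q).

Lemma ga_continuous (P' : 'I_2 -> 'I_n -> R * R -> R) w K : pwfield k w P' ->
  [/\ continuous (ga P' K), continuous (gb P' K), continuous (gc P' K),
      continuous (gd P' K) & forall j, continuous (P' j K)].
Proof.
move=> h; split; try exact: (field_partial_continuous h).
by move=> j; exact: (field_continuous h).
Qed.

Lemma gradP_entries P' K x : [/\ gradP P' K x 0 0 = ga P' K x, gradP P' K x 0 1 = gb P' K x,
  gradP P' K x 1 0 = gc P' K x & gradP P' K x 1 1 = gd P' K x].
Proof. by split; rewrite mxE. Qed.

Lemma frob_sym (A B : 'M[R]_2) : frob (sym A) (sym B) =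
  A 0 0 * B 0 0 + A 1 1 * B 1 1 + (A 0 1 + A 1 0) * (B 0 1 + B 1 0) / 2.
Proof.
rewrite /frob sumI2 !sumI2 /sym !mxE.
move: (A 0 0) (A 0 1) (A 1 0) (A 1 1) (B 0 0) (B 0 1) (B 1 0) (B 1 1) => a b c d a' b' c' d'.
by field.
Qed.

Lemma dot_sym (A : 'M[R]_2) (y z : 'cV[R]_2) : dot (sym A *m y) z =
  (A 0 0 * y 0 0 + (A 0 1 + A 1 0) / 2 * y 1 0) * z 0 0 +
  ((A 0 1 + A 1 0) / 2 * y 0 0 + A 1 1 * y 1 0) * z 1 0.
Proof.
rewrite /dot sumI2 !mxE !sumI2 /sym !mxE.
move: (A 0 0) (A 0 1) (A 1 0) (A 1 1) (y 0 0) (y 1 0) (z 0 0) (z 1 0) => a b c d p q r s.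
by field.
Qed.

Lemma trace2 (A : 'M[R]_2) : \tr A = A 0 0 + A 1 1.
Proof. by rewrite /mxtrace sumI2. Qed.

Lemma form_aE mu lam : form_a Om mu lam u v = sumK (qa mu lam P Q).
Proof.
pose q1 K x := 2 * mu * (ga P K x * ga Q K x + gd P K x * gd Q K x +
            (gb P K x + gc P K x) * (gb Q K x + gc Q K x) / 2).
pose q2 K x := lam * ((ga P K x + gd P K x) * (ga Q K x + gd Q K x)).
have c1 K : continuous (q1 K).
  rewrite /q1; move: (ga_continuous K hP) (ga_continuous K hQ) => [+ + + + _] [+ + + + _].
  by move: (ga P K) (gb P K) (gc P K) (gd P K) (ga Q K) (gb Q K) (gc Q K) (gd Q K) =>
    a b c d a' b' c' d' ? ? ? ? ? ? ? ?; continuity.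
have c2 K : continuous (q2 K).
  rewrite /q2; move: (ga_continuous K hP) (ga_continuous K hQ) => [+ _ _ + _] [+ _ _ + _].
  by move: (ga P K) (gd P K) (ga Q K) (gd Q K) => a d a' d' ? ? ? ?; continuity.
have E1 : \int[area]_(x in Om) (2 * mu * frob (strain u x) (strain v x)) = sumK q1.
  apply: (Om_integral hOm hT (G := q1)) => // K x Kx.
  rewrite /strain (grad_open hP Kx) (grad_open hQ Kx) frob_sym /q1.
  by have [-> -> -> ->] := gradP_entries P K x; have [-> -> -> ->] := gradP_entries Q K x.
have E2 : \int[area]_(x in Om) (lam * div u x * div v x) = sumK q2.
  apply: (Om_integral hOm hT (G := q2)) => // K x Kx.
  rewrite /div (grad_open hP Kx) (grad_open hQ Kx) !trace2 /q2 mulrA.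
  by have [-> _ _ ->] := gradP_entries P K x; have [-> _ _ ->] := gradP_entries Q K x.
rewrite /form_a; transitivity (sumK q1 + sumK q2); first by congr (_ + _).
exact: sumK_add.
Qed.

Lemma form_bE mu lam : form_b V Om mu lam u v = sumF (qb mu lam P Q).
Proof.
pose q1 i f x :=
  2 * mu * ((ga P f.1 x * n1 i + (gb P f.1 x + gc P f.1 x) / 2 * n2 i) * Q 0 f.1 x +
            ((gb P f.1 x + gc P f.1 x) / 2 * n1 i + gd P f.1 x * n2 i) * Q 1 f.1 x).
pose q2 i f x :=
  lam * ((ga P f.1 x + gd P f.1 x) * (Q 0 f.1 x * n1 i + Q 1 f.1 x * n2 i)).
have c1 i f : continuous (q1 i f).
  rewrite /q1; move: (ga_continuous f.1 hP) (ga_continuous f.1 hQ) => [+ + + + _] [_ _ _ _ H].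
  move: (H 0) (H 1); move: (n1 i) (n2 i) (ga P f.1) (gb P f.1) (gc P f.1) (gd P f.1).
  by move: (Q 0 f.1) (Q 1 f.1) => a b c d a' b' c' d' ? ? ? ? ? ?; continuity.
have c2 i f : continuous (q2 i f).
  rewrite /q2; move: (ga_continuous f.1 hP) (ga_continuous f.1 hQ) => [+ _ _ + _] [_ _ _ _ H].
  move: (H 0) (H 1); move: (n1 i) (n2 i) (ga P f.1) (gd P f.1).
  by move: (Q 0 f.1) (Q 1 f.1) => a b c d a' b' ? ? ? ?; continuity.
have E1 : bint V (fun i x => 2 * mu * dot (trace_strain Om u x *m normal V i) (v x)) = sumF q1.
  apply: bintE => // i f t fi ft; rewrite /trace_strain (trace_grad_edge hP fi ft).
  have [e1 e2] := normalE i.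
  rewrite dot_sym e1 e2 (field_edge hQ 0 fi ft) (field_edge hQ 1 fi ft) /q1.
  by have [-> -> -> ->] := gradP_entries P f.1 (side_param V i t).
have E2 : bint V (fun i x => lam * trace_div Om u x * dot (v x) (normal V i)) = sumF q2.
  apply: bintE => // i f t fi ft; rewrite /trace_div (trace_grad_edge hP fi ft).
  have [e1 e2] := normalE i.
  rewrite /dot sumI2 e1 e2 (field_edge hQ 0 fi ft) (field_edge hQ 1 fi ft) trace2 /q2 mulrA.
  by have [-> _ _ ->] := gradP_entries P f.1 (side_param V i t).
rewrite /form_b; transitivity (sumF q1 + sumF q2); first by congr (_ + _).
exact: sumF_add.
Qed.

Definition norm2 mu lam (h : R) P' : R :=
  mu * (sumK (qG P') + h^-1 * sumF (fun _ => qB P')) +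
  lam * (sumK (qD P') + h^-1 * sumF (qN P')).

Lemma triple_normE mu lam h : triple_norm V Om mu lam h u = Num.sqrt (norm2 mu lam h P).
Proof.
have H K := ga_continuous K hP.
have cG K : continuous (qG P K).
  rewrite /qG; move: (H K) => [+ + + + _]; move: (ga P K) (gb P K) (gc P K) (gd P K).
  by move=> a b c d ? ? ? ?; continuity.
have cD K : continuous (qD P K).
  rewrite /qD; move: (H K) => [+ _ _ + _]; move: (ga P K) (gd P K).
  by move=> a b ? ?; continuity.
have cB i f : continuous (qB P f).
  rewrite /qB; move: (H f.1) => [_ _ _ _ h']; move: (h' 0) (h' 1).
  by move: (P 0 f.1) (P 1 f.1) => a b ? ?; continuity.
have cN i f : continuous (qN P i f).
  rewrite /qN; move: (H f.1) => [_ _ _ _ h']; move: (h' 0) (h' 1).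
  by move: (n1 i) (n2 i) (P 0 f.1) (P 1 f.1) => p q a b ? ?; continuity.
have EG : \int[area]_(x in Om) frob (grad u x) (grad u x) = sumK (qG P).
  apply: (Om_integral hOm hT (G := qG P)) => // K x Kx.
  have [e1 e2 e3 e4] := gradP_entries P K x.
  by rewrite (grad_open hP Kx) /frob sumI2 !sumI2 e1 e2 e3 e4 /qG !expr2 !addrA.
have ED : \int[area]_(x in Om) (div u x ^+ 2) = sumK (qD P).
  apply: (Om_integral hOm hT (G := qD P)) => // K x Kx.
  rewrite /div (grad_open hP Kx) trace2 /qD.
  by have [-> _ _ ->] := gradP_entries P K x.
have EB : bint V (fun _ x => h^-1 * dot (u x) (u x)) = h^-1 * sumF (fun _ => qB P).
  rewrite [RHS]sumF_scale//; apply: bintE.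
    by move=> i f; exact: (@ct_mul _ _ (fun=> h^-1) _ (@ct_cst _ _ _) (cB i f)).
  move=> i f t fi ft; rewrite /dot sumI2 (field_edge hP 0 fi ft) (field_edge hP 1 fi ft) /qB.
  by rewrite !expr2.
have EN : bint V (fun i x => h^-1 * dot (u x) (normal V i) ^+ 2) = h^-1 * sumF (qN P).
  rewrite [RHS]sumF_scale//; apply: bintE.
    by move=> i f; exact: (@ct_mul _ _ (fun=> h^-1) _ (@ct_cst _ _ _) (cN i f)).
  move=> i f t fi ft; have [e1 e2] := normalE i.
  by rewrite /dot sumI2 e1 e2 (field_edge hP 0 fi ft) (field_edge hP 1 fi ft).
have E4 (a b c d a' b' c' d' : R) : a = a' -> b = b' -> c = c' -> d = d' ->
  Num.sqrt (mu * (a + b) + lam * (c + d)) = Num.sqrt (mu * (a' + b') + lam * (c' + d')).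
  by move=> -> -> -> ->.
exact: E4 EG EB ED EN.
Qed.

End Reductions.
End FormReduction.

(** * Size and shape of the elements *)

Section EuclideanNorm.
Context {R : realType}.
Implicit Types (x y w : R * R) (r : R).

Lemma enorm_sqr x : enorm x ^+ 2 = x.1 ^+ 2 + x.2 ^+ 2.
Proof. by rewrite sqr_sqrtr// addr_ge0// sqr_ge0. Qed.

Lemma enorm_le x r : 0 <= r -> (enorm x <= r) = (x.1 ^+ 2 + x.2 ^+ 2 <= r ^+ 2).
Proof. by move=> r0; rewrite -enorm_sqr ler_sqr// nnegrE// sqrtr_ge0. Qed.

Lemma enorm_coord x r : enorm x <= r -> `|x.1| <= r /\ `|x.2| <= r.
Proof.
move=> xr; have r0 : 0 <= r := le_trans (sqrtr_ge0 _) xr.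
move: xr; rewrite enorm_le// => xr.
by split; rewrite -ler_sqr ?nnegrE// real_normK ?num_real//;
  apply: le_trans xr; rewrite ?lerDl ?lerDr sqr_ge0.
Qed.

Lemma cross_le x y : cross x y <= enorm x * enorm y.
Proof.
apply: le_trans (ler_norm _) _.
rewrite -ler_sqr ?nnegrE ?mulr_ge0 ?sqrtr_ge0//.
rewrite real_normK ?num_real// exprMn !enorm_sqr /cross -subr_ge0.
set e := (X in 0 <= X); have -> : e = (x.1 * y.1 + x.2 * y.2) ^+ 2 by rewrite /e; ring.
exact: sqr_ge0.
Qed.

Lemma enorm_gt0 x : x != 0 -> 0 < enorm x.
Proof.
case: x => x1 x2 xn; rewrite sqrtr_gt0 /= lt_neqAle addr_ge0 ?sqr_ge0// andbT eq_sym.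
by rewrite paddr_eq0 ?sqr_ge0// !sqrf_eq0; apply: contra xn => /andP[/eqP -> /eqP ->].
Qed.

End EuclideanNorm.

Section Scaling.
Context {R : realType} {m : nat} (V : 'I_m -> R * R) (Om : set (R * R)).
Context (hOm : convex_polygonal_domain V Om).
Context {n : nat} (T : 'I_n -> 'I_3 -> R * R) (hT : triangulation Om T).
Local Notation P2 := (measurableTypeR R * measurableTypeR R)%type.
Local Notation leb := (@lebesgue_measure R).
Implicit Types (K L : 'I_n) (i : 'I_m) (f g : 'I_n * 'I_3) (x y w : R * R).
Variables (c_rho c_qu : R).
Hypotheses (hS : shape_regular T c_rho) (hQ : quasi_uniform T c_qu).
Local Notation h := (meshsize T).
Let T0 K : tdet (T K) != 0 := tdet_neq0 hT K.

Lemma dist_le_diam K x y : elt T K x -> elt T K y -> enorm (x - y) <= diam (elt T K).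
Proof.
move=> Kx Ky; apply: ub_le_sup; last by exists x, y.
have [M hM] := elt_inbox T K; exists (2 * M + 2 * M) => _ [x' [y' [/hM Kx' /hM Ky' ->]]].
have [a1 a2] := sqbox_bounds Kx'; have [b1 b2] := sqbox_bounds Ky'.
have M0 : 0 <= M := le_trans (normr_ge0 _) a1.
rewrite enorm_le; last by lra.
have d1 : `|(x' - y').1| <= 2 * M.
  by apply: le_trans (ler_normB _ _) _; rewrite mulr_natl mulr2n lerD.
have d2 : `|(x' - y').2| <= 2 * M.
  by apply: le_trans (ler_normB _ _) _; rewrite mulr_natl mulr2n lerD.
have s1 : (x' - y').1 ^+ 2 <= (2 * M) ^+ 2.
  by rewrite -(real_normK (num_real (x' - y').1)) lerXn2r// nnegrE; lra.
have s2 : (x' - y').2 ^+ 2 <= (2 * M) ^+ 2.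
  by rewrite -(real_normK (num_real (x' - y').2)) lerXn2r// nnegrE; lra.
apply: le_trans (lerD s1 s2) _; rewrite [(2 * M + _) ^+ 2]sqrrD lerD2r.
by rewrite lerDl mulrn_wge0// mulr_ge0// mulr_ge0.
Qed.

Lemma diam_le_meshsize K : diam (elt T K) <= h.
Proof. exact: (le_bigmax _ (fun K => diam (elt T K)) K). Qed.

Lemma dist_le K x y : elt T K x -> elt T K y -> enorm (x - y) <= h.
Proof. by move=> Kx Ky; exact: le_trans (dist_le_diam Kx Ky) (diam_le_meshsize K). Qed.

(** The summand [1] makes the ratio positive for all values of the regularity
    parameters. *)
Definition disc_ratio : R := 2 * `|c_qu| * `|c_rho| + 1.

Lemma disc_ratio_gt0 : 0 < disc_ratio.
Proof. by rewrite /disc_ratio ltr_wpDl// !mulr_ge0. Qed.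

Lemma some_disc K : exists r c, 0 < r /\ forall x, enorm (x - c) <= r -> elt T K x.
Proof.
pose b : R * R := \sum_a 3^-1 *: T K a.
have s1 : \sum_(a : 'I_3) 3^-1 = 1 :> R.
  by rewrite sumr_const card_ord -[LHS]mulr_natr mulVf// pnatr_eq0.
have Kb : open_elt T K b.
  by move=> a; rewrite /b lam_unique// invr_gt0 ltr0n.
have /nbhs_ballP[e /= e0 he] := open_nbhs_nbhs (conj (@open_open_elt _ _ T K) Kb).
exists (e / 2), b; split; first by rewrite divr_gt0.
move=> x /enorm_coord[x1 x2]; apply: (open_elt_sub hT); apply: he.
by split; rewrite /ball/= distrC; [apply: le_lt_trans x1 _|apply: le_lt_trans x2 _];
  rewrite ltr_pdivrMr// ltr_pMr// ltr1n.
Qed.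

(** Shape regularity bounds the diameter of the element by its inradius,
    quasi-uniformity bounds the mesh size by the diameter. *)
Lemma inscribed_disc K : exists r c,
  [/\ 0 < r, h <= disc_ratio * r & forall x, enorm (x - c) <= r -> elt T K x].
Proof.
have [r0 [c0 [r0_gt0 hr0]]] := some_disc K.
pose S := [set r | 0 <= r /\ exists c, forall x, enorm (x - c) <= r -> elt T K x].
have ubS : has_ubound S.
  have [M hM] := elt_inbox T K; exists M => r [r_ge0 [c hc]].
  have e1 : elt T K (c + (r, 0)).
    by apply: hc; rewrite addrAC subrr add0r enorm_le//= expr0n addr0.
  have e2 : elt T K (c - (r, 0)).
    by apply: hc; rewrite addrAC subrr add0r enorm_le//= sqrrN oppr0 expr0n addr0.
  have [a1 _] := sqbox_bounds (hM _ e1); have [a2 _] := sqbox_bounds (hM _ e2).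
  by move: a1 a2 => /=; rewrite !ler_norml => /andP[? ?] /andP[? ?]; lra.
have Sr0 : S r0 by split; [exact: ltW|exists c0].
have iE : inradius (elt T K) = sup S by [].
have i0 : 0 < inradius (elt T K) by apply: lt_le_trans r0_gt0 _; rewrite iE; exact: ub_le_sup.
have hs : has_sup S by split => //; exists r0.
have [r Sr rlt] : exists2 r, S r & inradius (elt T K) / 2 < r.
  apply: sup_gt; first by exists r0.
  by rewrite -iE ltr_pdivrMr// ltr_pMr// ltr1n.
have r_gt0 : 0 < r by apply: le_lt_trans rlt; rewrite divr_ge0// ltW.
case: Sr => _ [c hc]; exists r, c; split => //.
have d_le : diam (elt T K) <= `|c_rho| * (2 * r).
  have := hS K; rewrite ler_pdivrMr// => /le_trans; apply.
  apply: le_trans (ler_wpM2r (ltW i0) (ler_norm _)) _.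
  rewrite ler_wpM2l//; move: rlt; rewrite ltr_pdivrMr// mulrC; exact: ltW.
have d_ge0 : 0 <= diam (elt T K).
  exact: le_trans (sqrtr_ge0 _) (dist_le_diam (vertex_elt hT K 0) (vertex_elt hT K 0)).
apply: le_trans (hQ K) _; apply: le_trans (ler_wpM2r d_ge0 (ler_norm _)) _.
apply: le_trans (ler_wpM2l (normr_ge0 _) d_le) _.
rewrite (_ : disc_ratio * r = `|c_qu| * (`|c_rho| * (2 * r)) + r); first by rewrite lerDl ltW.
by rewrite /disc_ratio; ring.
Qed.

End Scaling.

Lemma enorm0 {R : realType} : enorm (0 : R * R) = 0.
Proof.
by rewrite /enorm (_ : (0 : R * R).1 = 0)// (_ : (0 : R * R).2 = 0)// expr0n addr0 sqrtr0.
Qed.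

Section LamGradient.
Context {R : realType}.
Implicit Types (p : 'I_3 -> R * R) (x y : R * R) (a : 'I_3).

Definition edge_vec p a : R * R := p (a + 2%:R) - p (a + 1).
Definition lam1 p a : R := - (edge_vec p a).2 / tdet p.
Definition lam2 p a : R := (edge_vec p a).1 / tdet p.

Lemma lamE p a x y : lam p a x = lam p a y + (x.1 - y.1) * lam1 p a + (x.2 - y.2) * lam2 p a.
Proof. by rewrite /lam /lam1 /lam2 /edge_vec /cross /=; ring. Qed.

Lemma lam_cross p a x : tdet p != 0 ->
  cross (edge_vec p a) x = cross (edge_vec p a) (p (a + 1)) + lam p a x * tdet p.
Proof. by move=> p0; rewrite /lam divfK// /edge_vec /cross /=; ring. Qed.

End LamGradient.

Definition fat {R : realType} n (T : 'I_n -> 'I_3 -> R * R) (Cq : R) :=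
  forall K, exists r c, [/\ 0 < r, meshsize T <= Cq * r &
    forall x, enorm (x - c) <= r -> elt T K x].

Section ElementEstimates.
Context {R : realType} {m : nat} (V : 'I_m -> R * R) (Om : set (R * R)).
Context (hOm : convex_polygonal_domain V Om).
Context {n : nat} (T : 'I_n -> 'I_3 -> R * R) (hT : triangulation Om T).
Local Notation P2 := (measurableTypeR R * measurableTypeR R)%type.
Local Notation leb := (@lebesgue_measure R).
Implicit Types (K L : 'I_n) (i : 'I_m) (f g : 'I_n * 'I_3) (x y w : R * R) (a : 'I_3).
Variables (Cq : R).
Hypotheses (Cq0 : 0 < Cq) (hfat : fat T Cq).
Local Notation h := (meshsize T).
Let T0 K : tdet (T K) != 0 := tdet_neq0 hT K.

Lemma meshsize_gt0 K : 0 < h.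
Proof.
have [r [c [r0 _ hr]]] := hfat K; apply: (lt_le_trans r0).
have e0 : elt T K c by apply: hr; rewrite subrr enorm0 ltW.
have e1 : elt T K (c + (r, 0)).
  by apply: hr; rewrite addrAC subrr add0r enorm_le ?(ltW r0)//= expr0n addr0.
apply: le_trans _ (dist_le e1 e0); rewrite addrAC subrr add0r.
by rewrite /enorm/= expr0n addr0 sqrtr_sqr ler_norm.
Qed.

Lemma elt_segment K x y (t : R) : elt T K x -> elt T K y -> 0 <= t <= 1 ->
  elt T K (x.1 + t * (y.1 - x.1), x.2 + t * (y.2 - x.2)).
Proof.
move=> /(eltP hT) Kx /(eltP hT) Ky /andP[t0 t1]; apply/(eltP hT) => a.
have -> : lam (T K) a (x.1 + t * (y.1 - x.1), x.2 + t * (y.2 - x.2)) =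
    (1 - t) * lam (T K) a x + t * lam (T K) a y.
  rewrite (lamE _ a _ x) (lamE _ a y x) /=; ring.
by rewrite addr_ge0// mulr_ge0// subr_ge0.
Qed.

(** The disc contains a diameter orthogonal to the level lines of [cross w]. *)
Lemma element_width K w (A B : R) :
  (forall x, elt T K x -> A <= cross w x <= B) -> h * enorm w <= Cq * (B - A).
Proof.
move=> hw; have [r [c [r0 hr Kc]]] := hfat K.
have [->|w0] := eqVneq w 0.
  have e0 : elt T K c by apply: Kc; rewrite subrr enorm0 ltW.
  have /andP[l1 l2] := hw c e0.
  rewrite enorm0 mulr0 mulr_ge0 ?(ltW Cq0)// subr_ge0.
  exact: le_trans l1 l2.
have e0 := enorm_gt0 w0; have e2 := enorm_sqr w.
pose v (s : R) : R * R := c + (s * - w.2, s * w.1).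
have Kv s : `|s| * enorm w <= r -> elt T K (v s).
  move=> sr; apply: Kc; rewrite /v addrAC subrr add0r enorm_le ?(ltW r0)//=.
  have -> : (s * - w.2) ^+ 2 + (s * w.1) ^+ 2 = (`|s| * enorm w) ^+ 2.
    by rewrite [RHS]exprMn e2 real_normK ?num_real//; ring.
  by rewrite lerXn2r// nnegrE ?mulr_ge0// ltW.
have cv s : cross w (v s) = cross w c + s * enorm w ^+ 2.
  by rewrite e2 /cross /v /=; ring.
pose s := r / enorm w; have s0 : 0 < s by rewrite divr_gt0.
have se : s * enorm w = r by rewrite divfK// gt_eqF.
have /hw : elt T K (v s) by apply: Kv; rewrite gtr0_norm// se.
have /hw : elt T K (v (- s)) by apply: Kv; rewrite normrN gtr0_norm// se.
rewrite !cv mulNr expr2 mulrA se => /andP[l1 _] /andP[_ l2].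
apply: le_trans (_ : Cq * (r * enorm w) <= _).
  by rewrite mulrA ler_wpM2r// ltW.
rewrite ler_pM2l//; have : 0 < r * enorm w by rewrite mulr_gt0.
lra.
Qed.

Lemma edge_vec_tdet K a : h * enorm (edge_vec (T K) a) <= Cq * `|tdet (T K)|.
Proof.
set w := edge_vec _ _; set q := cross w (T K (a + 1)).
have H x : elt T K x -> 0 <= lam (T K) a x <= 1.
  by move=> Kx; rewrite (lam_le1 hT)// andbT; exact: (iffLR (eltP hT _ _)).
have [d0|d0] := lerP 0 (tdet (T K)).
  rewrite ger0_norm//.
  have := @element_width K w q (q + tdet (T K)); rewrite [q + _]addrC addrK; apply.
  rewrite [_ + q]addrC => x /H /andP[l0 l1]; rewrite lam_cross//.
  by rewrite lerDl mulr_ge0//= lerD2l ler_piMl.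
rewrite ltr0_norm//.
have := @element_width K w (q + tdet (T K)) q; rewrite (_ : q - (q + tdet (T K)) = - tdet (T K)); last by ring.
apply; move=> x /H /andP[l0 l1]; rewrite lam_cross//.
by rewrite lerD2l gerDl mulr_ge0_le0 ?(ltW d0)// andbT ler_niMl ?(ltW d0).
Qed.

Lemma edge_vec_neq0 K a : edge_vec (T K) a != 0.
Proof.
rewrite subr_eq0; apply/eqP => /(vertex_inj (T0 K)) /eqP.
by have [_ _ n12] := neqI3 a; rewrite eq_sym (negbTE n12).
Qed.

Lemma tdet_edge K a : `|tdet (T K)| <= enorm (edge_vec (T K) a) * enorm (edge_vec (T K) (a + 2%:R)).
Proof.
have [E1 E2 E3 E4] := addI3 a.
have E : tdet (T K) = cross (edge_vec (T K) a) (- edge_vec (T K) (a + 2%:R)).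
  by rewrite (tdetE _ (a + 1)) E1 E2 /edge_vec E3 E4 opprB.
have N x : enorm (- x) = enorm x :> R by rewrite /enorm /= !sqrrN.
rewrite ler_norml; apply/andP; split; last by rewrite E -(N (edge_vec _ (a + 2%:R))) cross_le.
rewrite lerNl E -(N (edge_vec _ a)); set x := edge_vec _ _; set y := edge_vec _ _.
have -> : - cross x (- y) = cross (- x) (- y) by rewrite /cross /=; ring.
by rewrite -(N y) cross_le.
Qed.

(** An edge is at least as long as the height over an adjacent edge, and this
    height is at least the width of the disc. *)
Lemma edge_vec_ge K a : h <= Cq * enorm (edge_vec (T K) a).
Proof.
have e0 := enorm_gt0 (edge_vec_neq0 K (a + 2%:R)).
rewrite -(ler_pM2r e0); apply: le_trans (edge_vec_tdet _ _) _.
by rewrite -mulrA ler_pM2l// tdet_edge.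
Qed.

Lemma lam_gradient K a : h ^+ 2 * (lam1 (T K) a ^+ 2 + lam2 (T K) a ^+ 2) <= Cq ^+ 2.
Proof.
have d0 : 0 < `|tdet (T K)| by rewrite normr_gt0.
have -> : lam1 (T K) a ^+ 2 + lam2 (T K) a ^+ 2 =
    (enorm (edge_vec (T K) a) / `|tdet (T K)|) ^+ 2.
  rewrite /lam1 /lam2 !expr_div_n sqrrN enorm_sqr real_normK ?num_real//.
  by rewrite -mulrDl addrC.
rewrite -exprMn lerXn2r ?nnegrE ?(ltW Cq0)//.
  by rewrite mulr_ge0 ?(ltW (meshsize_gt0 K))// divr_ge0// sqrtr_ge0.
by rewrite mulrA ler_pdivrMr// edge_vec_tdet.
Qed.

Lemma side_vec_gt0 i : 0 < enorm (side_vec V i).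
Proof. by rewrite sqrtr_gt0; exact: (len2_gt0 hOm). Qed.

Lemma onside_height i f : onside V T i f ->
  h * enorm (side_vec V i) <= Cq * ell V i (apex T f) /\
  ell V i (apex T f) <= h * enorm (side_vec V i).
Proof.
move=> fi; have l0 := onside_apex hOm hT fi.
have E x : cross (side_vec V i) x = cross (side_vec V i) (V i) + ell V i x.
  by rewrite /ell /cross /=; ring.
split.
  have := @element_width f.1 (side_vec V i) (cross (side_vec V i) (V i))
    (cross (side_vec V i) (V i) + ell V i (apex T f)).
  rewrite [_ + ell _ _ _]addrC addrK; apply; rewrite [ell _ _ _ + _]addrC => x Kx.
  rewrite (E x) lerD2l lerDl.
  rewrite (onside_ell hT x fi) mulr_ge0 ?(ltW l0)//=; last exact: (iffLR (eltP hT _ _)).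
  by rewrite ler_piMl ?(ltW l0)// (lam_le1 hT).
have [ls _] := onside_src fi; rewrite -[leLHS]subr0 -ls.
have -> : ell V i (apex T f) - ell V i (src T f) =
  cross (side_vec V i) (apex T f - src T f) by rewrite /ell /cross /=; ring.
apply: le_trans (cross_le _ _) _; rewrite mulrC ler_wpM2r ?sqrtr_ge0//.
exact: (dist_le (vertex_elt hT _ _) (src_elt hT f)).
Qed.

Lemma onside_length i f : onside V T i f ->
  h <= Cq * (enorm (side_vec V i) * (tp V T i f - tm V T i f)) /\
  enorm (side_vec V i) * (tp V T i f - tm V T i f) <= h.
Proof.
move=> fi; have lt := tm_lt_tp hOm hT fi.
have E : enorm (side_vec V i) * (tp V T i f - tm V T i f) = enorm (tgt T f - src T f).
  rewrite -(src_param hOm fi) -(tgt_param hOm fi) /enorm /=.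
  rewrite -[X in _ * X]gtr0_norm ?subr_gt0// -sqrtr_sqr -sqrtrM ?addr_ge0 ?sqr_ge0//.
  congr Num.sqrt; rewrite /side_param /=.
  rewrite /GRing.scale /= /GRing.scale /=; ring.
rewrite E; split; last exact: (dist_le (tgt_elt hT f) (src_elt hT f)).
apply: le_trans (edge_vec_ge f.1 f.2) _; rewrite ler_pM2l// /edge_vec /src /tgt /ea /eb.
case: ifP => _ //; rewrite le_eqVlt; apply/orP; left; apply/eqP.
by rewrite /enorm; congr Num.sqrt => /=; ring.
Qed.

(** The open elements are disjoint and contained in a square of side [2 h]. *)
Lemma area_star (s : pred 'I_n) x :
  (forall K y, s K -> open_elt T K y -> `|y.1 - x.1| <= h /\ `|y.2 - x.2| <= h) -> 0 <= h ->
  \sum_(K | s K) \int[area]_(y in open_elt T K) 1 <= 4 * h ^+ 2.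
Proof.
move=> hs h0.
pose box : set (R * R) := `[x.1 - h, x.1 + h] `*` `[x.2 - h, x.2 + h].
have mB : measurable (box : set P2) by apply: measurableX; exact: measurable_itv.
have aB : (area (box : set P2) = (4 * h ^+ 2)%:E)%E.
  rewrite /area /box product_measure1E; try exact: measurable_itv.
  rewrite /= !lebesgue_measure_itv/= !lte_fin.
  have [h1|h1] := ltP 0 h; last first.
    have -> : h = 0 by apply/eqP; rewrite eq_le h0 h1.
    by rewrite !addr0 !subr0 !ltxx/= mule0 expr0n mulr0.
  have lx (z : R) : z - h < z + h by lra.
  by rewrite !lx/= -EFinB -EFinM; congr EFin; ring.
have -> : 4 * h ^+ 2 = \int[area]_(y in box) 1.
  rewrite Rintegral_cst// mul1r; exact: (esym (congr1 fine aB)).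
rewrite [leRHS]Rintegral_mkcond.
pose one : R * R -> R := fun=> 1.
have H K : area.-integrable setT (EFin \o (one \_ (open_elt T K) : P2 -> R)).
  rewrite -restrict_EFin; apply: (iffLR (integrable_mkcond _ _)).
    exact: measurable_open_elt.
  by apply: (open_elt_integrable hT K); exact: ct_cst.
have [E iE] := @Rintegral_sum _ _ _ area setT _ (index_enum 'I_n) s
    (fun K => one \_ (open_elt T K)) measurableT H.
have -> : \sum_(K | s K) \int[area]_(y in open_elt T K) 1 =
    \sum_(K | s K) \int[area]_y ((one \_ (open_elt T K)) y).
  by apply: eq_bigr => K _; rewrite [LHS]Rintegral_mkcond.
rewrite -[leLHS]E; apply: le_Rintegral => //.
  rewrite -restrict_EFin; apply: (iffLR (integrable_mkcond _ mB)).
  apply: integrable_area => //; last exact: ct_cst.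
  exists (`|x.1| + `|x.2| + h) => y [/= + +]; rewrite !in_itv/= => /andP[? ?] /andP[? ?].
  have := ler_norm x.1; have := ler_norm (- x.1); rewrite normrN.
  have := ler_norm x.2; have := ler_norm (- x.2); rewrite normrN => ? ? ? ?.
  have ? := normr_ge0 x.1; have ? := normr_ge0 x.2.
  by split; rewrite /= in_itv/=; apply/andP; split; lra.
move=> y _; have [/existsP[K /andP[sK /asboolP Ky]]|no] :=
    boolP [exists K, s K && `[< open_elt T K y >]].
  rewrite (bigD1 K)//= patchE mem_set// big1 ?addr0 => [|L /andP[_ LK]].
    rewrite patchE mem_set//; have [] := hs K y sK Ky.
    rewrite !ler_norml => /andP[? ?] /andP[? ?].
    by split; rewrite /= in_itv/=; apply/andP; split; lra.
  rewrite patchE; case: ifPn => //; rewrite inE => Ly.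
  by have e := open_elt_disjoint hT Ly (open_elt_sub hT Ky); rewrite e eqxx in LK.
rewrite big1 => [|K sK]; first by rewrite patchE; case: ifPn.
rewrite patchE; case: ifPn => //; rewrite inE => Ky; exfalso; move/negP: no; apply.
by apply/existsP; exists K; rewrite sK; exact/asboolP.
Qed.

End ElementEstimates.

(** * Uniform inverse estimates *)

Section Affine.
Context {R : realType}.
Implicit Types (x : R * R) (a b c : R).

Definition affine_coef a b c (i j : nat) : R :=
  match i, j with 0%N, 0%N => c | 1%N, 0%N => a | 0%N, 1%N => b | _, _ => 0 end.

Lemma affine_pol k a b c x : (1 <= k)%N ->
  \sum_(i < k.+1) \sum_(j < k.+1 | (i + j <= k)%N) affine_coef a b c i j * x.1 ^+ i * x.2 ^+ j =
  c + a * x.1 + b * x.2.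
Proof.
case: k => // k _.
pose G (i j : nat) := affine_coef a b c i j * x.1 ^+ i * x.2 ^+ j.
have S2 (F : nat -> R) : (forall j, F j.+2 = 0) -> \sum_(j < k.+2) F j = F 0%N + F 1%N.
  by move=> F0; rewrite big_ord_recl big_ord_recl big1 ?addr0// => j _; exact: F0.
have S3 i : \sum_(j < k.+2 | (i + j <= k.+1)%N) G i j =
    (if (i <= k.+1)%N then G i 0%N else 0) + (if (i <= k)%N then G i 1%N else 0).
  rewrite big_mkcond (S2 (fun j => if (i + j <= k.+1)%N then G i j else 0)) ?addn0 ?addn1//.
  by move=> j; rewrite /G /affine_coef; case: i => [|[|i]]; rewrite !mul0r; case: ifP.
rewrite (S2 (fun i => \sum_(j < k.+2 | (i + j <= k.+1)%N) G i j)) => [|j].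
  by rewrite !S3 /G /=; case: (k) => [|?] /=; rewrite !expr0 !expr1 ?mul0r !mulr1 !addr0 addrAC.
by rewrite S3 /G /= !mul0r !if_same addr0.
Qed.

Lemma affine_p2 k a b c : (1 <= k)%N -> p2 k (fun x => c + a * x.1 + b * x.2).
Proof.
move=> k1; exists (affine_coef a b c); apply/funext => x; rewrite -(affine_pol a b c x k1) /pol.
apply: eq_bigr => i _; rewrite big_mkcond; apply: eq_bigr => j _; case: ifPn => //.
by case: k k1 i j => // k _ [[|[|i]] ilt] [[|[|j]] jlt] //=; rewrite ?mul0r.
Qed.

Lemma affine_poly_on k (A : set (R * R)) a b c : (1 <= k)%N ->
  poly_on k A (fun x => c + a * x.1 + b * x.2).
Proof. by move=> k1; exists (affine_coef a b c) => x _; rewrite affine_pol. Qed.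

Lemma poly_on_comb k (A : set (R * R)) (f g : R * R -> R) r :
  poly_on k A f -> poly_on k A g -> poly_on k A (fun x => f x + r * g x).
Proof.
move=> [c hc] [d hd]; exists (fun i j => c i j + r * d i j) => x Ax.
rewrite hc// hd// mulr_sumr -big_split; apply: eq_bigr => i _ /=.
rewrite mulr_sumr -big_split; apply: eq_bigr => j _ /=; ring.
Qed.

End Affine.

Section InverseMesh.
Context {R : realType}.

(** The disc in an element contains a square of size comparable with [h], and
    the element lies within a comparable distance of this square, so the
    constant of [inverse_2d] serves for all elements. *)
Lemma inverse_mesh k (Cq : R) : 0 < Cq -> exists2 CI : R, 0 < CI &
  forall (Om : set (R * R)) n (T : 'I_n -> 'I_3 -> R * R),
    triangulation Om T -> fat T Cq ->
    forall K q y, p2 k q -> elt T K y ->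
      meshsize T ^+ 2 * q y ^+ 2 <= CI * \int[area]_(x in open_elt T K) (q x ^+ 2).
Proof.
move=> C0; have M0 : 0 <= Cq + 1 by rewrite addr_ge0 ?ltW.
have [C C_gt0 hC] := inverse_2d k M0.
exists (Cq ^+ 2 * C); first by rewrite mulr_gt0 ?exprn_gt0.
move=> Om n T hT hfat K q y pq Ky; have [r [c [r0 hr Kc]]] := hfat K.
have h0 := meshsize_gt0 hfat K.
have Kc0 : elt T K c by apply: Kc; rewrite subrr enorm0 ltW.
have [y1 y2] := enorm_coord (dist_le Ky Kc0).
have near z1 z2 : `|z1 - z2| <= meshsize T -> `|z1 - (z2 - r / 2)| <= (Cq + 1) * r.
  move=> z; have -> : z1 - (z2 - r / 2) = (z1 - z2) + r / 2 by ring.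
  apply: le_trans (ler_normD _ _) _; rewrite mulrDl mul1r; apply: lerD.
    exact: le_trans z hr.
  by rewrite gtr0_norm ?divr_gt0// ler_pdivrMr// ler_pMr// ler1n.
have sq u v : c.1 - r / 2 <= u <= c.1 - r / 2 + r -> c.2 - r / 2 <= v <= c.2 - r / 2 + r ->
    elt T K (u, v).
  move=> /andP[u1 u2] /andP[v1 v2]; apply: Kc; rewrite enorm_le ?(ltW r0)//=.
  have hu : (u - c.1) ^+ 2 <= (r / 2) ^+ 2.
    by rewrite -(real_normK (num_real (u - c.1))) lerXn2r// ?nnegrE ?divr_ge0 ?(ltW r0)//
      ler_norml; apply/andP; split; lra.
  have hv : (v - c.2) ^+ 2 <= (r / 2) ^+ 2.
    by rewrite -(real_normK (num_real (v - c.2))) lerXn2r// ?nnegrE ?divr_ge0 ?(ltW r0)//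
      ler_norml; apply/andP; split; lra.
  by apply: le_trans (lerD hu hv) _; have := sqr_ge0 r; rewrite expr_div_n; lra.
have := hC q pq (elt T K) (c.1 - r / 2) (c.2 - r / 2) r y (measurable_elt hT K)
  (elt_inbox T K) r0 sq (near _ _ y1) (near _ _ y2).
rewrite (elt_integral hT) => H; rewrite -mulrA.
apply: le_trans (ler_wpM2l (sqr_ge0 Cq) H).
rewrite [leRHS]mulrA -[X in _ <= X * _]exprMn ler_wpM2r ?sqr_ge0// lerXn2r ?nnegrE ?(ltW h0)//.
by rewrite mulr_ge0 ?(ltW C0) ?(ltW r0).
Qed.

End InverseMesh.

Lemma p2_line_eq {R : realType} k (q : R * R -> R) (x y : R * R) : p2 k q ->
  dv (fun t => q (x.1 + t * (y.1 - x.1), x.2 + t * (y.2 - x.2)))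
     (fun t => (y.1 - x.1) * partial 0 q (x.1 + t * (y.1 - x.1), x.2 + t * (y.2 - x.2)) +
               (y.2 - x.2) * partial 1 q (x.1 + t * (y.1 - x.1), x.2 + t * (y.2 - x.2))).
Proof. by move=> pq; have := p2_line x (y.1 - x.1, y.2 - x.2) pq. Qed.

Section Oscillation.
Context {R : realType} {Om : set (R * R)}.
Context {n : nat} (T : 'I_n -> 'I_3 -> R * R) (hT : triangulation Om T).
Implicit Types (K : 'I_n) (f : 'I_n * 'I_3) (x y : R * R) (k : nat).
Variables (k : nat) (Cq CI : R).
Hypotheses (k1 : (1 <= k)%N) (CI0 : 0 < CI) (hfat : fat T Cq).
Hypothesis inverse : forall K q y, p2 k q -> elt T K y ->
  meshsize T ^+ 2 * q y ^+ 2 <= CI * \int[area]_(x in open_elt T K) (q x ^+ 2).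
Local Notation h := (meshsize T).

(** The mean value theorem along the segment between the points; the inverse
    inequality bounds the gradient. *)
Lemma oscillation K q x y : p2 k q -> elt T K x -> elt T K y ->
  (q x - q y) ^+ 2 <= CI * (\int[area]_(z in open_elt T K) (partial 0 q z ^+ 2) +
                            \int[area]_(z in open_elt T K) (partial 1 q z ^+ 2)).
Proof.
move=> pq Kx Ky; pose g t := (y.1 + t * (x.1 - y.1), y.2 + t * (x.2 - y.2)).
have H := p2_line_eq y x pq.
have [c c01 E] := MVT (ltr01) (fun t _ => H t) (continuous_subspaceT (dv_continuous H)).
have g1 : g 1 = x by rewrite /g !mul1r !subrKC; case: (x).
have g0 : g 0 = y by rewrite /g !mul0r !addr0; case: (y).
move: E; rewrite -/(g 1) -/(g 0) -/(g c) g1 g0 subr0 mulr1 => ->.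
have Kc : elt T K (g c).
  by apply: (elt_segment hT Ky Kx); move: c01; rewrite in_itv/= => /andP[c0 c1]; rewrite !ltW.
have a0 := inverse (p2_partial 0 pq) Kc; have a1 := inverse (p2_partial 1 pq) Kc.
rewrite mulrDr; apply: le_trans (lerD a0 a1).
have : (x.1 - y.1) ^+ 2 + (x.2 - y.2) ^+ 2 <= h ^+ 2.
  by rewrite -[leLHS](@enorm_sqr R (x - y)) lerXn2r ?nnegrE ?sqrtr_ge0 ?(dist_le Kx Ky)//
    (ltW (meshsize_gt0 hfat K)).
rewrite -mulrDr; move: (partial 0 q (g c)) (partial 1 q (g c)) => p1 p2 hd.
apply: le_trans (ler_wpM2r (addr_ge0 (sqr_ge0 p1) (sqr_ge0 p2)) hd).
rewrite -subr_ge0; set e := (X in 0 <= X).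
have -> : e = ((x.1 - y.1) * p2 - (x.2 - y.2) * p1) ^+ 2 by rewrite /e; ring.
exact: sqr_ge0.
Qed.

Lemma unit_area K : h ^+ 2 <= CI * \int[area]_(z in open_elt T K) 1.
Proof.
have p1 : p2 k (fun=> 1 : R).
  rewrite (_ : (fun=> 1) = (fun x : R * R => 1 + 0 * x.1 + 0 * x.2)); first exact: affine_p2.
  by apply/funext => x; rewrite !mul0r !addr0.
have := inverse p1 (vertex_elt hT K 0); by rewrite expr1n mulr1.
Qed.

(** Boundedly many elements meet at a vertex, since their areas add up. *)
Lemma vertex_count x : \sum_f (T f.1 f.2 == x)%:R <= 12 * CI.
Proof.
pose s K := [exists a, T K a == x].
have S1 : \sum_f (T f.1 f.2 == x)%:R <= 3 * \sum_(K | s K) (1 : R).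
  rewrite -(pair_bigA _ (fun K a => (T K a == x)%:R)) /= mulr_sumr [leRHS]big_mkcond /=.
  apply: ler_sum => K _; case: ifP => [sK|/negbT].
    rewrite mulr1; apply: le_trans (_ : \sum_(a : 'I_3) 1 <= _).
      by apply: ler_sum => a _; case: (_ == _); rewrite ?lexx ?ler01.
    by rewrite sumr_const card_ord.
  rewrite negb_exists => /forallP ns; rewrite big1// => a _.
  by rewrite (negbTE (ns a)).
apply: le_trans S1 _.
have [K0 _|no] := pickP 'I_n; last first.
  rewrite big1 ?mulr0 => [|K]; first by rewrite mulr_ge0// ltW.
  by have := no K.
have h0 := meshsize_gt0 hfat K0.
have : \sum_(K | s K) \int[area]_(y in open_elt T K) 1 <= 4 * h ^+ 2.
  apply: (area_star (T := T) hT (x := x)); last exact: ltW.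
  move=> K y /existsP[a /eqP <-] /(open_elt_sub hT) Ky.
  exact: (enorm_coord (dist_le Ky (vertex_elt hT K a))).
rewrite -(ler_pM2l CI0) mulr_sumr => H.
have : h ^+ 2 * \sum_(K | s K) 1 <= h ^+ 2 * (4 * CI).
  rewrite mulr_sumr; apply: (@le_trans _ _ (CI * (4 * h ^+ 2))); last first.
    by rewrite le_eqVlt; apply/orP; left; apply/eqP; ring.
  apply: le_trans H; apply: ler_sum => K _; rewrite mulr1; exact: unit_area.
rewrite ler_pM2l ?exprn_gt0// => H4; lra.
Qed.

Lemma area_elt_le K : \int[area]_(y in open_elt T K) 1 <= 4 * h ^+ 2.
Proof.
have := @area_star R Om n T hT (pred1 K) (T K 0).
rewrite big_pred1_eq; apply; last exact: ltW (meshsize_gt0 hfat K).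
move=> L y /eqP -> /(open_elt_sub hT) Ky.
exact: (enorm_coord (dist_le Ky (vertex_elt hT K 0))).
Qed.

End Oscillation.

(** * A Korn inequality with boundary terms *)

Section KornAlgebra.
Context {R : realType}.
Implicit Types (a b c d p q s t x y : R).

Lemma young2 t x y : 0 < t -> 2 * (x * y) <= t * x ^+ 2 + t^-1 * y ^+ 2.
Proof.
move=> t0; rewrite -subr_ge0.
have -> : t * x ^+ 2 + t^-1 * y ^+ 2 - 2 * (x * y) = t^-1 * (t * x - y) ^+ 2.
  by field; rewrite gt_eqF.
by rewrite mulr_ge0 ?sqr_ge0// invr_ge0 ltW.
Qed.

Lemma cauchy2 p q x y : (p * x + q * y) ^+ 2 <= (p ^+ 2 + q ^+ 2) * (x ^+ 2 + y ^+ 2).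
Proof.
rewrite -subr_ge0; set e := (X in 0 <= X).
have -> : e = (p * y - q * x) ^+ 2 by rewrite /e; ring.
exact: sqr_ge0.
Qed.

(** The tangential derivative of the tangential component only involves the
    strain. *)
Lemma tangential_strain p q a b c d : (p * (p * a + q * b) + q * (p * c + q * d)) ^+ 2 <=
  (p ^+ 2 + q ^+ 2) ^+ 2 * (a ^+ 2 + d ^+ 2 + (b + c) ^+ 2 / 2).
Proof.
rewrite -subr_ge0; set e := (X in 0 <= X); pose s := (b + c) / 2.
have -> : e = 2 * (p ^+ 2 * s - p * q * a) ^+ 2 + (p ^+ 2 * d - q ^+ 2 * a) ^+ 2 +
    2 * (p * q * d - q ^+ 2 * s) ^+ 2.
  by rewrite /e /s; field.
have := sqr_ge0 (p ^+ 2 * s - p * q * a); have := sqr_ge0 (p ^+ 2 * d - q ^+ 2 * a).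
have := sqr_ge0 (p * q * d - q ^+ 2 * s); lra.
Qed.

(** A vector is recovered from its components along two independent
    directions. *)
Lemma corner_bound p q p' q' x y : (p * q' - q * p') ^+ 2 * (x ^+ 2 + y ^+ 2) <=
  2 * ((p' ^+ 2 + q' ^+ 2) * (p * x + q * y) ^+ 2 + (p ^+ 2 + q ^+ 2) * (p' * x + q' * y) ^+ 2).
Proof.
rewrite -subr_ge0; set e := (X in 0 <= X).
have -> : e = (p' * (p * x + q * y) + p * (p' * x + q' * y)) ^+ 2 +
              (q' * (p * x + q * y) + q * (p' * x + q' * y)) ^+ 2.
  by rewrite /e; ring.
by rewrite addr_ge0 ?sqr_ge0.
Qed.

Lemma korn_pointwise a b c d : a ^+ 2 + b ^+ 2 + c ^+ 2 + d ^+ 2 <=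
  2 * (a ^+ 2 + d ^+ 2 + (b + c) ^+ 2 / 2) + 2 * (a * d - b * c).
Proof.
rewrite -subr_ge0; set e := (X in 0 <= X).
have -> : e = (a + d) ^+ 2 by rewrite /e; field.
exact: sqr_ge0.
Qed.

Lemma corner_combine M c w X X' a b z z' : 0 < M -> 0 < c -> 0 <= X -> 0 <= a -> 0 <= b ->
  X <= M -> X' <= M -> a <= M * z -> b <= M * z' -> c^-1 <= M ->
  c * w <= 2 * (X' * a + X * b) -> w <= 2 * M ^+ 3 * (z + z').
Proof.
move=> M0 c0 X0 a0 b0 XM XM' az bz cM; rewrite -ler_pdivlMl// => H; apply: le_trans H _.
have h1 : X' * a <= M * (M * z).
  by apply: le_trans (ler_wpM2r a0 XM') _; rewrite ler_pM2l.
have h2 : X * b <= M * (M * z') by apply: ler_pM.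
have mz : 0 <= M * z := le_trans a0 az.
have mz' : 0 <= M * z' := le_trans b0 bz.
have nn : 0 <= M * (M * z) + M * (M * z') by rewrite addr_ge0// mulr_ge0// ltW.
have -> : 2 * M ^+ 3 * (z + z') = M * (2 * (M * (M * z) + M * (M * z'))) by ring.
apply: le_trans (_ : c^-1 * (2 * (M * (M * z) + M * (M * z'))) <= _).
  by rewrite ler_pM2l ?invr_gt0// ler_pM2l//; apply: lerD.
by rewrite ler_wpM2r// mulr_ge0.
Qed.

Lemma side_trace_bound t s X a a' B E : 1 <= t -> -1 <= s <= 1 -> 0 <= X -> 0 <= B ->
  a ^+ 2 <= X * B -> a' ^+ 2 <= X ^+ 2 * E ->
  a ^+ 2 + 2 * (s * (a * a')) <= 2 * X * (t * B) + X ^+ 2 * (t^-1 * E).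
Proof.
move=> t1 /andP[s1 s2] X0 B0 aB aE; have t0 : 0 < t := lt_le_trans ltr01 t1.
have h1 : 2 * (s * (a * a')) <= t * a ^+ 2 + t^-1 * a' ^+ 2.
  have -> : s * (a * a') = a * (s * a') by ring.
  apply: le_trans (young2 a (s * a') t0) _.
  rewrite lerD2l ler_wpM2l ?invr_ge0 ?(ltW t0)// exprMn ler_piMl ?sqr_ge0//.
  by rewrite -[s ^+ 2]real_normK ?num_real// exprn_ile1// ler_norml s1 s2.
have h2 : t^-1 * a' ^+ 2 <= X ^+ 2 * (t^-1 * E).
  by rewrite [leRHS]mulrCA ler_wpM2l// invr_ge0 ltW.
have h3 : t * a ^+ 2 <= X * (t * B) by rewrite [leRHS]mulrCA ler_wpM2l// ltW.
have h4 : a ^+ 2 <= X * (t * B).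
  by apply: le_trans aB _; rewrite ler_wpM2l// ler_peMl.
by rewrite -mulrA; lra.
Qed.

Lemma cyclic_sum_bound (I : finType) (r : I -> I) (F Z : I -> R) M : injective r ->
  (forall i, F (r i) <= 2 * M ^+ 3 * (Z i + Z (r i))) ->
  \sum_i (F i + F (r i) + M * Z i) <= (8 * M ^+ 3 + M) * \sum_i Z i.
Proof.
move=> r_inj le; have sumF : \sum_i F i = \sum_i F (r i) by rewrite (reindex_inj r_inj).
have sumZ : \sum_i Z i = \sum_i Z (r i) by rewrite (reindex_inj r_inj).
have : \sum_i F (r i) <= 4 * M ^+ 3 * \sum_i Z i.
  apply: (@le_trans _ _ (\sum_i 2 * M ^+ 3 * (Z i + Z (r i)))); first exact: ler_sum.
  by rewrite -mulr_sumr big_split/= -sumZ le_eqVlt; apply/orP; left; apply/eqP; ring.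
by rewrite !big_split/= sumF -mulr_sumr => ?; lra.
Qed.

End KornAlgebra.

Section Korn.
Context {R : realType} {m : nat} (V : 'I_m -> R * R) (Om : set (R * R)).
Context (hOm : convex_polygonal_domain V Om).
Local Notation leb := (@lebesgue_measure R).

Lemma side_param1 i : side_param V i 1 = V (ordS i).
Proof. by rewrite /side_param scale1r /side_vec subrKC. Qed.

Lemma side_param0 i : side_param V i 0 = V i.
Proof. by rewrite /side_param scale0r addr0. Qed.

Section OneSide.
Context {n : nat} (T : 'I_n -> 'I_3 -> R * R) (hT : triangulation Om T).
Context (k : nat) (u : R * R -> 'cV[R]_2) (P : 'I_2 -> 'I_n -> R * R -> R).
Context (hP : pwfield T k u P) (i : 'I_m) (tau : R) (tau1 : 1 <= tau).
Local Notation p := (side_vec V i).1.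
Local Notation q := (side_vec V i).2.
Local Notation X := (len2 V i).
Implicit Types (f : 'I_n * 'I_3) (t : R) (j : 'I_2).

Definition kornY f x := tau * qB P f x + tau^-1 * qE P f.1 x.
Definition sideY : R := \sum_(f | onside V T i f)
  \int[leb]_(t in `[tm V T i f, tp V T i f]) kornY f (side_param V i t).

Let U j f t := P j f.1 (side_param V i t).
Let U' j f t := p * partial 0 (P j f.1) (side_param V i t) +
                q * partial 1 (P j f.1) (side_param V i t).

Let dU j f : dv (U j f) (U' j f).
Proof.
have [pP _] := hP j f.1; apply: (dv_eq _ _ (p2_line (V i) (side_vec V i) pP)) => t.
  by rewrite /U side_paramE.
by rewrite /U' side_paramE.
Qed.

Let cU j f : continuous (U j f). Proof. exact: dv_continuous (dU j f). Qed.
Let cU' j f : continuous (U' j f).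
Proof.
have c l := ct_comp (field_partial_continuous hP (j := j) (j' := l) (K := f.1)) (@side_param_continuous _ _ V i).
exact: (ct_add (ct_mul (@ct_cst _ _ p) (c 0)) (ct_mul (@ct_cst _ _ q) (c 1))).
Qed.

Arguments cU : clear implicits.
Arguments cU' : clear implicits.

(** Components of the field along the side and across it, scaled by the length
    of the side. *)
Let A f t := p * U 0 f t + q * U 1 f t.
Let A' f t := p * U' 0 f t + q * U' 1 f t.
Let B f t := p * U 1 f t - q * U 0 f t.
Let B' f t := p * U' 1 f t - q * U' 0 f t.

Let dA f : dv (A f) (A' f).
Proof.
apply: (dv_eq _ _ (dv_add (dv_mul (dv_cst p) (dU 0 f)) (dv_mul (dv_cst q) (dU 1 f)))) => t //.
by rewrite !mul0r !add0r.
Qed.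

Let dB f : dv (B f) (B' f).
Proof.
apply: (dv_eq _ _ (dv_add (dv_mul (dv_cst p) (dU 1 f)) (dv_mul (dv_cst (- q)) (dU 0 f)))) => t.
  by rewrite mulNr.
by rewrite !mul0r !add0r mulNr.
Qed.

Let cA f : continuous (A f). Proof. exact: dv_continuous (dA f). Qed.
Let cB f : continuous (B f). Proof. exact: dv_continuous (dB f). Qed.
Let cA' f : continuous (A' f).
Proof. exact: (ct_add (ct_mul (@ct_cst _ _ p) (cU' 0 f)) (ct_mul (@ct_cst _ _ q) (cU' 1 f))). Qed.
Let cB' f : continuous (B' f).
Proof. exact: (ct_add (ct_mul (@ct_cst _ _ p) (cU' 1 f)) (ct_opp (ct_mul (@ct_cst _ _ q) (cU' 0 f)))). Qed.

Arguments cA : clear implicits.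
Arguments cB : clear implicits.
Arguments cA' : clear implicits.
Arguments cB' : clear implicits.

Lemma kornY_continuous f : continuous (kornY f).
Proof.
rewrite /kornY /qB /qE.
move: (ga_continuous f.1 hP) => [+ + + + H]; move: (H 0) (H 1).
move: (ga P f.1) (gb P f.1) (gc P f.1) (gd P f.1) (P 0 f.1) (P 1 f.1) => a b c d u0 u1.
by move=> ? ? ? ? ? ?; continuity.
Qed.

Let cY f : continuous (fun t => kornY f (side_param V i t)).
Proof. exact: (ct_comp (kornY_continuous (f := f)) (@side_param_continuous _ _ V i)). Qed.

Let a t := p * u (side_param V i t) 0 0 + q * u (side_param V i t) 1 0.
Let b t := p * u (side_param V i t) 1 0 - q * u (side_param V i t) 0 0.

Arguments cY : clear implicits.

Let edge_a f t : onside V T i f -> tm V T i f <= t <= tp V T i f -> a t = A f t /\ b t = B f t.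
Proof.
move=> fi ft; have Kt := edge_elt hOm hT fi ft.
by rewrite /a /b (field_val hP 0 Kt) (field_val hP 1 Kt).
Qed.

Let bound_A f t : A f t ^+ 2 <= X * qB P f (side_param V i t) /\
  B f t ^+ 2 <= X * qB P f (side_param V i t) /\
  A' f t ^+ 2 <= X ^+ 2 * qE P f.1 (side_param V i t).
Proof.
split; first exact: cauchy2.
split; last exact: tangential_strain.
have := cauchy2 (- q) p (U 0 f t) (U 1 f t); rewrite sqrrN [_ + p ^+ 2]addrC.
by rewrite mulNr [_ + p * _]addrC.
Qed.

Let X0 : 0 <= X. Proof. exact: ltW (len2_gt0 hOm i). Qed.

Let qB0 f x : 0 <= qB P f x. Proof. by rewrite addr_ge0 ?sqr_ge0. Qed.
Let qE0 K x : 0 <= qE P K x.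
Proof. by rewrite !addr_ge0 ?divr_ge0 ?sqr_ge0. Qed.

Let tau0 : 0 < tau := lt_le_trans ltr01 tau1.
Variable (M : R).
Hypotheses (M1 : 1 <= M) (MX : 2 * X <= M) (MX2 : X ^+ 2 <= M).

Let weight f x : 2 * X * (tau * qB P f x) + X ^+ 2 * (tau^-1 * qE P f.1 x) <= M * kornY f x.
Proof.
rewrite /kornY [leRHS]mulrDr; apply: lerD; apply: ler_wpM2r => //.
  by rewrite mulr_ge0 ?qB0 ?(ltW tau0).
by rewrite mulr_ge0 ?qE0 ?invr_ge0 ?(ltW tau0).
Qed.

Let sum_bound (F : 'I_n * 'I_3 -> R -> R) : (forall f, continuous (F f)) ->
  (forall f t, onside V T i f -> tm V T i f <= t <= tp V T i f ->
    F f t <= M * kornY f (side_param V i t)) ->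
  \sum_(f | onside V T i f) \int[leb]_(t in `[tm V T i f, tp V T i f]) F f t <= M * sideY.
Proof.
move=> cF le; rewrite /sideY mulr_sumr; apply: ler_sum => f fi.
rewrite Rintegral_scale//; apply: Rintegral_le_itv => //.
  exact: (ct_mul (@ct_cst _ _ M) (cY f)).
by move=> t ft; exact: le.
Qed.

Let unit_t f t : onside V T i f -> tm V T i f <= t <= tp V T i f -> 0 <= t <= 1.
Proof.
move=> fi /andP[t1 t2]; have [h1 h2] := tm_ge0 hOm hT fi.
by apply/andP; split; [exact: le_trans h1 t1|exact: le_trans t2 h2].
Qed.

(** Trace inequality in one variable, from the integrals over the side of the
    derivatives of [(1 - t) a ^+ 2] and [t a ^+ 2]. *)
Lemma side_end_bound : a 0 ^+ 2 <= M * sideY /\ a 1 ^+ 2 <= M * sideY.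
Proof.
split.
- have d1 f := dv_mul (dv_add (dv_cst (-1)) (@dv_id R)) (dv_exp 2 (dA f)).
  pose F f t := (0 + 1) * A f t ^+ 2 + (-1 + t) * (2%:R * A f t ^+ 1 * A' f t).
  have cF f : continuous (F f).
    rewrite /F; move: (cA f) (cA' f); move: (A f) (A' f) => x y ? ?.
    by continuity.
  have := @side_ftc _ _ _ _ hOm _ _ hT i (fun t => (-1 + t) * a t ^+ 2) _ _ d1 cF.
  rewrite addNr addr0 mul0r sub0r mulN1r opprK => <-.
    apply: sum_bound => // f t fi ft; apply: le_trans (weight _ _).
    have [h1 [_ h3]] := bound_A f t; have /andP[t0 t1] := unit_t fi ft.
    have s1 : -1 <= -1 + t <= 1 by apply/andP; split; lra.
    apply: le_trans (side_trace_bound tau1 s1 X0 (qB0 _ _) h1 h3).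
    by rewrite le_eqVlt; apply/orP; left; apply/eqP; ring.
  by move=> f t fi ft; have [-> _] := edge_a fi ft.
- have d1 f := dv_mul (@dv_id R) (dv_exp 2 (dA f)).
  pose F f t := 1 * A f t ^+ 2 + t * (2%:R * A f t ^+ 1 * A' f t).
  have cF f : continuous (F f).
    rewrite /F; move: (cA f) (cA' f); move: (A f) (A' f) => x y ? ?.
    by continuity.
  have := @side_ftc _ _ _ _ hOm _ _ hT i (fun t => t * a t ^+ 2) _ _ d1 cF.
  rewrite mul1r mul0r subr0 => <-.
    apply: sum_bound => // f t fi ft; apply: le_trans (weight _ _).
    have [h1 [_ h3]] := bound_A f t; have /andP[t0 t1] := unit_t fi ft.
    have s1 : -1 <= t <= 1 by apply/andP; split; lra.
    apply: le_trans (side_trace_bound tau1 s1 X0 (qB0 _ _) h1 h3).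
    by rewrite le_eqVlt; apply/orP; left; apply/eqP; ring.
  by move=> f t fi ft; have [-> _] := edge_a fi ft.
Qed.

Let S x := u x 0 0 ^+ 2 + u x 1 0 ^+ 2.

Let ab_bound t : `|a t * b t| <= X * S (side_param V i t).
Proof.
have h1 : a t ^+ 2 + b t ^+ 2 = X * S (side_param V i t) by rewrite /a /b /S /len2; ring.
rewrite -h1 ler_norml; move: (a t) (b t) => x y.
have := sqr_ge0 (x - y); have := sqr_ge0 (x + y); have := sqr_ge0 x; have := sqr_ge0 y.
by move=> ? ? ? ?; apply/andP; split; nra.
Qed.

(** Multiplied by the squared length of the side, the integrand is the
    derivative of [a b] minus twice [b] times the derivative of [a]. The
    latter is a strain, and the former leaves the values at the two corners. *)
Lemma side_rotation_bound :
  \sum_(f | onside V T i f) \int[leb]_(t in `[tm V T i f, tp V T i f])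
     (U 0 f t * U' 1 f t - U 1 f t * U' 0 f t) <=
  S (V i) + S (V (ordS i)) + M * sideY.
Proof.
have d1 f := dv_mul (dA f) (dB f).
have c1 f : continuous (fun t => A' f t * B f t + A f t * B' f t).
  exact: (ct_add (ct_mul (cA' f) (cB f)) (ct_mul (cA f) (cB' f))).
have F1 := @side_ftc _ _ _ _ hOm _ _ hT i (fun t => a t * b t) _ _ d1 c1.
have {}F1 := F1 (fun f t fi ft => congr2 *%R (edge_a fi ft).1 (edge_a fi ft).2).
have X_gt0 : 0 < X := len2_gt0 hOm i.
pose F f t := - 2 / X * (B f t * A' f t).
have cF f : continuous (F f).
  exact: (ct_mul (@ct_cst _ _ _) (ct_mul (cB f) (cA' f))).
have F2 : \sum_(f | onside V T i f) \int[leb]_(t in `[tm V T i f, tp V T i f]) F f t <= M * sideY.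
  apply: sum_bound => // f t fi ft.
  have [_ [h2 h3]] := bound_A f t; have t0 := tau0.
  have y := young2 (- B f t) (A' f t) t0; rewrite sqrrN mulNr in y.
  have e1 : tau * B f t ^+ 2 <= X * (tau * qB P f (side_param V i t)).
    by rewrite [leRHS]mulrCA ler_pM2l.
  have e2 : tau^-1 * A' f t ^+ 2 <= X * (X * (tau^-1 * qE P f.1 (side_param V i t))).
    by rewrite [leRHS]mulrA -expr2 [leRHS]mulrCA ler_pM2l ?invr_gt0.
  have F1' : F f t <= tau * qB P f (side_param V i t) + X * (tau^-1 * qE P f.1 (side_param V i t)).
    rewrite -(ler_pM2l X_gt0) mulrDr; apply: le_trans (lerD e1 e2); apply: le_trans y.
    by rewrite /F le_eqVlt; apply/orP; left; apply/eqP; field; rewrite gt_eqF.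
  apply: le_trans F1' _; rewrite /kornY [leRHS]mulrDr; apply: lerD.
    by rewrite ler_peMl// mulr_ge0 ?qB0 ?(ltW tau0).
  apply: ler_wpM2r; first by rewrite mulr_ge0 ?qE0 ?invr_ge0 ?(ltW tau0).
  by apply: le_trans MX; rewrite mulr_natl mulr2n lerDl.
have -> : \sum_(f | onside V T i f) \int[leb]_(t in `[tm V T i f, tp V T i f])
     (U 0 f t * U' 1 f t - U 1 f t * U' 0 f t) =
  X^-1 * (a 1 * b 1 - a 0 * b 0) +
  \sum_(f | onside V T i f) \int[leb]_(t in `[tm V T i f, tp V T i f]) F f t.
  rewrite -F1 mulr_sumr -big_split; apply: eq_bigr => f _ /=.
  rewrite -[X in _ = _ + X]mul1r [RHS](Rintegral_comb _ _ _ _ (c1 f) (cF f)).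
  apply: eq_Rintegral => t _; rewrite /F /A /A' /B /B'.
  move: X_gt0; rewrite /len2; move: (U 0 f t) (U 1 f t) (U' 0 f t) (U' 1 f t) p q.
  by move=> u0 u1 v0 v1 r s rs; field; rewrite gt_eqF.
apply: lerD F2; rewrite ler_pdivrMl//.
have := ab_bound 0; have := ab_bound 1; rewrite side_param1 side_param0 !ler_norml.
move: (a 1 * b 1) (a 0 * b 0) (S (V i)) (S (V (ordS i))) => z1 z0 s0 s1.
by move=> /andP[? ?] /andP[? ?]; rewrite mulrDr; lra.
Qed.

End OneSide.

Lemma side_constants : exists2 M : R, 0 < M & forall i,
  [/\ 1 <= M, 2 * len2 V i <= M, len2 V i ^+ 2 <= M,
  (cross (side_vec V i) (side_vec V (ordS i)) ^+ 2)^-1 <= M & (enorm (side_vec V i))^-1 <= M].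
Proof.
pose w j := 2 * len2 V j + len2 V j ^+ 2 +
  (cross (side_vec V j) (side_vec V (ordS j)) ^+ 2)^-1 + (enorm (side_vec V j))^-1.
have l0 j := ltW (len2_gt0 hOm j).
have c0 j : 0 <= (cross (side_vec V j) (side_vec V (ordS j)) ^+ 2)^-1 by rewrite invr_ge0 sqr_ge0.
have e0 j : 0 <= (enorm (side_vec V j))^-1 by rewrite invr_ge0 sqrtr_ge0.
have w0 j : 0 <= w j.
  by have := l0 j; have := c0 j; have := e0 j; have := sqr_ge0 (len2 V j); rewrite /w; lra.
exists (1 + \sum_i w i); first by rewrite ltr_wpDr ?ltr01// sumr_ge0.
move=> i; have wM : 1 + w i <= 1 + \sum_i w i.
  by rewrite lerD2l (bigD1 i)//= lerDl sumr_ge0// => l _; exact: w0.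
move: wM (w0 i) (l0 i) (c0 i) (e0 i) (sqr_ge0 (len2 V i)); move: (1 + \sum_i w i) => M.
by rewrite /w => ? ? ? ? ? ?; split; lra.
Qed.

(** Twice the squared strain is at least the squared gradient minus twice the
    Jacobian determinant, and [jacobian_boundary] moves the determinant to the
    boundary. The corner values that appear there are controlled through the
    tangential components along both adjacent sides. The parameter [tau]
    weighs the boundary values of the field against those of its strain. *)
Lemma korn_boundary : exists2 C : R, 0 < C &
  forall n (T : 'I_n -> 'I_3 -> R * R), triangulation Om T ->
  forall k u P, pwfield T k u P -> forall tau : R, 1 <= tau ->
  sumK T (qG P) <= 2 * sumK T (qE P) + C * sumF V T (fun _ => kornY P tau).
Proof.
have [M M0 Mi] := side_constants.
exists ((8 * M ^+ 3 + M) * M).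
  by rewrite mulr_gt0// addr_gt0// mulr_gt0// exprn_gt0.
move=> n T hT k u P hP tau tau1.
pose Z i := sideY T P i tau.
pose S x := u x 0 0 ^+ 2 + u x 1 0 ^+ 2.
have ends i := side_end_bound hT hP tau1 (let: And5 _ h _ _ _ := Mi i in h)
  (let: And5 _ _ h _ _ := Mi i in h).
have Z0 i : 0 <= Z i.
  by rewrite -(pmulr_rge0 _ M0); exact: le_trans (sqr_ge0 _) (ends i).1.
have corner i : S (V (ordS i)) <= 2 * M ^+ 3 * (Z i + Z (ordS i)).
  have [_ _ _ h4 _] := Mi i; have [_ h2 _ _ _] := Mi i; have [_ h2' _ _ _] := Mi (ordS i).
  have [_ e1] := ends i; have [e0 _] := ends (ordS i).
  rewrite side_param1 in e1; rewrite side_param0 in e0.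
  have := corner_bound (side_vec V i).1 (side_vec V i).2 (side_vec V (ordS i)).1
    (side_vec V (ordS i)).2 (u (V (ordS i)) 0 0) (u (V (ordS i)) 1 0).
  have c0 : 0 < cross (side_vec V i) (side_vec V (ordS i)) ^+ 2.
    by rewrite exprn_even_gt0//= (corner_cross hOm).
  have lM : len2 V i <= M by apply: le_trans h2; rewrite mulr_natl mulr2n lerDl ltW ?(len2_gt0 hOm).
  have lM' : len2 V (ordS i) <= M.
    by apply: le_trans h2'; rewrite mulr_natl mulr2n lerDl ltW ?(len2_gt0 hOm).
  move=> H; apply: (corner_combine M0 c0 _ _ _ lM lM' e1 e0 h4 H).
  - exact: ltW (len2_gt0 hOm i).
  - exact: sqr_ge0.
  - exact: sqr_ge0.
have cJ (p r : 'I_2) K : continuous (jacobian (P p K) (P r K)).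
  have c p' l := field_partial_continuous hP (j := p') (j' := l) (K := K).
  rewrite /jacobian; exact: (ct_add (ct_mul (c p 0) (c r 1)) (ct_opp (ct_mul (c p 1) (c r 0)))).
have cE K : continuous (qE P K).
  rewrite /qE; move: (ga_continuous K hP) => [+ + + + _].
  by move: (ga P K) (gb P K) (gc P K) (gd P K) => a b c d ? ? ? ?; continuity.
have cG K : continuous (qG P K).
  rewrite /qG; move: (ga_continuous K hP) => [+ + + + _].
  by move: (ga P K) (gb P K) (gc P K) (gd P K) => a b c d ? ? ? ?; continuity.
pose J p r := sumK T (fun K => jacobian (P p K) (P r K)).
have step1 : sumK T (qG P) <= 2 * sumK T (qE P) + 2 * J 0 1.
  rewrite /J (sumK_scale hT 2 cE) (sumK_scale hT 2 (cJ 0 1)).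
  have c2 K : continuous (fun x => 2 * qE P K x) := ct_mul (@ct_cst _ _ 2) (cE K).
  have c2' K : continuous (fun x => 2 * jacobian (P 0 K) (P 1 K) x) :=
    ct_mul (@ct_cst _ _ 2) (cJ 0 1 K).
  rewrite [leRHS](sumK_add hT c2 c2'); apply: (sumK_le hT) => //.
    by move=> K; exact: (ct_add (c2 K) (c2' K)).
  move=> K x _; rewrite /qG /qE /jacobian -/(ga P K x) -/(gb P K x) -/(gc P K x) -/(gd P K x).
  move: (ga P K x) (gb P K x) (gc P K x) (gd P K x) => a b c d; exact: korn_pointwise.
have step2 : 2 * J 0 1 = J 0 1 - J 1 0.
  have -> : J 1 0 = (-1) * J 0 1.
    rewrite /J (sumK_scale hT (-1) (cJ 0 1)); apply: eq_bigr => K _.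
    apply: eq_Rintegral => x _; rewrite /jacobian.
    move: (partial 0 (P 0 K) x) (partial 1 (P 0 K) x) (partial 0 (P 1 K) x) (partial 1 (P 1 K) x).
    by move=> a b c d; ring.
  by ring.
have step3 : J 0 1 - J 1 0 <= \sum_i (S (V i) + S (V (ordS i)) + M * Z i).
  have j01 := jacobian_boundary hOm hT (hP 0) (hP 1).
  have j10 := jacobian_boundary hOm hT (hP 1) (hP 0).
  rewrite /J /sumK [X in X - _]j01 [X in _ - X]j10 -sumrB; apply: ler_sum => i _.
  have := side_rotation_bound hT hP tau1 (let: And5 h _ _ _ _ := Mi i in h)
    (let: And5 _ h _ _ _ := Mi i in h).
  apply: le_trans; rewrite -sumrB le_eqVlt; apply/orP; left; apply/eqP.
  apply: eq_bigr => f _.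
  have cs := @side_param_continuous _ _ V i.
  have c p' l := ct_comp (field_partial_continuous hP (j := p') (j' := l) (K := f.1)) cs.
  have c' p' := ct_comp (field_continuous hP (j := p') (K := f.1)) cs.
  have w p' r := ct_mul (c' p') (ct_add (ct_mul (@ct_cst _ _ (side_vec V i).1) (c r 0))
    (ct_mul (@ct_cst _ _ (side_vec V i).2) (c r 1))).
  rewrite -[X in X - _ = _]mul1r -[X in _ - X = _]mul1r -mulNr.
  rewrite [LHS](Rintegral_comb _ _ _ _ (w 0 1) (w 1 0)); apply: eq_Rintegral => t _ /=.
  move: (P 0 f.1 _) (P 1 f.1 _) (partial 0 (P 0 f.1) _) (partial 1 (P 0 f.1) _)
    (partial 0 (P 1 f.1) _) (partial 1 (P 1 f.1) _) (side_vec V i).1 (side_vec V i).2.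
  by move=> u0 u1 a0 a1 b0 b1 p q; ring.
have step4 : \sum_i (S (V i) + S (V (ordS i)) + M * Z i) <= (8 * M ^+ 3 + M) * \sum_i Z i.
  exact: (cyclic_sum_bound (@ordS_inj m) corner).
have step5 : \sum_i Z i <= M * sumF V T (fun _ => kornY P tau).
  rewrite /sumF mulr_sumr; apply: ler_sum => i _.
  rewrite -mulr_sumr -[X in _ * (_ * X)]/(Z i) mulrA ler_peMl//.
  by have [_ _ _ _ h5] := Mi i; rewrite -ler_pdivrMr ?div1r// (side_vec_gt0 hOm).
rewrite step2 in step1; apply: le_trans step1 _; rewrite lerD2l.
apply: le_trans step3 _; apply: le_trans step4 _; rewrite -mulrA ler_wpM2l//.
by rewrite addr_ge0 ?mulr_ge0 ?exprn_ge0 ?(ltW M0).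
Qed.

End Korn.

(** * The test function *)

Lemma partial_affine {R : realType} (a b c : R) x :
  partial 0 (fun x => c + a * x.1 + b * x.2) x = a /\
  partial 1 (fun x => c + a * x.1 + b * x.2) x = b.
Proof.
have D (v : R * R) : is_derive x v (fun x => c + a * x.1 + b * x.2) (a * v.1 + b * v.2).
  have l (p q : R) : dv (fun t => p + t * q) (fun=> q).
    apply: (dv_eq _ _ (dv_add (dv_cst p) (dv_mul (@dv_id R) (dv_cst q)))) => t //.
    by rewrite mul1r mulr0 add0r addr0.
  have H : dv (fun t => c + a * (x.1 + t * v.1) + b * (x.2 + t * v.2)) (fun=> a * v.1 + b * v.2).
    apply: (dv_eq _ _ (dv_add (dv_add (dv_cst c) (dv_mul (dv_cst a) (l x.1 v.1)))
      (dv_mul (dv_cst b) (l x.2 v.2)))) => t //.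
    by rewrite !mul0r !add0r.
  by apply: is_derive_line; exact: H.
have [h0 h1] := (D (unit_vec 0), D (unit_vec 1)).
by rewrite /partial !derive_val /unit_vec /= !mulr0 !mulr1 addr0 add0r.
Qed.

Section NodalInterpolation.
Context {R : realType} {Om : set (R * R)}.
Context {n : nat} (T : 'I_n -> 'I_3 -> R * R) (hT : triangulation Om T).
Implicit Types (K L : 'I_n) (x y : R * R) (k : nat) (j : 'I_2).
Let T0 K : tdet (T K) != 0 := tdet_neq0 hT K.
Variable (W : 'I_2 -> R * R -> R).

Definition hatQ j K x : R := \sum_a W j (T K a) * lam (T K) a x.

(** A point common to several elements may be attributed to any of them, by
    [hatQ_conform]. *)
Definition hatw x : 'cV[R]_2 :=
  \col_j (if [pick K | `[< elt T K x >]] is Some K then hatQ j K x else 0).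

(** On a common face both interpolants only use the common vertices. *)
Lemma hatQ_conform j K L x : elt T K x -> elt T L x -> hatQ j K x = hatQ j L x.
Proof.
move=> Kx Lx; have [->//|KL] := eqVneq K L.
have [S [S' [_ _ ES _]]] := conform hT KL.
have : face (T K) S x by rewrite -ES.
move=> /(faceP _ _ (T0 K))[_ lS].
have vert a : lam (T K) a x != 0 -> exists b, T K a = T L b.
  move=> la; apply: (vertex_of_both hT).
  suff : face (T K) S (T K a) by rewrite -ES => -[].
  apply/faceP => //; split=> c; rewrite lam_vertex// => cS.
  by case: eqP => // ca; move: la; rewrite -ca lS ?eqxx.
rewrite /hatQ; transitivity (\sum_a lam (T K) a x * \sum_b W j (T L b) * lam (T L) b (T K a)).
  apply: eq_bigr => a _; have [->|la] := eqVneq (lam (T K) a x) 0; first by rewrite mulr0 mul0r.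
  have [b0 E] := vert a la; rewrite mulrC; congr (_ * _).
  rewrite E (bigD1 b0)//= lam_vertex// eqxx mulr1 big1 ?addr0// => b bb.
  by rewrite lam_vertex// (negbTE bb) mulr0.
under eq_bigr do rewrite mulr_sumr.
rewrite exchange_big; apply: eq_bigr => b _ /=.
rewrite (lam_lam hT L K b x) mulr_sumr; apply: eq_bigr => a _; ring.
Qed.

Lemma hatw_val j K x : elt T K x -> hatw x j 0 = hatQ j K x.
Proof.
move=> Kx; rewrite mxE; case: pickP => [L /asboolP Lx|/(_ K)/asboolP//].
exact: hatQ_conform.
Qed.

Lemma hatQ_affine j K : hatQ j K = fun x => (\sum_a W j (T K a) * lam (T K) a 0) +
  (\sum_a W j (T K a) * lam1 (T K) a) * x.1 + (\sum_a W j (T K a) * lam2 (T K) a) * x.2.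
Proof.
apply/funext => x; rewrite /hatQ !mulr_suml -!big_split; apply: eq_bigr => a _ /=.
rewrite (lamE _ _ x 0) /=; ring.
Qed.

Lemma hatQ_partial j K x : partial 0 (hatQ j K) x = \sum_a W j (T K a) * lam1 (T K) a /\
  partial 1 (hatQ j K) x = \sum_a W j (T K a) * lam2 (T K) a.
Proof. by rewrite hatQ_affine; exact: partial_affine. Qed.

Lemma hatw_field k : (1 <= k)%N -> pwfield T k hatw hatQ.
Proof.
move=> k1 j K; split; first by rewrite hatQ_affine; exact: affine_p2.
by move=> x; exact: hatw_val.
Qed.

Lemma hatw_poly k j K : (1 <= k)%N -> poly_on k (elt T K) (fun x => hatw x j 0).
Proof.
move=> k1; have [c hc] := affine_poly_on (elt T K) (\sum_a W j (T K a) * lam1 (T K) a)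
  (\sum_a W j (T K a) * lam2 (T K) a) (\sum_a W j (T K a) * lam (T K) a 0) k1.
by exists c => x Kx; rewrite (hatw_val j Kx) hatQ_affine hc.
Qed.

End NodalInterpolation.

Lemma weighted_sum_le {R : realType} (h C a b c x y z : R) :
  h * a <= C * x -> h * b <= C * y -> h * c <= C * z ->
  h * (a + b + c / 2) <= C * (x + y + 2^-1 * z).
Proof. by move=> ? ? ?; lra. Qed.

Section FieldSums.
Context {R : realType} {m : nat} (V : 'I_m -> R * R) (Om : set (R * R)).
Context (hOm : convex_polygonal_domain V Om).
Context {n : nat} (T : 'I_n -> 'I_3 -> R * R) (hT : triangulation Om T).
Variables (Cq CI : R).
Hypotheses (Cq0 : 0 < Cq) (CI0 : 0 < CI) (hfat : fat T Cq).
Variables (k : nat) (k1 : (1 <= k)%N).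
Hypothesis inverse : forall K q y, p2 k q -> elt T K y ->
  meshsize T ^+ 2 * q y ^+ 2 <= CI * \int[area]_(x in open_elt T K) (q x ^+ 2).
Variables (u : R * R -> 'cV[R]_2) (P : 'I_2 -> 'I_n -> R * R -> R).
Hypothesis hP : pwfield T k u P.
Implicit Types (K L : 'I_n) (i : 'I_m) (f g : 'I_n * 'I_3) (x y : R * R).
Local Notation h := (meshsize T).
Local Notation leb := (@lebesgue_measure R).

Lemma sum_flag_element (F : 'I_n -> R) : \sum_(f : 'I_n * 'I_3) F f.1 = 3 * \sum_K F K.
Proof.
rewrite -(pair_bigA _ (fun K (_ : 'I_3) => F K)) /= mulr_sumr.
by apply: eq_bigr => K _; rewrite sumr_const card_ord mulr_natl.
Qed.

Lemma sumF_element (F : 'I_n -> R) : (forall K, 0 <= F K) -> 0 <= h ->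
  sumF V T (fun _ f _ => F f.1) <= h * (3 * \sum_K F K).
Proof.
move=> F0 h0; rewrite -sum_flag_element mulr_sumr.
apply: le_trans (sum_onside_le hOm hT (F := fun f => h * F f.1) _); last first.
  by move=> f; rewrite mulr_ge0.
apply: ler_sum => i _; apply: ler_sum => f fi.
have [_ le] := onside_length hOm hT Cq0 hfat fi.
have lt := ltW (tm_lt_tp hOm hT fi).
rewrite Rintegral_cst; last exact: measurable_itv.
have -> : fine (leb `[tm V T i f, tp V T i f]%classic) = tp V T i f - tm V T i f.
  rewrite lebesgue_measure_itv/= lte_fin; case: ltP => //= ge.
  by apply/esym/eqP; rewrite subr_eq0 eq_le ge lt.
by rewrite mulrCA mulrC ler_wpM2r.
Qed.

Let cP := fun K => ga_continuous K hP.

Definition element_energy K : R := \int[area]_(x in open_elt T K) qG P K x.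

Lemma qG_continuous K : continuous (qG P K).
Proof.
rewrite /qG; move: (cP K) => [+ + + + _].
by move: (ga P K) (gb P K) (gc P K) (gd P K) => a b c d ? ? ? ?; continuity.
Qed.

Lemma qE_continuous K : continuous (qE P K).
Proof.
rewrite /qE; move: (cP K) => [+ + + + _].
by move: (ga P K) (gb P K) (gc P K) (gd P K) => a b c d ? ? ? ?; continuity.
Qed.

Lemma qB_continuous f : continuous (qB P f).
Proof.
rewrite /qB; move: (cP f.1) => [_ _ _ _ H]; move: (H 0) (H 1).
by move: (P 0 f.1) (P 1 f.1) => a b ? ?; continuity.
Qed.

Lemma qN_continuous i f : continuous (qN V P i f).
Proof.
rewrite /qN; move: (cP f.1) => [_ _ _ _ H]; move: (H 0) (H 1).
by move: (n1 V i) (n2 V i) (P 0 f.1) (P 1 f.1) => p q a b ? ?; continuity.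
Qed.

Let int_add K (F G : R * R -> R) : continuous F -> continuous G ->
  \int[area]_(x in open_elt T K) F x + \int[area]_(x in open_elt T K) G x =
  \int[area]_(x in open_elt T K) (F x + G x).
Proof.
move=> cF cG; by rewrite (RintegralD (measurable_open_elt T K)
  (open_elt_integrable hT K cF) (open_elt_integrable hT K cG)).
Qed.

Let int_scale K (c : R) (F : R * R -> R) : continuous F ->
  c * \int[area]_(x in open_elt T K) F x = \int[area]_(x in open_elt T K) (c * F x).
Proof.
by move=> cF; rewrite (RintegralZl _ (measurable_open_elt T K) (open_elt_integrable hT K cF)).
Qed.

Lemma open_elt_int_ge0 K (F : R * R -> R) : (forall x, 0 <= F x) ->
  0 <= \int[area]_(x in open_elt T K) F x.
Proof. by move=> F0; apply: Rintegral_ge0 => x _. Qed.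

Lemma qG_ge0 K x : 0 <= qG P K x.
Proof. by rewrite /qG !addr_ge0 ?sqr_ge0. Qed.

Lemma qE_ge0 K x : 0 <= qE P K x.
Proof. by rewrite /qE !addr_ge0 ?divr_ge0 ?sqr_ge0. Qed.

Lemma element_energy_ge0 K : 0 <= element_energy K.
Proof. by apply: open_elt_int_ge0 => x; exact: qG_ge0. Qed.

Lemma inverse_qE K y : elt T K y ->
  h ^+ 2 * qE P K y <= CI * \int[area]_(x in open_elt T K) qE P K x.
Proof.
move=> Ky; have pp j l : p2 k (partial l (P j K)) by have [/(p2_partial l)] := hP j K.
have a1 : h ^+ 2 * ga P K y ^+ 2 <= CI * \int[area]_(x in open_elt T K) (ga P K x ^+ 2) :=
  inverse (pp 0 0) Ky.
have a2 : h ^+ 2 * gd P K y ^+ 2 <= CI * \int[area]_(x in open_elt T K) (gd P K x ^+ 2) :=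
  inverse (pp 1 1) Ky.
have a3 : h ^+ 2 * (gb P K y + gc P K y) ^+ 2 <=
    CI * \int[area]_(x in open_elt T K) ((gb P K x + gc P K x) ^+ 2) :=
  inverse (p2_add (pp 0 1) (pp 1 0)) Ky.
have e : \int[area]_(x in open_elt T K) qE P K x =
  \int[area]_(x in open_elt T K) (ga P K x ^+ 2) + \int[area]_(x in open_elt T K) (gd P K x ^+ 2) +
  2^-1 * \int[area]_(x in open_elt T K) ((gb P K x + gc P K x) ^+ 2).
  move: (cP K) => [+ + + + _]; rewrite /qE.
  move: (ga P K) (gb P K) (gc P K) (gd P K) => a b c d ca cb cc cd.
  have c1 := @ct_exp _ _ _ 2 ca; have c2 := @ct_exp _ _ _ 2 cd; have c3 := @ct_exp _ _ _ 2 (ct_add cb cc).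
  rewrite [X in _ = _ + X](int_scale K _ c3) [X in _ = X + _](int_add K c1 c2).
  rewrite [RHS](int_add K (ct_add c1 c2) (ct_mul (@ct_cst _ _ 2^-1) c3)).
  by apply: eq_Rintegral => x _; rewrite [_ / 2]mulrC.
rewrite e /qE; apply: weighted_sum_le a1 a2 a3.
Qed.

(** The inverse inequality on the boundary elements, integrated over edges of
    length at most [h]. *)
Lemma boundary_strain : 0 < h -> h * sumF V T (fun _ f => qE P f.1) <= 3 * CI * sumK T (qE P).
Proof.
move=> h0; have E0 K : 0 <= CI * \int[area]_(x in open_elt T K) qE P K x / h ^+ 2.
  by rewrite divr_ge0 ?sqr_ge0// mulr_ge0 ?(ltW CI0)//; apply: open_elt_int_ge0; exact: qE_ge0.
have le : sumF V T (fun _ f => qE P f.1) <=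
    sumF V T (fun _ f _ => CI * \int[area]_(x in open_elt T f.1) qE P f.1 x / h ^+ 2).
  apply: sumF_le => [i f|i f|i f t fi ft].
  - exact: qE_continuous.
  - exact: ct_cst.
  - rewrite ler_pdivlMr ?exprn_gt0// mulrC; apply: inverse_qE.
    exact: (edge_elt hOm hT fi ft).
have := le_trans le (sumF_element E0 (ltW h0)); rewrite -(ler_pM2l h0) => H.
apply: le_trans H _; rewrite -mulr_suml -mulr_sumr -/(sumK T (qE P)).
by rewrite le_eqVlt; apply/orP; left; apply/eqP; field; rewrite gt_eqF.
Qed.

Lemma field_oscillation K x y : elt T K x -> elt T K y ->
  (P 0 K x - P 0 K y) ^+ 2 + (P 1 K x - P 1 K y) ^+ 2 <= CI * element_energy K.
Proof.
move=> Kx Ky; have pp j : p2 k (P j K) by have [] := hP j K.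
have a0 : (P 0 K x - P 0 K y) ^+ 2 <= CI * (\int[area]_(z in open_elt T K) (ga P K z ^+ 2) +
    \int[area]_(z in open_elt T K) (gb P K z ^+ 2)) := oscillation hT hfat inverse (pp 0) Kx Ky.
have a1 : (P 1 K x - P 1 K y) ^+ 2 <= CI * (\int[area]_(z in open_elt T K) (gc P K z ^+ 2) +
    \int[area]_(z in open_elt T K) (gd P K z ^+ 2)) := oscillation hT hfat inverse (pp 1) Kx Ky.
apply: le_trans (lerD a0 a1) _; rewrite -mulrDr ler_pM2l// le_eqVlt; apply/orP; left; apply/eqP.
rewrite /element_energy /qG; move: (cP K) => [+ + + + _].
move: (ga P K) (gb P K) (gc P K) (gd P K) => a b c d ca cb cc cd.
have c1 := @ct_exp _ _ _ 2 ca; have c2 := @ct_exp _ _ _ 2 cb.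
have c3 := @ct_exp _ _ _ 2 cc; have c4 := @ct_exp _ _ _ 2 cd.
rewrite [X in X + _](int_add K c1 c2) [X in _ + X](int_add K c3 c4).
rewrite [LHS](int_add K (ct_add c1 c2) (ct_add c3 c4)).
by apply: eq_Rintegral => x' _; rewrite !addrA.
Qed.

End FieldSums.

Section PenaltyAlgebra.
Context {R : realType}.

Lemma sqr_sum3 (F : 'I_3 -> R) : (\sum_a F a) ^+ 2 <= 3 * \sum_a F a ^+ 2.
Proof.
rewrite (sumI3 F 0) (sumI3 (fun a => F a ^+ 2) 0).
move: (F 0) (F (0 + 1)) (F (0 + 2%:R)) => x y z.
have := sqr_ge0 (x - y); have := sqr_ge0 (y - z); have := sqr_ge0 (z - x).
by move=> ? ? ?; nra.
Qed.

Lemma twice_bound (c d x y e : R) : (c - x) ^+ 2 + (d - y) ^+ 2 <= e ->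
  c ^+ 2 + d ^+ 2 <= 2 * (x ^+ 2 + y ^+ 2) + 2 * e.
Proof.
have := sqr_ge0 (c - 2 * x); have := sqr_ge0 (d - 2 * y) => ? ? ?; nra.
Qed.

(** The stress of the gradient [rho (c, d)^T (a, b)] in the direction of the
    unit normal [(a, b)], paired with a vector [(x, y)] close to [(c, d)]. *)
Lemma penalty_lower (mu lam rho h Cq a b c d x y e : R) : 0 <= mu -> 0 <= lam -> 0 < h ->
  a ^+ 2 + b ^+ 2 = 1 -> h^-1 <= rho -> rho <= Cq / h ->
  (c - x) ^+ 2 + (d - y) ^+ 2 <= e ->
  mu / (2 * h) * (x ^+ 2 + y ^+ 2) + lam / (2 * h) * (x * a + y * b) ^+ 2 <=
  2 * mu * ((c * a * rho * a + (c * b * rho + d * a * rho) / 2 * b) * x +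
            ((c * b * rho + d * a * rho) / 2 * a + d * b * rho * b) * y) +
  lam * ((c * a * rho + d * b * rho) * (x * a + y * b)) + (mu + lam) * (Cq / h) * e.
Proof.
move=> mu0 lam0 h0 ab1 rho1 rho2 he.
set rhs := 2 * mu * _ + _.
have rhsE : rhs = rho * (mu * ((c * x + d * y) + (c * a + d * b) * (x * a + y * b)) +
    lam * ((c * a + d * b) * (x * a + y * b))).
  transitivity (rho * (mu * ((c * x + d * y) * (a ^+ 2 + b ^+ 2) +
      (c * a + d * b) * (x * a + y * b)) + lam * ((c * a + d * b) * (x * a + y * b)))).
    by rewrite /rhs; field.
  by rewrite ab1 mulr1.
pose u2 := x ^+ 2 + y ^+ 2; pose un := x * a + y * b.
have e0 : 0 <= e by apply: le_trans he; rewrite addr_ge0 ?sqr_ge0.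
have A1 : u2 / 2 - e / 2 <= c * x + d * y.
  have := sqr_ge0 c; have := sqr_ge0 d; rewrite /u2 => ? ?; move: he.
  by rewrite !sqrrB => ?; lra.
have en : ((c - x) * a + (d - y) * b) ^+ 2 <= e.
  apply: le_trans (cauchy2 _ _ _ _) _.
  by rewrite ab1 mulr1.
have A2 : un ^+ 2 / 2 - e / 2 <= (c * a + d * b) * un.
  have -> : c * a + d * b = ((c - x) * a + (d - y) * b) + un by rewrite /un; ring.
  have := sqr_ge0 ((c - x) * a + (d - y) * b + un); move: en.
  move: ((c - x) * a + (d - y) * b) (un) => p q; rewrite sqrrD mulrDl -expr2 => ? ?; lra.
have u20 : 0 <= u2 by rewrite addr_ge0 ?sqr_ge0.
have un0 : 0 <= un ^+ 2 by exact: sqr_ge0.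
pose pos := mu * u2 / 2 + lam * un ^+ 2 / 2.
pose neg := (mu + lam) * e.
have pos0 : 0 <= pos.
  by have := mulr_ge0 mu0 u20; have := mulr_ge0 lam0 un0; rewrite /pos => ? ?; lra.
have neg0 : 0 <= neg by rewrite /neg mulr_ge0// addr_ge0.
have core : pos - neg <= mu * ((c * x + d * y) + (c * a + d * b) * un) +
    lam * ((c * a + d * b) * un).
  have B1 : mu * (u2 / 2 - e) <= mu * ((c * x + d * y) + (c * a + d * b) * un).
    by rewrite ler_wpM2l//; lra.
  have B2 : lam * (un ^+ 2 / 2 - e / 2) <= lam * ((c * a + d * b) * un).
    by rewrite ler_wpM2l.
  have le0 : 0 <= lam * e by rewrite mulr_ge0.
  have combine (z1 z2 z3 z4 : R) : mu * (z4 / 2 - e) <= mu * (z2 + z1) ->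
      lam * (z3 / 2 - e / 2) <= lam * z1 ->
      mu * z4 / 2 + lam * z3 / 2 - (mu + lam) * e <= mu * (z2 + z1) + lam * z1.
    by move: le0; clear; move=> ? ? ?; lra.
  exact: combine B1 B2.
have hi : 0 < h^-1 by rewrite invr_gt0.
have r0 : 0 <= rho := le_trans (ltW hi) rho1.
have D1 : rho * (pos - neg) <= rhs by rewrite rhsE ler_wpM2l.
have D2 : h^-1 * pos <= rho * pos by rewrite ler_wpM2r.
have D3 : rho * neg <= Cq / h * neg by rewrite ler_wpM2r.
have -> : mu / (2 * h) * (x ^+ 2 + y ^+ 2) + lam / (2 * h) * (x * a + y * b) ^+ 2 = h^-1 * pos.
  by rewrite /pos /u2 /un; field; rewrite gt_eqF.
have -> : (mu + lam) * (Cq / h) * e = Cq / h * neg by rewrite /neg; ring.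
move: D1 D2 D3; rewrite mulrBr; lra.
Qed.

End PenaltyAlgebra.

Section TestFunction.
Context {R : realType} {m : nat} (V : 'I_m -> R * R) (Om : set (R * R)).
Context (hOm : convex_polygonal_domain V Om).
Context {n : nat} (T : 'I_n -> 'I_3 -> R * R) (hT : triangulation Om T).
Variables (Cq CI : R).
Hypotheses (Cq0 : 0 < Cq) (CI0 : 0 < CI) (hfat : fat T Cq).
Variables (k : nat) (k1 : (1 <= k)%N).
Hypothesis inverse : forall K q y, p2 k q -> elt T K y ->
  meshsize T ^+ 2 * q y ^+ 2 <= CI * \int[area]_(x in open_elt T K) (q x ^+ 2).
Variables (u : R * R -> 'cV[R]_2) (P : 'I_2 -> 'I_n -> R * R -> R).
Hypothesis hP : pwfield T k u P.
Hypothesis apex_Om : forall i f, onside V T i f -> Om (apex T f).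
Implicit Types (K L : 'I_n) (i : 'I_m) (f g : 'I_n * 'I_3) (x y : R * R) (j : 'I_2).
Local Notation h := (meshsize T).
Local Notation leb := (@lebesgue_measure R).
Hypothesis h0 : 0 < h.

Definition is_apex y : bool := [exists i, exists f, onside V T i f && (apex T f == y)].

(** Opposite to the field at the third vertices of the elements with an edge
    on the boundary, which are interior; zero at the other vertices, so that
    the test function vanishes on the boundary. *)
Definition nodal_value j y : R := if is_apex y then - u y j 0 else 0.

Local Notation Q := (hatQ T nodal_value).

Lemma test_field : pwfield T k (hatw T nodal_value) Q.
Proof. exact: (hatw_field hT). Qed.

Lemma nodal_value_apex i f j : onside V T i f -> nodal_value j (apex T f) = - P j f.1 (apex T f).
Proof.
move=> fi; rewrite /nodal_value (field_val hP j (vertex_elt hT f.1 f.2)) ifT//.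
by apply/existsP; exists i; apply/existsP; exists f; rewrite fi eqxx.
Qed.

Lemma nodal_value_end i x j : ell V i x = 0 -> nodal_value j x = 0.
Proof.
move=> lx; rewrite /nodal_value; case: ifPn => // /existsP[i' /existsP[f /andP[fi /eqP fx]]].
by have := ell_gt0 hOm i (apex_Om fi); rewrite fx lx ltxx.
Qed.

Lemma test_sum i f j (l : 'I_3 -> R) : onside V T i f ->
  \sum_a nodal_value j (T f.1 a) * l a = nodal_value j (apex T f) * l f.2.
Proof.
move=> /andP[/eqP la /eqP lb]; rewrite (sumI3 _ f.2).
by rewrite [nodal_value j (T f.1 (f.2 + 1))](nodal_value_end j la) [nodal_value j (T f.1 (f.2 + 2%:R))](nodal_value_end j lb)
  !mul0r !addr0.
Qed.

Lemma test_side i f t j : onside V T i f -> Q j f.1 (side_param V i t) = 0.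
Proof. by move=> fi; rewrite /hatQ (test_sum j _ fi) (onside_lam_apex hOm hT)// mulr0. Qed.

(** Inverse of the height of the element over its edge on the side. *)
Definition rho i f : R := enorm (side_vec V i) / ell V i (apex T f).

Lemma rho_bounds i f : onside V T i f -> h^-1 <= rho i f /\ rho i f <= Cq / h.
Proof.
move=> fi; have [le1 le2] := onside_height hOm hT Cq0 hfat fi.
have l0 := onside_apex hOm hT fi; split; rewrite /rho.
  by rewrite ler_pdivlMr// ler_pdivrMl.
by rewrite ler_pdivrMr// mulrAC ler_pdivlMr// mulrC.
Qed.

Lemma lam_normal i f : onside V T i f -> lam1 (T f.1) f.2 = - (n1 V i * rho i f) /\
  lam2 (T f.1) f.2 = - (n2 V i * rho i f).
Proof.
move=> fi; have l0 := onside_apex hOm hT fi; have e0 := side_vec_gt0 hOm i.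
have z := onside_ell hT 0 fi; have x := onside_ell hT (1, 0) fi; have y := onside_ell hT (0, 1) fi.
rewrite (lamE _ _ _ 0) in x; rewrite (lamE _ _ _ 0) in y.
have r (c : R) : c / enorm (side_vec V i) * rho i f = c / ell V i (apex T f).
  by rewrite /rho mulrA divfK// gt_eqF.
rewrite /n1 /n2 !r; split; apply: (mulIf (lt0r_neq0 l0)).
  rewrite mulNr divfK ?gt_eqF//; apply: (addrI (ell V i 0)).
  transitivity (ell V i (1, 0)); first by rewrite x z /=; ring.
  by rewrite /ell /cross /=; ring.
rewrite mulNr divfK ?gt_eqF//; apply: (addrI (ell V i 0)).
transitivity (ell V i (0, 1)); first by rewrite y z /=; ring.
by rewrite /ell /cross /=; ring.
Qed.

Lemma normal_unit i : n1 V i ^+ 2 + n2 V i ^+ 2 = 1.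
Proof.
have e0 := side_vec_gt0 hOm i; rewrite /n1 /n2 !expr_div_n sqrrN -mulrDl addrC -enorm_sqr.
by rewrite divff// expf_neq0// gt_eqF.
Qed.

Lemma test_gradient i f x : onside V T i f ->
  [/\ ga Q f.1 x = P 0 f.1 (apex T f) * n1 V i * rho i f,
      gb Q f.1 x = P 0 f.1 (apex T f) * n2 V i * rho i f,
      gc Q f.1 x = P 1 f.1 (apex T f) * n1 V i * rho i f &
      gd Q f.1 x = P 1 f.1 (apex T f) * n2 V i * rho i f].
Proof.
move=> fi; have [e1 e2] := lam_normal fi.
have [q0 q1] := hatQ_partial T nodal_value 0 f.1 x; have [q2 q3] := hatQ_partial T nodal_value 1 f.1 x.
rewrite /ga /gb /gc /gd q0 q1 q2 q3 !(test_sum _ _ fi) !(nodal_value_apex _ fi) e1 e2.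
by split; rewrite mulrNN mulrA.
Qed.

Lemma qb_continuous k' k'' w w' (A B : 'I_2 -> 'I_n -> R * R -> R) mu lam i f :
  pwfield T k' w A -> pwfield T k'' w' B -> continuous (qb V mu lam A B i f).
Proof.
move=> hA hB; rewrite /qb.
move: (ga_continuous f.1 hA) (ga_continuous f.1 hB) => [+ + + + _] [_ _ _ _ H].
move: (H 0) (H 1); move: (n1 V i) (n2 V i) (ga A f.1) (gb A f.1) (gc A f.1) (gd A f.1).
by move: (B 0 f.1) (B 1 f.1) => a b c d a' b' c' d' ? ? ? ? ? ?; continuity.
Qed.

Local Notation G := (sumK T (qG P)).
Local Notation BB := (sumF V T (fun _ => qB P)).
Local Notation BN := (sumF V T (qN V P)).

Lemma element_energy_sum (c : R) : 0 <= c -> sumF V T (fun _ f _ => c * element_energy T P f.1) <= h * (3 * (c * G)).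
Proof.
move=> c0; have := @sumF_element _ _ _ _ hOm _ _ hT Cq Cq0 hfat (fun K => c * element_energy T P K).
rewrite -mulr_sumr => H; apply: H; last exact: ltW.
by move=> K; rewrite mulr_ge0// element_energy_ge0.
Qed.

(** On an element with an edge on the side the gradient of the test function
    has the direction of the normal and the size of [u] divided by the height,
    so its boundary stress paired with [u] recovers the penalty terms.
    Replacing the value of [u] at the apex by the value on the edge costs an
    oscillation. *)
Lemma penalty_bound mu lam : 0 <= mu -> 0 <= lam ->
  mu / (2 * h) * BB + lam / (2 * h) * BN <=
  sumF V T (qb V mu lam Q P) + 3 * (mu + lam) * Cq * CI * G.
Proof.
move=> mu0 lam0.
have cb := fun i f => @qb_continuous _ _ _ _ _ _ mu lam i f test_field hP.
have cB : forall (i : 'I_m) f, continuous (qB P f) := fun _ f => qB_continuous hP (f := f).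
have cN i f : continuous (qN V P i f) by exact: (qN_continuous (V := V) hP (i := i) (f := f)).
pose c := (mu + lam) * (Cq / h) * CI.
have c0 : 0 <= c by rewrite !mulr_ge0 ?addr_ge0 ?invr_ge0 ?(ltW h0) ?(ltW Cq0) ?(ltW CI0).
have cst : forall (i : 'I_m) f, continuous (fun _ : R * R => c * element_energy T P f.1) :=
  fun _ _ => @ct_cst _ _ _.
have le : mu / (2 * h) * BB + lam / (2 * h) * BN <=
    sumF V T (qb V mu lam Q P) + sumF V T (fun _ f _ => c * element_energy T P f.1).
  rewrite [X in X + _](sumF_scale V T _ cB) [X in _ + X](sumF_scale V T _ cN) [leRHS](sumF_add V T cb cst).
  have c1 : forall i f, continuous (fun x => mu / (2 * h) * qB P f x) :=
    fun i f => ct_mul (@ct_cst _ _ _) (cB i f).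
  have c2 : forall i f, continuous (fun x => lam / (2 * h) * qN V P i f x) :=
    fun i f => ct_mul (@ct_cst _ _ _) (cN i f).
  rewrite (sumF_add V T c1 c2); apply: sumF_le => [i f|i f|i f t fi ft].
  - exact: (ct_add (c1 i f) (c2 i f)).
  - exact: (ct_add (cb i f) (cst i f)).
  have [r1 r2] := rho_bounds fi.
  have [ea eb ec ed] := test_gradient (side_param V i t) fi.
  have osc := field_oscillation hT CI0 hfat inverse hP (vertex_elt hT f.1 f.2)
    (edge_elt hOm hT fi ft).
  have := penalty_lower mu0 lam0 h0 (normal_unit i) r1 r2 osc.
  rewrite /qb /qB /qN ea eb ec ed /c -![in X in _ -> X]mulrA ![in X in X -> _]mulrA.
  by rewrite -!mulrA.
apply: le_trans le _; rewrite lerD2l; apply: le_trans (element_energy_sum c0) _.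
by rewrite le_eqVlt; apply/orP; left; apply/eqP; rewrite /c; field; rewrite gt_eqF.
Qed.

Lemma sumF_eq0 (q : 'I_m -> 'I_n * 'I_3 -> R * R -> R) :
  (forall i f t, onside V T i f -> q i f (side_param V i t) = 0) -> sumF V T q = 0.
Proof.
move=> q0; rewrite /sumF big1// => i _; rewrite big1// => f fi.
have -> : \int[leb]_(t in `[tm V T i f, tp V T i f]) q i f (side_param V i t) =
    \int[leb]_(t in `[tm V T i f, tp V T i f]) 0.
  by apply: eq_Rintegral => t _; exact: q0.
by rewrite Rintegral_cst ?mul0r ?mulr0//; exact: measurable_itv.
Qed.

Lemma test_boundary mu lam : [/\ sumF V T (fun _ => qB Q) = 0, sumF V T (qN V Q) = 0 &
  sumF V T (qb V mu lam P Q) = 0].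
Proof.
split; apply: sumF_eq0 => i f t fi.
- by rewrite /qB !(test_side t _ fi) expr0n addr0.
- by rewrite /qN !(test_side t _ fi) !mul0r addr0 expr0n.
- by rewrite /qb !(test_side t _ fi) !mulr0 !mul0r !addr0 !mulr0 addr0.
Qed.

Definition nodal_sqr y : R := nodal_value 0 y ^+ 2 + nodal_value 1 y ^+ 2.

Let nodal_sqr_ge0 y : 0 <= nodal_sqr y. Proof. by rewrite addr_ge0 ?sqr_ge0. Qed.

Lemma test_gradient_le K x : h ^+ 2 * qG Q K x <= 3 * Cq ^+ 2 * \sum_a nodal_sqr (T K a).
Proof.
have [q0 q1] := hatQ_partial T nodal_value 0 K x; have [q2 q3] := hatQ_partial T nodal_value 1 K x.
have le1 : qG Q K x <= 3 * \sum_a nodal_sqr (T K a) * (lam1 (T K) a ^+ 2 + lam2 (T K) a ^+ 2).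
  rewrite /qG /ga /gb /gc /gd q0 q1 q2 q3.
  have s0 := sqr_sum3 (fun a => nodal_value 0 (T K a) * lam1 (T K) a).
  have s1 := sqr_sum3 (fun a => nodal_value 0 (T K a) * lam2 (T K) a).
  have s2 := sqr_sum3 (fun a => nodal_value 1 (T K a) * lam1 (T K) a).
  have s3 := sqr_sum3 (fun a => nodal_value 1 (T K a) * lam2 (T K) a).
  apply: le_trans (lerD (lerD (lerD s0 s1) s2) s3) _.
  rewrite -!mulrDr -!big_split le_eqVlt; apply/orP; left; apply/eqP; congr (_ * _).
  by apply: eq_bigr => a _ /=; rewrite /nodal_sqr; ring.
apply: le_trans (ler_wpM2l (sqr_ge0 h) le1) _.
rewrite mulrCA -mulrA ler_pM2l// !mulr_sumr; apply: ler_sum => a _.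
by rewrite mulrCA [leRHS]mulrC ler_wpM2l// (lam_gradient hT Cq0 hfat).
Qed.

Lemma test_gradient_int K :
  \int[area]_(x in open_elt T K) qG Q K x <= 12 * Cq ^+ 2 * \sum_a nodal_sqr (T K a).
Proof.
pose c := 3 * Cq ^+ 2 * (\sum_a nodal_sqr (T K a)) / h ^+ 2.
have c0 : 0 <= c.
  by rewrite /c divr_ge0 ?sqr_ge0// mulr_ge0 ?sumr_ge0// mulr_ge0 ?sqr_ge0.
have one : \int[area]_(x in open_elt T K) c = c * \int[area]_(x in open_elt T K) 1.
  rewrite !Rintegral_cst ?mul1r//; exact: measurable_open_elt.
apply: (@le_trans _ _ (\int[area]_(x in open_elt T K) c)).
  apply: le_Rintegral.
  - exact: measurable_open_elt.
  - exact: (open_elt_integrable hT K (qG_continuous test_field (K := K))).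
  - exact: (open_elt_integrable hT K (@ct_cst _ _ c)).
  - by move=> x _; rewrite /c ler_pdivlMr ?exprn_gt0// mulrC test_gradient_le.
rewrite one; apply: le_trans (ler_wpM2l c0 (area_elt_le hT hfat K)) _.
by rewrite /c le_eqVlt; apply/orP; left; apply/eqP; field; rewrite gt_eqF.
Qed.

Definition apex_sqr f : R := qB P f (apex T f).

Let apex_sqr_ge0 f : 0 <= apex_sqr f. Proof. by rewrite addr_ge0 ?sqr_ge0. Qed.

(** Summing over all boundary edges with the given apex avoids choosing one of
    them. *)
Lemma nodal_sqr_le y : nodal_sqr y <= \sum_i \sum_(f | onside V T i f) (apex T f == y)%:R * apex_sqr f.
Proof.
have nn i : 0 <= \sum_(f | onside V T i f) (apex T f == y)%:R * apex_sqr f.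
  by apply: sumr_ge0 => f _; rewrite mulr_ge0.
have [|/negPf no] := boolP (is_apex y); last first.
  by rewrite /nodal_sqr /nodal_value no expr0n addr0 sumr_ge0.
move=> /existsP[i /existsP[f /andP[fi /eqP <-]]].
rewrite /nodal_sqr !(nodal_value_apex _ fi) !sqrrN (bigD1 i)//= (bigD1 f)//= eqxx mul1r -/(qB P f _) -/(apex_sqr f).
rewrite -addrA lerDl addr_ge0//; apply: sumr_ge0 => g' _; rewrite ?mulr_ge0//.
by apply: sumr_ge0 => g _; rewrite mulr_ge0.
Qed.

Lemma nodal_sum_le : \sum_K \sum_a nodal_sqr (T K a) <=
  12 * CI * \sum_i \sum_(f | onside V T i f) apex_sqr f.
Proof.
apply: (@le_trans _ _ (\sum_(g : 'I_n * 'I_3) \sum_i \sum_(f | onside V T i f)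
   (apex T f == T g.1 g.2)%:R * apex_sqr f)).
  by rewrite (pair_bigA _ (fun K a => nodal_sqr (T K a))) /=; apply: ler_sum => g _; exact: nodal_sqr_le.
rewrite exchange_big mulr_sumr; apply: ler_sum => i _ /=.
rewrite exchange_big mulr_sumr; apply: ler_sum => f _ /=.
rewrite -mulr_suml ler_wpM2r//.
have := vertex_count hT k1 CI0 hfat inverse (apex T f); apply: le_trans.
by apply: ler_sum => g _; rewrite eq_sym.
Qed.

(** The edges have length comparable with [h], so the value at the apex is
    bounded by the mean over the edge and the oscillation. *)
Lemma apex_value_sum : h * \sum_i \sum_(f | onside V T i f) apex_sqr f <= Cq * (2 * BB + 6 * CI * h * G).
Proof.
have cB : forall (i : 'I_m) f, continuous (qB P f) := fun _ f => qB_continuous hP (f := f).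
have cst (c : 'I_n * 'I_3 -> R) : forall (i : 'I_m) f, continuous (fun _ : R * R => c f) :=
  fun _ _ => @ct_cst _ _ _.
apply: (@le_trans _ _ (Cq * sumF V T (fun _ f _ => apex_sqr f))).
  rewrite /sumF !mulr_sumr; apply: ler_sum => i _; rewrite !mulr_sumr; apply: ler_sum => f fi.
  have [le _] := onside_length hOm hT Cq0 hfat fi.
  have lt := ltW (tm_lt_tp hOm hT fi).
  rewrite Rintegral_cst; last exact: measurable_itv.
  have -> : fine (leb `[tm V T i f, tp V T i f]%classic) = tp V T i f - tm V T i f.
    rewrite lebesgue_measure_itv/= lte_fin; case: ltP => //= ge.
    by apply/esym/eqP; rewrite subr_eq0 eq_le ge lt.
  by rewrite [apex_sqr f * _]mulrC [enorm _ * _]mulrA mulrA ler_wpM2r.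
rewrite ler_pM2l//.
have c1 : forall (i : 'I_m) f, continuous (fun x => 2 * qB P f x) :=
  fun i f => ct_mul (@ct_cst _ _ _) (cB i f).
apply: (@le_trans _ _ (2 * BB + sumF V T (fun _ f _ => 2 * CI * element_energy T P f.1))).
  rewrite [X in X + _](sumF_scale V T _ cB) (sumF_add V T c1 (cst (fun f => 2 * CI * element_energy T P f.1))).
  apply: sumF_le => [i f|i f|i f t fi ft].
  - exact: ct_cst.
  - exact: (ct_add (c1 i f) (cst (fun f => 2 * CI * element_energy T P f.1) i f)).
  have osc := field_oscillation hT CI0 hfat inverse hP (vertex_elt hT f.1 f.2)
    (edge_elt hOm hT fi ft).
  by rewrite -[2 * CI * _]mulrA /apex_sqr /qB; apply: twice_bound osc.
rewrite lerD2l; apply: le_trans (element_energy_sum _) _; first by rewrite mulr_ge0 ?(ltW CI0).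
by rewrite le_eqVlt; apply/orP; left; apply/eqP; ring.
Qed.

(** The barycentric coordinates have gradients of order [1 / h], and boundedly
    many elements meet at a vertex. *)
Lemma test_norm : h * sumK T (qG Q) <=
  144 * Cq ^+ 2 * CI * (Cq * (2 * BB + 6 * CI * h * G)).
Proof.
have c0 : 0 <= 144 * Cq ^+ 2 * CI.
  by apply: mulr_ge0; [apply: mulr_ge0; rewrite ?sqr_ge0|exact: ltW].
apply: le_trans (ler_wpM2l c0 apex_value_sum).
have le : sumK T (qG Q) <= 12 * Cq ^+ 2 * \sum_K \sum_a nodal_sqr (T K a).
  by rewrite /sumK mulr_sumr; apply: ler_sum => K _; exact: test_gradient_int.
have c1 : 0 <= 12 * Cq ^+ 2 by rewrite mulr_ge0 ?sqr_ge0.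
have {}le := le_trans le (ler_wpM2l c1 nodal_sum_le).
apply: le_trans (ler_wpM2l (ltW h0) le) _.
by rewrite le_eqVlt; apply/orP; left; apply/eqP; ring.
Qed.

End TestFunction.

(** * Choice of the parameters *)

Section Arithmetic.
Context {R : realType}.

(** Parameters of the test field [u + alpha w]: [delta] makes the boundary
    part of the Korn inequality small against the penalty gained from [w], the
    Young parameter [s] does the same for the energy of [w], and [alpha] is so
    small that the energy of [u] absorbs the remainder and [alpha w] is small
    against [u]. *)
Lemma test_choice (mu lam C1 C2 CK CI : R) : 0 < mu -> 0 < lam -> 0 < C1 -> 0 < C2 ->
  0 < CK -> 0 < CI -> exists delta alpha C : R, [/\ 0 < delta, 0 < alpha, 0 < C &
  forall E D G b n Gw AQ NQ : R, 0 <= E -> 0 <= D -> 0 <= G -> 0 <= b -> 0 <= n ->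
    G <= 2 * E + CK * (delta * b + 3 * CI * E / delta) ->
    Gw <= C2 * (b + G) ->
    (forall s : R, 0 < s ->
      mu / 2 * b + lam / 2 * n <= AQ + C1 * G + (mu + lam) * (s^-1 * E + s * Gw)) ->
    NQ <= (mu + 2 * lam) * Gw ->
    mu * (G + b) + lam * (D + n) <= C * (2 * mu * E + lam * D + alpha * AQ) /\
    2 * alpha ^+ 2 * NQ <= (mu * (G + b) + lam * (D + n)) / 4].
Proof.
move=> mu0 lam0 C10 C20 CK0 CI0.
pose C3' := C1 + mu / 8.
have C3'0 : 0 < C3' by rewrite addr_gt0// divr_gt0.
pose delta := mu / 8 / (C3' * CK).
have d0 : 0 < delta by rewrite !divr_gt0// mulr_gt0.
pose kap := mu + lam; have kap0 : 0 < kap by rewrite addr_gt0.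
pose s := mu / 8 / (kap * C2).
have s0 : 0 < s by rewrite !divr_gt0// mulr_gt0.
pose C4 := 2 + 3 * CK * CI / delta.
have C40 : 0 < C4 by rewrite addr_gt0// divr_gt0// !mulr_gt0.
pose C5 := CK * delta; have C50 : 0 < C5 by rewrite mulr_gt0.
pose C3 := C3' * C4 + kap / s.
have C30 : 0 < C3 by apply: addr_gt0; [exact: mulr_gt0|exact: divr_gt0].
pose C7 := (mu + 2 * lam) * C2 / mu.
have ml0 : 0 < mu + 2 * lam by rewrite addr_gt0// mulr_gt0.
have C70 : 0 < C7 by rewrite divr_gt0// mulr_gt0.
pose den := 1 + C3 / mu + 8 * C7.
have c3m : 0 < C3 / mu by rewrite divr_gt0.
have den0 : 0 < den by rewrite /den; lra.
pose alpha := den^-1; have al0 : 0 < alpha by rewrite invr_gt0.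
have al1 : alpha <= 1 by rewrite invf_le1// /den; lra.
have al3 : alpha * C3 <= mu.
  rewrite mulrC ler_pdivrMr// mulrC -ler_pdivrMr// /den; lra.
have al7 : alpha * C7 <= 1 / 8.
  rewrite mulrC ler_pdivrMr//; rewrite /den; lra.
pose C6 := 1 + C4 + (4 * (C5 + 1) + 2) / alpha.
have C60 : 0 < C6.
  have : 0 < (4 * (C5 + 1) + 2) / alpha by rewrite divr_gt0//; lra.
  by rewrite /C6 => ?; lra.
exists delta, alpha, C6; split => // E D G b n Gw AQ NQ E0 D0 G0 b0 n0 hG hGw hA hN.
have {hG} hG : G <= C4 * E + C5 * b.
  apply: le_trans hG _; rewrite le_eqVlt; apply/orP; left; apply/eqP.
  by rewrite /C4 /C5; field; rewrite gt_eqF.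
have kG : kap * (s * Gw) <= mu / 8 * (b + G).
  have -> : mu / 8 * (b + G) = kap * (s * (C2 * (b + G))).
    by rewrite /s; field; rewrite !gt_eqF.
  by rewrite ler_pM2l// ler_pM2l.
have dC : C3' * C5 = mu / 8 by rewrite /C5 /delta; field; rewrite !gt_eqF.
have A1 : mu / 4 * b + lam / 2 * n - C3 * E <= AQ.
  have h1 := hA s s0.
  have h2 : C3' * G <= C3' * (C4 * E + C5 * b) by rewrite ler_pM2l.
  have h3 : C3' * (C4 * E + C5 * b) = C3' * C4 * E + mu / 8 * b by rewrite -dC; ring.
  rewrite h3 /C3' in h2; rewrite -/kap mulrDr in h1.
  have -> : C3 * E = (C1 + mu / 8) * C4 * E + kap * (s^-1 * E) by rewrite /C3 /C3'; ring.
  move: h1 h2 kG; clear; move=> h1 h2 h3; lra.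
have low : mu * E + lam * D + alpha * (mu / 4 * b + lam / 2 * n) <= 2 * mu * E + lam * D + alpha * AQ.
  have h1 : alpha * (mu / 4 * b + lam / 2 * n - C3 * E) <= alpha * AQ by rewrite ler_pM2l.
  have h2 : alpha * C3 * E <= mu * E by rewrite ler_wpM2r.
  move: h1 h2; rewrite mulrBr mulrA; clear; move=> h1 h2; lra.
split.
  apply: le_trans (ler_wpM2l (ltW C60) low).
  have hN' : mu * (G + b) + lam * (D + n) <= mu * (C4 * E + C5 * b + b) + lam * (D + n).
    by rewrite lerD2r ler_pM2l// lerD2r.
  apply: le_trans hN' _.
  have t1 : mu * (C4 * E) <= C6 * (mu * E).
    rewrite mulrCA ler_wpM2r ?mulr_ge0 ?(ltW mu0)// /C6.
    have : 0 <= (4 * (C5 + 1) + 2) / alpha by rewrite divr_ge0 ?(ltW al0)//; lra.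
    move=> ?; lra.
  have t2 : lam * D <= C6 * (lam * D).
    rewrite ler_peMl ?mulr_ge0 ?(ltW lam0)// /C6.
    have : 0 <= (4 * (C5 + 1) + 2) / alpha by rewrite divr_ge0 ?(ltW al0)//; lra.
    move=> ?; lra.
  have C6a : 4 * (C5 + 1) + 2 <= C6 * alpha.
    have -> : C6 * alpha = (1 + C4) * alpha + (4 * (C5 + 1) + 2).
      by rewrite /C6; field; rewrite gt_eqF.
    by rewrite lerDr mulr_ge0 ?(ltW al0)//; lra.
  have t3 : mu * (C5 * b + b) <= C6 * (alpha * (mu / 4 * b)).
    have -> : C6 * (alpha * (mu / 4 * b)) = (C6 * alpha) * (mu * b / 4) by field.
    have mb : 0 <= mu * b / 4 by rewrite divr_ge0// mulr_ge0// ltW.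
    apply: le_trans (ler_wpM2r mb C6a).
    have -> : mu * (C5 * b + b) = (4 * (C5 + 1)) * (mu * b / 4) by field.
    by rewrite ler_wpM2r// lerDl.
  have t4 : lam * n <= C6 * (alpha * (lam / 2 * n)).
    have -> : C6 * (alpha * (lam / 2 * n)) = (C6 * alpha) * (lam * n / 2) by field.
    have mb : 0 <= lam * n / 2 by rewrite divr_ge0// mulr_ge0// ltW.
    apply: le_trans (ler_wpM2r mb C6a).
    apply: (@le_trans _ _ (2 * (lam * n / 2))); first by move: (lam * n) => z; lra.
    by rewrite ler_wpM2r// lerDr; lra.
  move: t1 t2 t3 t4; rewrite !mulrDr; clear; move=> t1 t2 t3 t4; lra.
have n2 : NQ <= C7 * (mu * (G + b)).
  apply: le_trans hN _; apply: le_trans (ler_wpM2l (ltW ml0) hGw) _.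
  rewrite le_eqVlt; apply/orP; left; apply/eqP; rewrite /C7; field; rewrite gt_eqF//.
have Y0 : 0 <= mu * (G + b) by rewrite mulr_ge0 ?addr_ge0 ?(ltW mu0).
have a2 : 2 * alpha ^+ 2 * NQ <= 2 * alpha * (1 / 8 * (mu * (G + b))).
  have -> : 2 * alpha ^+ 2 * NQ = 2 * alpha * (alpha * NQ) by ring.
  rewrite ler_pM2l ?mulr_gt0//; apply: le_trans (ler_wpM2l (ltW al0) n2) _.
  by rewrite [leLHS]mulrA ler_wpM2r.
have a3 : 2 * alpha * (1 / 8 * (mu * (G + b))) <= 2 * (1 / 8 * (mu * (G + b))).
  by rewrite ler_wpM2r ?mulr_ge0//; lra.
have l1 : 0 <= lam * (D + n) by rewrite mulr_ge0 ?addr_ge0 ?(ltW lam0).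
have fin (x y z t : R) : x <= y -> y <= 2 * (1 / 8 * z) -> 0 <= t -> x <= (z + t) / 4.
  by clear; move=> ? ? ?; lra.
exact: fin a2 a3 l1.
Qed.

End Arithmetic.

(** * Linear combinations of fields *)

Section Combination.
Context {R : realType}.

Lemma partial_comb k (f g : R * R -> R) (r : R) j x : p2 k f -> p2 k g ->
  partial j (fun y => f y + r * g y) x = partial j f x + r * partial j g x.
Proof.
move=> pf pg; have [_ df] := partial_p2 j pf; have [_ dg] := partial_p2 j pg.
have H := @is_deriveD _ _ _ f (r \*: g) x (unit_vec j) _ _ (df x) (is_deriveZ r (dg x)).
by rewrite {1}/partial (_ : (fun y => f y + r * g y) = f + r \*: g)// derive_val.
Qed.

Definition comb n (P Q : 'I_2 -> 'I_n -> R * R -> R) (r : R) :=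
  fun j K x => P j K x + r * Q j K x.

Context {m : nat} (V : 'I_m -> R * R) (Om : set (R * R)).
Context (hOm : convex_polygonal_domain V Om).
Context {n : nat} (T : 'I_n -> 'I_3 -> R * R) (hT : triangulation Om T).
Variables (k : nat).
Implicit Types (P Q : 'I_2 -> 'I_n -> R * R -> R) (u v w : R * R -> 'cV[R]_2).

Lemma field_comb u w P Q r : pwfield T k u P -> pwfield T k w Q ->
  pwfield T k (fun x => u x + r *: w x) (comb P Q r).
Proof.
move=> hP hQ j K; have [pP uP] := hP j K; have [pQ wQ] := hQ j K.
split; first exact: p2_add pP (p2_scale r pQ).
by move=> x Kx; rewrite !mxE uP// wQ.
Qed.

Lemma Vh_field u : Vh Om T k u -> exists P, pwfield T k u P.
Proof.
move=> hu; have H j K : exists f, p2 k f /\ forall x, elt T K x -> u x j 0 = f x.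
  by have [_ /(_ K)/poly_on_p2[f pf uf]] := hu j; exists f.
by exists (fun j K => projT1 (cid (H j K))) => j K; exact: (projT2 (cid (H j K))).
Qed.

Lemma Vh_comb u w r : Vh Om T k u -> Vh Om T k w -> Vh Om T k (fun x => u x + r *: w x).
Proof.
move=> hu hw; have [P hP] := Vh_field hu; have [Q hQ] := Vh_field hw.
move=> j; split; first exact: (piecewise_H1 hOm hT (field_comb r hP hQ j)).
move=> K; have [c hc] := poly_on_comb r ((hu j).2 K) ((hw j).2 K).
by exists c => x Kx; rewrite !mxE hc.
Qed.

End Combination.

(** Young's inequality for the energy form, in terms of the strain of the
    first field and the gradient of the second. *)
Lemma young_form {R : realType} (mu lam s a b c d a' b' c' d' : R) : 0 < s -> 0 <= mu -> 0 <= lam ->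
  - (2 * mu * (a * a' + d * d' + (b + c) * (b' + c') / 2) + lam * ((a + d) * (a' + d'))) <=
  (mu + lam) * (s^-1 * (a ^+ 2 + d ^+ 2 + (b + c) ^+ 2 / 2) +
                s * (a' ^+ 2 + b' ^+ 2 + c' ^+ 2 + d' ^+ 2)).
Proof.
move=> s0 mu0 lam0; have si : 0 < s^-1 by rewrite invr_gt0.
pose e := b + c; pose e' := b' + c'.
have e'2 : e' ^+ 2 / 2 <= b' ^+ 2 + c' ^+ 2.
  by have := sqr_ge0 (b' - c'); rewrite /e'; nra.
pose X := s^-1 * (a ^+ 2 + d ^+ 2 + e ^+ 2 / 2).
pose Y := s * (a' ^+ 2 + b' ^+ 2 + c' ^+ 2 + d' ^+ 2).
have yg (x y : R) : - (2 * (x * y)) <= s^-1 * x ^+ 2 + s * y ^+ 2.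
  by have := young2 (- x) y si; rewrite sqrrN invrK mulNr mulrN.
have ya := yg a a'; have yd := yg d d'; have ye := yg e e'; have yt := yg (a + d) (a' + d').
have se : s * (e' ^+ 2 / 2) <= s * (b' ^+ 2 + c' ^+ 2) by rewrite ler_pM2l.
have s1 : s^-1 * (a + d) ^+ 2 <= s^-1 * (2 * (a ^+ 2 + d ^+ 2)).
  by rewrite ler_pM2l//; have := sqr_ge0 (a - d); nra.
have s2 : s * (a' + d') ^+ 2 <= s * (2 * (a' ^+ 2 + d' ^+ 2)).
  by rewrite ler_pM2l//; have := sqr_ge0 (a' - d'); nra.
have ge0 (x y : R) : 0 < x -> 0 <= x * y ^+ 2 by move=> x0; rewrite mulr_ge0 ?sqr_ge0 ?ltW.
have B1 : - (2 * (a * a' + d * d' + e * e' / 2)) <= X + Y.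
  move: ya yd ye se; rewrite /X /Y !mulrDr; clear; move=> ya yd ye se; lra.
have B2 : - ((a + d) * (a' + d')) <= X + Y.
  have := ge0 s^-1 e si; have := ge0 s b' s0; have := ge0 s c' s0.
  move: yt s1 s2; rewrite /X /Y; move: ((a + d) * (a' + d')) (s^-1 * (a + d) ^+ 2) (s * (a' + d') ^+ 2).
  by rewrite !mulrDr; clear; move=> z1 z2 z3 *; lra.
have := ler_wpM2l mu0 B1; have := ler_wpM2l lam0 B2; rewrite -/e -/e' -/X -/Y.
move: (a * a' + d * d' + e * e' / 2) ((a + d) * (a' + d')) (X + Y) => z1 z2 z3; clear; move=> *; lra.
Qed.

Section BilinearForm.
Context {R : realType} {m : nat} (V : 'I_m -> R * R) (Om : set (R * R)).
Context (hOm : convex_polygonal_domain V Om).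
Context {n : nat} (T : 'I_n -> 'I_3 -> R * R) (hT : triangulation Om T).
Variables (k : nat) (mu lam : R).
Implicit Types (P Q : 'I_2 -> 'I_n -> R * R -> R) (u v w : R * R -> 'cV[R]_2)
  (K : 'I_n) (i : 'I_m) (f : 'I_n * 'I_3) (x : R * R) (r s : R).

Definition form_poly P Q : R :=
  sumK T (qa mu lam P Q) - sumF V T (qb V mu lam P Q) + sumF V T (qb V mu lam Q P).

Lemma form_AE u v P Q : pwfield T k u P -> pwfield T k v Q -> form_A V Om mu lam u v = form_poly P Q.
Proof.
move=> hP hQ; rewrite /form_A (form_aE hOm hT hP hQ) (form_bE hOm hT hP hQ).
by rewrite (form_bE hOm hT hQ hP).
Qed.

Lemma qa_continuous u v P Q K : pwfield T k u P -> pwfield T k v Q ->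
  continuous (qa mu lam P Q K).
Proof.
move=> hP hQ; rewrite /qa.
move: (ga_continuous K hP) (ga_continuous K hQ) => [+ + + + _] [+ + + + _].
by move: (ga P K) (gb P K) (gc P K) (gd P K) (ga Q K) (gb Q K) (gc Q K) (gd Q K) =>
  a b c d a' b' c' d' ? ? ? ? ? ? ? ?; continuity.
Qed.

Lemma comb_gradient u w P Q r K x : pwfield T k u P -> pwfield T k w Q ->
  [/\ ga (comb P Q r) K x = ga P K x + r * ga Q K x,
      gb (comb P Q r) K x = gb P K x + r * gb Q K x,
      gc (comb P Q r) K x = gc P K x + r * gc Q K x &
      gd (comb P Q r) K x = gd P K x + r * gd Q K x].
Proof.
move=> hP hQ; have pP j : p2 k (P j K) by have [] := hP j K.
have pQ j : p2 k (Q j K) by have [] := hQ j K.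
by split; exact: partial_comb.
Qed.

Lemma form_poly_comb u v w P Q1 Q2 r : pwfield T k u P -> pwfield T k v Q1 -> pwfield T k w Q2 ->
  form_poly P (comb Q1 Q2 r) = form_poly P Q1 + r * form_poly P Q2.
Proof.
move=> hP h1 h2.
have a1 K := @qa_continuous _ _ _ _ K hP h1; have a2 K := @qa_continuous _ _ _ _ K hP h2.
have b1 i f := @qb_continuous _ _ V _ T k k _ _ _ _ mu lam i f hP h1.
have b2 i f := @qb_continuous _ _ V _ T k k _ _ _ _ mu lam i f hP h2.
have c1 i f := @qb_continuous _ _ V _ T k k _ _ _ _ mu lam i f h1 hP.
have c2 i f := @qb_continuous _ _ V _ T k k _ _ _ _ mu lam i f h2 hP.
have E1 : sumK T (qa mu lam P (comb Q1 Q2 r)) =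
    sumK T (qa mu lam P Q1) + r * sumK T (qa mu lam P Q2).
  have a2' K : continuous (fun x => r * qa mu lam P Q2 K x) := ct_mul (@ct_cst _ _ r) (a2 K).
  rewrite (sumK_scale hT r a2) (sumK_add hT a1 a2').
  apply: eq_bigr => K _; apply: eq_Rintegral => x _.
  have [ea eb ec ed] := comb_gradient r K x h1 h2; rewrite /qa ea eb ec ed; ring.
have E2 : sumF V T (qb V mu lam P (comb Q1 Q2 r)) =
    sumF V T (qb V mu lam P Q1) + r * sumF V T (qb V mu lam P Q2).
  have b2' i f : continuous (fun x => r * qb V mu lam P Q2 i f x) := ct_mul (@ct_cst _ _ r) (b2 i f).
  rewrite (sumF_scale V T r b2) (sumF_add V T b1 b2').
  apply: eq_bigr => i _; apply: eq_bigr => f _; congr (_ * _); apply: eq_Rintegral => t _.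
  by rewrite /qb /comb; ring.
have E3 : sumF V T (qb V mu lam (comb Q1 Q2 r) P) =
    sumF V T (qb V mu lam Q1 P) + r * sumF V T (qb V mu lam Q2 P).
  have c2' i f : continuous (fun x => r * qb V mu lam Q2 P i f x) := ct_mul (@ct_cst _ _ r) (c2 i f).
  rewrite (sumF_scale V T r c2) (sumF_add V T c1 c2').
  apply: eq_bigr => i _; apply: eq_bigr => f _; congr (_ * _); apply: eq_Rintegral => t _.
  have [ea eb ec ed] := comb_gradient r f.1 (side_param V i t) h1 h2.
  by rewrite /qb ea eb ec ed; field.
have E (x y z a b c a' b' c' : R) : x = a + r * a' -> y = b + r * b' -> z = c + r * c' ->
  x - y + z = (a - b + c) + r * (a' - b' + c') by move=> -> -> ->; ring.
exact: E E1 E2 E3.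
Qed.

Lemma qD_continuous u P K : pwfield T k u P -> continuous (qD P K).
Proof.
move=> hP; rewrite /qD; move: (ga_continuous K hP) => [+ _ _ + _].
by move: (ga P K) (gd P K) => a b ? ?; continuity.
Qed.

Lemma form_poly_diag u P : pwfield T k u P ->
  form_poly P P = 2 * mu * sumK T (qE P) + lam * sumK T (qD P).
Proof.
move=> hP; rewrite /form_poly subrK.
have cE K := qE_continuous hP (K := K); have cD K := @qD_continuous _ _ K hP.
have c1 K : continuous (fun x => 2 * mu * qE P K x) := ct_mul (@ct_cst _ _ _) (cE K).
have c2 K : continuous (fun x => lam * qD P K x) := ct_mul (@ct_cst _ _ _) (cD K).
rewrite (sumK_scale hT _ cE) (sumK_scale hT lam cD) (sumK_add hT c1 c2).
apply: eq_bigr => K _; apply: eq_Rintegral => x _; rewrite /qa /qE /qD.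
by move: (ga P K x) (gb P K x) (gc P K x) (gd P K x) => a b c d; field.
Qed.

Lemma form_a_lower u w P Q s : pwfield T k u P -> pwfield T k w Q -> 0 < s -> 0 <= mu -> 0 <= lam ->
  0 <= sumK T (qa mu lam P Q) + (mu + lam) * (s^-1 * sumK T (qE P) + s * sumK T (qG Q)).
Proof.
move=> hP hQ s0 mu0 lam0.
have cE K := qE_continuous hP (K := K); have cG K := qG_continuous hQ (K := K).
have ca K := @qa_continuous _ _ _ _ K hP hQ.
have c1 K : continuous (fun x => s^-1 * qE P K x) := ct_mul (@ct_cst _ _ _) (cE K).
have c2 K : continuous (fun x => s * qG Q K x) := ct_mul (@ct_cst _ _ _) (cG K).
have c3 K := ct_add (c1 K) (c2 K).
have c4 K : continuous (fun x => (mu + lam) * (s^-1 * qE P K x + s * qG Q K x)) :=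
  ct_mul (@ct_cst _ _ _) (c3 K).
rewrite (sumK_scale hT _ cE) (sumK_scale hT s cG) (sumK_add hT c1 c2).
rewrite (sumK_scale hT _ c3) (sumK_add hT ca c4).
apply: sumr_ge0 => K _; apply: Rintegral_ge0 => x _.
by rewrite addrC -[X in 0 <= _ + X]opprK subr_ge0; exact: young_form.
Qed.

Let two_sqr (x y r : R) : (x + r * y) ^+ 2 <= 2 * x ^+ 2 + 2 * r ^+ 2 * y ^+ 2.
Proof.
rewrite -subr_ge0; have -> : 2 * x ^+ 2 + 2 * r ^+ 2 * y ^+ 2 - (x + r * y) ^+ 2 = (x - r * y) ^+ 2.
  by ring.
exact: sqr_ge0.
Qed.

Let sumK_comb (q q1 q2 : 'I_n -> R * R -> R) r : (forall K, continuous (q K)) ->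
  (forall K, continuous (q1 K)) -> (forall K, continuous (q2 K)) ->
  (forall K x, q K x <= 2 * q1 K x + 2 * r ^+ 2 * q2 K x) ->
  sumK T q <= 2 * sumK T q1 + 2 * r ^+ 2 * sumK T q2.
Proof.
move=> cq c1 c2 le.
have c1' K : continuous (fun x => 2 * q1 K x) := ct_mul (@ct_cst _ _ _) (c1 K).
have c2' K : continuous (fun x => 2 * r ^+ 2 * q2 K x) := ct_mul (@ct_cst _ _ _) (c2 K).
rewrite (sumK_scale hT 2 c1) (sumK_scale hT _ c2) (sumK_add hT c1' c2').
by apply: (sumK_le hT) => // K; exact: (ct_add (c1' K) (c2' K)).
Qed.

Let sumF_comb (q q1 q2 : 'I_m -> 'I_n * 'I_3 -> R * R -> R) r : (forall i f, continuous (q i f)) ->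
  (forall i f, continuous (q1 i f)) -> (forall i f, continuous (q2 i f)) ->
  (forall i f x, q i f x <= 2 * q1 i f x + 2 * r ^+ 2 * q2 i f x) ->
  sumF V T q <= 2 * sumF V T q1 + 2 * r ^+ 2 * sumF V T q2.
Proof.
move=> cq c1 c2 le.
have c1' i f : continuous (fun x => 2 * q1 i f x) := ct_mul (@ct_cst _ _ _) (c1 i f).
have c2' i f : continuous (fun x => 2 * r ^+ 2 * q2 i f x) := ct_mul (@ct_cst _ _ _) (c2 i f).
rewrite (sumF_scale V T 2 c1) (sumF_scale V T _ c2) (sumF_add V T c1' c2').
by apply: sumF_le => // i f; exact: (ct_add (c1' i f) (c2' i f)).
Qed.

Lemma norm2_comb u w P Q r h : pwfield T k u P -> pwfield T k w Q ->
  0 <= mu -> 0 <= lam -> 0 < h ->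
  norm2 V T mu lam h (comb P Q r) <= 2 * norm2 V T mu lam h P + 2 * r ^+ 2 * norm2 V T mu lam h Q.
Proof.
move=> hP hQ mu0 lam0 h0; have hC := field_comb r hP hQ.
have g : sumK T (qG (comb P Q r)) <= 2 * sumK T (qG P) + 2 * r ^+ 2 * sumK T (qG Q).
  apply: sumK_comb => [K|K|K|K x]; [exact: qG_continuous hC _|exact: qG_continuous hP _|
    exact: qG_continuous hQ _|].
  have [ea eb ec ed] := comb_gradient r K x hP hQ; rewrite /qG ea eb ec ed.
  have t1 := two_sqr (ga P K x) (ga Q K x) r; have t2 := two_sqr (gb P K x) (gb Q K x) r.
  have t3 := two_sqr (gc P K x) (gc Q K x) r; have t4 := two_sqr (gd P K x) (gd Q K x) r.
  apply: le_trans (lerD (lerD (lerD t1 t2) t3) t4) _.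
  by rewrite le_eqVlt; apply/orP; left; apply/eqP; ring.
have d : sumK T (qD (comb P Q r)) <= 2 * sumK T (qD P) + 2 * r ^+ 2 * sumK T (qD Q).
  apply: sumK_comb => [K|K|K|K x]; [exact: qD_continuous hC|exact: qD_continuous hP|
    exact: qD_continuous hQ|].
  have [ea _ _ ed] := comb_gradient r K x hP hQ; rewrite /qD ea ed.
  have -> : ga P K x + r * ga Q K x + (gd P K x + r * gd Q K x) =
    (ga P K x + gd P K x) + r * (ga Q K x + gd Q K x) by ring.
  exact: two_sqr.
have b : sumF V T (fun _ => qB (comb P Q r)) <=
    2 * sumF V T (fun _ => qB P) + 2 * r ^+ 2 * sumF V T (fun _ => qB Q).
  apply: sumF_comb => [i f|i f|i f|i f x]; [exact: qB_continuous hC _|exact: qB_continuous hP _|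
    exact: qB_continuous hQ _|].
  rewrite /qB /comb; have t1 := two_sqr (P 0 f.1 x) (Q 0 f.1 x) r.
  have t2 := two_sqr (P 1 f.1 x) (Q 1 f.1 x) r; apply: le_trans (lerD t1 t2) _.
  by rewrite le_eqVlt; apply/orP; left; apply/eqP; ring.
have c : sumF V T (qN V (comb P Q r)) <= 2 * sumF V T (qN V P) + 2 * r ^+ 2 * sumF V T (qN V Q).
  apply: sumF_comb => [i f|i f|i f|i f x].
  - exact: (qN_continuous (V := V) hC (i := i) (f := f)).
  - exact: (qN_continuous (V := V) hP (i := i) (f := f)).
  - exact: (qN_continuous (V := V) hQ (i := i) (f := f)).
  rewrite /qN /comb.
  have -> : (P 0 f.1 x + r * Q 0 f.1 x) * n1 V i + (P 1 f.1 x + r * Q 1 f.1 x) * n2 V i =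
    (P 0 f.1 x * n1 V i + P 1 f.1 x * n2 V i) + r * (Q 0 f.1 x * n1 V i + Q 1 f.1 x * n2 V i).
    by ring.
  exact: two_sqr.
have hi : 0 <= h^-1 by rewrite invr_ge0 ltW.
have fin (G G1 G2 B B1 B2 D D1 D2 N N1 N2 : R) :
    G <= 2 * G1 + 2 * r ^+ 2 * G2 -> B <= 2 * B1 + 2 * r ^+ 2 * B2 ->
    D <= 2 * D1 + 2 * r ^+ 2 * D2 -> N <= 2 * N1 + 2 * r ^+ 2 * N2 ->
    mu * (G + h^-1 * B) + lam * (D + h^-1 * N) <=
    2 * (mu * (G1 + h^-1 * B1) + lam * (D1 + h^-1 * N1)) +
    2 * r ^+ 2 * (mu * (G2 + h^-1 * B2) + lam * (D2 + h^-1 * N2)).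
  move=> hG hB hD hN; have h1 := ler_wpM2l mu0 (lerD hG (ler_wpM2l hi hB)).
  have h2 := ler_wpM2l lam0 (lerD hD (ler_wpM2l hi hN)).
  apply: le_trans (lerD h1 h2) _.
  by rewrite le_eqVlt; apply/orP; left; apply/eqP; ring.
exact: fin g b d c.
Qed.

Lemma norm2_ge0 h P : 0 <= mu -> 0 <= lam -> 0 < h -> 0 <= norm2 V T mu lam h P.
Proof.
move=> mu0 lam0 h0; have hi : 0 <= h^-1 by rewrite invr_ge0 ltW.
have K0 (q : 'I_n -> R * R -> R) : (forall K x, 0 <= q K x) -> 0 <= sumK T q.
  by move=> q0; apply: sumr_ge0 => K _; apply: Rintegral_ge0 => x _.
have F0 (q : 'I_m -> 'I_n * 'I_3 -> R * R -> R) : (forall i f x, 0 <= q i f x) -> 0 <= sumF V T q.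
  move=> q0; apply: sumr_ge0 => i _; apply: sumr_ge0 => f _; rewrite mulr_ge0 ?sqrtr_ge0//.
  by apply: Rintegral_ge0 => x _.
rewrite /norm2 addr_ge0// mulr_ge0// addr_ge0//.
- by apply: K0 => K x; rewrite /qG !addr_ge0 ?sqr_ge0.
- by rewrite mulr_ge0//; apply: F0 => i f x; rewrite /qB addr_ge0 ?sqr_ge0.
- by apply: K0 => K x; rewrite /qD sqr_ge0.
- by rewrite mulr_ge0//; apply: F0 => i f x; rewrite /qN sqr_ge0.
Qed.

End BilinearForm.

(** * The inf-sup estimate *)

Section ConstantFields.
Context {R : realType} {m : nat} (V : 'I_m -> R * R) (Om : set (R * R)).
Context (hOm : convex_polygonal_domain V Om).
Context {n : nat} (T : 'I_n -> 'I_3 -> R * R) (hT : triangulation Om T).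
Variables (k : nat) (k1 : (1 <= k)%N).

Definition cst_field (c : R) : R * R -> 'cV[R]_2 := fun=> const_mx c.

(** The affine form makes [affine_p2] and [partial_affine] applicable. *)
Definition cst_poly (c : R) : 'I_2 -> 'I_n -> R * R -> R :=
  fun _ _ x => c + 0 * x.1 + 0 * x.2.

Lemma cst_pwfield c : pwfield T k (cst_field c) (cst_poly c).
Proof.
move=> j K; split; first exact: affine_p2.
by move=> x _; rewrite mxE /cst_poly !mul0r !addr0.
Qed.

Lemma cst_Vh c : Vh Om T k (cst_field c).
Proof.
move=> j; split; first exact: (piecewise_H1 hOm hT (cst_pwfield c j)).
move=> K; have [d hd] := affine_poly_on (elt T K) 0 0 c k1; exists d => x Kx.
by rewrite -hd// mxE !mul0r !addr0.
Qed.

Lemma zero_norm mu lam h : norm2 V T mu lam h (cst_poly 0) = 0.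
Proof.
have p0 j K x : partial 0 (cst_poly 0 j K) x = 0 /\ partial 1 (cst_poly 0 j K) x = 0.
  exact: partial_affine.
have v0 j K x : cst_poly 0 j K x = 0 by rewrite /cst_poly !mul0r !addr0.
have K0 q : (forall K x, q K x = 0) -> sumK T q = 0.
  move=> q0; rewrite /sumK big1// => K _.
  have -> : \int[area]_(x in open_elt T K) q K x = \int[area]_(x in open_elt T K) 0.
    by apply: eq_Rintegral => x _; exact: q0.
  by rewrite Rintegral_cst ?mul0r//; exact: measurable_open_elt.
rewrite /norm2 !K0 ?sumF_eq0 ?mulr0 ?addr0 ?mulr0 ?addr0//.
- by move=> i f t _; rewrite /qN !v0 !mul0r addr0 expr0n.
- by move=> i f t _; rewrite /qB !v0 expr0n addr0.
- by move=> K x; rewrite /qD /ga /gd (p0 0 K x).1 ?(p0 1 K x).2 ?(p0 0 K x).2 addr0 expr0n.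
- move=> K x; rewrite /qG /ga /gb /gc /gd (p0 0 K x).1 (p0 0 K x).2 ?(p0 1 K x).1 ?(p0 1 K x).2.
  by rewrite expr0n !addr0.
Qed.

(** The norm only sees the values on the closed domain, where the zero field
    would have zero polynomials. *)
Lemma norm_nonzero u P mu lam h : pwfield T k u P -> 0 < norm2 V T mu lam h P -> nonzero Om u.
Proof.
move=> hP N0; have [//|nz] := pselect (nonzero Om u); exfalso.
have hZ : pwfield T k u (cst_poly 0).
  move=> j K; split; first exact: affine_p2.
  move=> x Kx; have /eqP -> : u x == 0.
    by apply: contra_notT nz => ux; exists x => //; exact: (elt_closure hT Kx).
  by rewrite mxE /cst_poly !mul0r !addr0.
have := triple_normE hOm hT hP mu lam h; rewrite (triple_normE hOm hT hZ) zero_norm sqrtr0.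
by move=> /esym/eqP; rewrite sqrtr_eq0 leNgt N0.
Qed.

End ConstantFields.

Section FinalArithmetic.
Context {R : realType}.
Implicit Types (x y z : R).

Lemma arith_norm x y z : 0 <= z -> 0 <= x * y -> 2 * y + 6 * x * z <= (2 + 6 * x) * (y + z).
Proof. by move=> ? ?; lra. Qed.

Lemma arith_scale (mu lam h x y : R) : 0 < h -> mu / 2 * (h^-1 * x) + lam / 2 * (h^-1 * y) =
  mu / (2 * h) * x + lam / (2 * h) * y.
Proof. by move=> h0; field; rewrite gt_eqF. Qed.

Lemma arith_collect z a1 a2 a3 a4 a5 : z <= a1 + a2 -> 0 <= a3 + a4 -> a5 = 0 ->
  z <= a3 - a5 + a1 + a2 + a4.
Proof. by move=> ? ? ->; lra. Qed.

Lemma arith_up x y z : 0 <= x -> y <= 2 * x + z -> z <= x / 4 -> y <= 4 * x.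
Proof. by move=> ? ? ?; lra. Qed.

Lemma arith_lo x y z : 0 < x -> x <= 2 * y + z -> z <= x / 4 -> 0 < y.
Proof. by move=> ? ? ?; lra. Qed.

Lemma trace_sqr_le (p q r s : R) :
  (p + s) ^+ 2 <= 2 * (p ^+ 2 + q ^+ 2 + r ^+ 2 + s ^+ 2).
Proof. have := sqr_ge0 (p - s); have := sqr_ge0 q; have := sqr_ge0 r; nra. Qed.

Lemma arith_flip x : x < 0 -> 0 <= x + -2 * x.
Proof. by move=> ?; lra. Qed.

Lemma one_sub_two : (1 : R) - 2 != 0.
Proof. by apply/eqP => ?; lra. Qed.

End FinalArithmetic.

Theorem theorem3p5 (R : realType) (c_rho : R) :
  exists n_min : nat,
  forall (n_max : nat) (c_qu c_1 c_2 : R) (hc_1 : 0 < c_1)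
    (m : nat) (V : 'I_m -> R * R) (Om : set (R * R))
    (hOm : convex_polygonal_domain V Om)
    (mu lam : R) (hmu : 0 < mu) (hlam : 0 < lam)
    (k : nat) (hk : (1 <= k)%N),
  exists beta h0 : R, [/\ 0 < beta, 0 < h0 &
    forall (n : nat) (T : 'I_n -> 'I_3 -> R * R),
      triangulation Om T -> shape_regular T c_rho -> quasi_uniform T c_qu ->
      patch_assumption V Om T n_min n_max c_1 c_2 ->
      let h := meshsize T in
      h < h0 ->
      forall u, Vh Om T k u ->
        ((beta * triple_norm V Om mu lam h u)%:E <=
         ereal_sup [set (form_A V Om mu lam u v / triple_norm V Om mu lam h v)%:E
                   | v in [set v | Vh Om T k v /\ nonzero Om v]])%E].
Proof.
exists 0%N => n_max c_qu c_1 c_2 hc_1 m V Om hOm mu lam hmu hlam k hk.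
have mu0 := ltW hmu; have lam0 := ltW hlam.
pose cq := disc_ratio c_rho c_qu; have cq0 : 0 < cq := disc_ratio_gt0 c_rho c_qu.
have [CI CI0 hinv] := inverse_mesh k cq0.
have [CK CK0 korn] := korn_boundary hOm.
pose C1 := 3 * (mu + lam) * cq * CI.
pose C2 := 144 * cq ^+ 2 * CI * (cq * (2 + 6 * CI)).
have ml0 : 0 < mu + lam by exact: addr_gt0.
have C10 : 0 < C1 by rewrite /C1 !mulr_gt0.
have C20 : 0 < C2.
  by apply: mulr_gt0; [rewrite !mulr_gt0// exprn_gt0|rewrite mulr_gt0// addr_gt0// mulr_gt0].
have [delta [alpha [C [d0 al0 C0 choice]]]] := test_choice hmu hlam C10 C20 CK0 CI0.
exists (1 / (2 * C)), delta; split => //; first by rewrite divr_gt0// mulr_gt0.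
move=> n T hT hS hQ hp h hd u hu.
have hfat : fat T cq by move=> K; exact: (inscribed_disc hT hS hQ).
have [x0 Omx0] : Om !=set0 by have [[]] := hOm.
have [K0 _] := closure_elt hT (subset_closure Omx0).
have h0 : 0 < h := meshsize_gt0 hfat K0.
have inv := hinv Om n T hT hfat.
have [P hP] := Vh_field hu.
have apex_Om i f : onside V T i f -> Om (apex T f) := apex_interior hOm hT hp.
pose N := norm2 V T mu lam h P.
have N0 : 0 <= N by exact: norm2_ge0.
rewrite (triple_normE hOm hT hP) -/N.
have attained v : Vh Om T k v -> nonzero Om v ->
    1 / (2 * C) * Num.sqrt N <= form_A V Om mu lam u v / triple_norm V Om mu lam h v ->
    ((1 / (2 * C) * Num.sqrt N)%:E <=
      ereal_sup [set (form_A V Om mu lam u v / triple_norm V Om mu lam h v)%:E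
                   | v in [set v | Vh Om T k v /\ nonzero Om v]])%E.
  move=> hv nv le; apply: (@le_trans _ _ (form_A V Om mu lam u v / triple_norm V Om mu lam h v)%:E).
    by rewrite lee_fin.
  by apply: ereal_sup_ubound; exists v.
(* if [u] has norm zero, a nonnegative quotient suffices: one of two opposite
   constant fields has it *)
have [Nz|Npos] := eqVneq N 0.
  have hC := cst_pwfield T hk 1; have C'0 := cst_Vh hOm hT hk 1.
  have good v Q : pwfield T k v Q -> Vh Om T k v -> nonzero Om v -> 0 <= form_poly V T mu lam P Q ->
      ((1 / (2 * C) * Num.sqrt N)%:E <=
      ereal_sup [set (form_A V Om mu lam u v / triple_norm V Om mu lam h v)%:E
                   | v in [set v | Vh Om T k v /\ nonzero Om v]])%E.
    move=> hQ' hv nv A0; apply: (attained v) => //.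
    by rewrite Nz sqrtr0 mulr0 (form_AE hOm hT _ _ hP hQ') divr_ge0// sqrtr_ge0.
  have [A0|A0] := lerP 0 (form_poly V T mu lam P (cst_poly 1)).
    apply: (good _ _ hC C'0 _ A0); exists x0; first exact: subset_closure.
    by apply/eqP => /matrixP/(_ 0 0); rewrite !mxE => /eqP; rewrite oner_eq0.
  apply: (good _ _ (field_comb (-2) hC hC) (Vh_comb hOm hT (-2) C'0 C'0)).
    exists x0; first exact: subset_closure.
    apply/eqP => /matrixP/(_ 0 0); rewrite !mxE mulr1 => H.
    by move: H => /eqP; rewrite -[_ == _]negbK one_sub_two.
  rewrite (form_poly_comb V hT _ _ (-2) hP hC hC); move: A0.
  exact: arith_flip.
have {}Npos : 0 < N by rewrite lt_neqAle eq_sym Npos.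
pose W := nodal_value V T u; pose w := hatw T W; pose Q := hatQ T W.
have hw : pwfield T k w Q := test_field V hT hk u.
have Vw : Vh Om T k w.
  move=> j; split; first exact: (piecewise_H1 hOm hT (hw j)).
  by move=> K; exact: (hatw_poly hT).
have [bB bN bP] := test_boundary hOm hT u P apex_Om mu lam.
pose v x := u x + alpha *: w x.
have hv : pwfield T k v (comb P Q alpha) := @field_comb _ _ _ _ _ _ _ _ alpha hP hw.
have Vv : Vh Om T k v := Vh_comb hOm hT alpha hu Vw.
pose E := sumK T (qE P); pose D := sumK T (qD P); pose G := sumK T (qG P).
pose B := sumF V T (fun _ => qB P); pose BN := sumF V T (qN V P).
pose NQ := norm2 V T mu lam h Q.
have K_ge0 (q : 'I_n -> R * R -> R) : (forall K x, 0 <= q K x) -> 0 <= sumK T q.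
  by move=> q0; apply: sumr_ge0 => K _; apply: Rintegral_ge0 => x _.
have E0 : 0 <= E by apply: K_ge0; exact: qE_ge0.
have D0 : 0 <= D by apply: K_ge0 => K x; exact: sqr_ge0.
have G0 : 0 <= G by apply: K_ge0; exact: qG_ge0.
have F_ge0 (q : 'I_m -> 'I_n * 'I_3 -> R * R -> R) : (forall i f x, 0 <= q i f x) -> 0 <= sumF V T q.
  move=> q0; apply: sumr_ge0 => i _; apply: sumr_ge0 => f _; rewrite mulr_ge0 ?sqrtr_ge0//.
  by apply: Rintegral_ge0 => x _.
have hi : 0 < h^-1 by rewrite invr_gt0.
have b0 : 0 <= h^-1 * B.
  by rewrite mulr_ge0 ?(ltW hi)//; apply: F_ge0 => i f x; rewrite /qB addr_ge0 ?sqr_ge0.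
have n0 : 0 <= h^-1 * BN.
  by rewrite mulr_ge0 ?(ltW hi)//; apply: F_ge0 => i f x; exact: sqr_ge0.
(* Korn with [tau = delta / h]; this is at least one because [h < delta] *)
have H1 : G <= 2 * E + CK * (delta * (h^-1 * B) + 3 * CI * E / delta).
  have t1 : 1 <= delta / h by rewrite ler_pdivlMr// mul1r ltW.
  apply: le_trans (korn n T hT k u P hP _ t1) _; rewrite lerD2l ler_pM2l//.
  have cB : forall (i : 'I_m) f, continuous (qB P f) := fun _ f => qB_continuous hP (f := f).
  have cE : forall (i : 'I_m) (f : 'I_n * 'I_3), continuous (qE P f.1) :=
    fun _ f => qE_continuous hP (K := f.1).
  have c1 (i : 'I_m) f : continuous (fun x => delta / h * qB P f x) := ct_mul (@ct_cst _ _ _) (cB i f).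
  have c2 (i : 'I_m) f : continuous (fun x => (delta / h)^-1 * qE P f.1 x) :=
    ct_mul (@ct_cst _ _ _) (cE i f).
  rewrite -[leLHS](sumF_add V T c1 c2) -(sumF_scale V T (delta / h) cB) -(sumF_scale V T _ cE).
  apply: lerD; first by rewrite /B mulrA.
  have bs := boundary_strain hOm hT cq0 CI0 hfat inv hP h0.
  by rewrite invf_div mulrAC ler_pM2r ?invr_gt0.
have H2 : sumK T (qG Q) <= C2 * (h^-1 * B + G).
  have B0 : 0 <= B by rewrite -(pmulr_rge0 _ hi).
  rewrite -(ler_pM2l h0); apply: le_trans (test_norm hOm hT cq0 CI0 hfat hk inv hP h0) _.
  rewrite -/h -/B -/G.
  have -> : h * (C2 * (h^-1 * B + G)) = 144 * cq ^+ 2 * CI * (cq * ((2 + 6 * CI) * (B + h * G))).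
    by rewrite /C2; field; rewrite gt_eqF.
  have le : 2 * B + 6 * CI * h * G <= (2 + 6 * CI) * (B + h * G).
    rewrite -[6 * CI * h * G]mulrA; apply: arith_norm.
      exact: mulr_ge0 (ltW h0) G0.
    exact: mulr_ge0 (ltW CI0) B0.
  apply: ler_wpM2l.
    by apply: mulr_ge0; [apply: mulr_ge0; rewrite ?sqr_ge0|exact: ltW].
  by rewrite ler_pM2l.
have H3 (s : R) : 0 < s -> mu / 2 * (h^-1 * B) + lam / 2 * (h^-1 * BN) <=
    form_poly V T mu lam P Q + C1 * G + (mu + lam) * (s^-1 * E + s * sumK T (qG Q)).
  move=> s0; have p := penalty_bound hOm hT cq0 CI0 hfat hk inv hP apex_Om h0 mu0 lam0.
  have a := form_a_lower hT hP hw s0 mu0 lam0.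
  have -> : mu / 2 * (h^-1 * B) + lam / 2 * (h^-1 * BN) =
      mu / (2 * h) * B + lam / (2 * h) * BN by exact: arith_scale.
  exact: arith_collect p a bP.
have H4 : NQ <= (mu + 2 * lam) * sumK T (qG Q).
  have cG K := qG_continuous hw (K := K).
  have dg : sumK T (qD Q) <= 2 * sumK T (qG Q).
    rewrite (sumK_scale hT 2 cG); apply: (sumK_le hT) => [K|K|K x _].
    - exact: qD_continuous hw.
    - exact: (ct_mul (@ct_cst _ _ 2) (cG K)).
    - rewrite /qD /qG; move: (ga Q K x) (gb Q K x) (gc Q K x) (gd Q K x) => p q r s.
      exact: trace_sqr_le.
  have vanish (p q x y : R) : x = 0 -> y = 0 ->
      mu * (p + h^-1 * x) + lam * (q + h^-1 * y) = mu * p + lam * q.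
    by move=> -> ->; rewrite !mulr0 !addr0.
  have -> : NQ = mu * sumK T (qG Q) + lam * sumK T (qD Q) := vanish _ _ _ _ bB bN.
  by rewrite mulrDl lerD2l [2 * lam]mulrC -mulrA ler_wpM2l.
have [key1 key2] := choice E D G _ _ _ _ NQ E0 D0 G0 b0 n0 H1 H2 H3 H4.
have NE : N = mu * (G + h^-1 * B) + lam * (D + h^-1 * BN) by [].
rewrite -NE in key1 key2.
have form : form_A V Om mu lam u v = 2 * mu * E + lam * D + alpha * form_poly V T mu lam P Q.
  by rewrite (form_AE hOm hT _ _ hP hv) (form_poly_comb V hT _ _ alpha hP hP hw) (form_poly_diag V hT _ _ hP).
rewrite -form in key1.
pose Nv := norm2 V T mu lam h (comb P Q alpha).
have up : Nv <= 4 * N.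
  have := norm2_comb V hT alpha hP hw mu0 lam0 h0; rewrite -/N -/NQ -/Nv.
  by move=> nc; exact: arith_up N0 nc key2.
have lo : 0 < Nv.
  (* [u] is itself a combination of the test field and [w] *)
  have back : comb (comb P Q alpha) Q (- alpha) = P.
    apply/funext => j; apply/funext => K; apply/funext => x; rewrite /comb mulNr.
    by rewrite addrK.
  have := norm2_comb V hT (- alpha) hv hw mu0 lam0 h0; rewrite back sqrrN -/N -/NQ -/Nv.
  by move=> nc; exact: arith_lo Npos nc key2.
apply: (attained v Vv (norm_nonzero hOm hT hk hv lo)).
rewrite (triple_normE hOm hT hv) -/Nv ler_pdivlMr ?sqrtr_gt0//.
have sN : Num.sqrt Nv <= 2 * Num.sqrt N.
  apply: le_trans (_ : Num.sqrt (2 ^+ 2 * N) <= _).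
    by rewrite ler_sqrt ?mulr_ge0 ?sqr_ge0// (_ : 2 ^+ 2 = 4)//; rewrite -natrX.
  by rewrite sqrtrM ?sqr_ge0// sqrtr_sqr ger0_norm.
have b1 : 0 <= 1 / (2 * C) * Num.sqrt N.
  by rewrite mulr_ge0 ?sqrtr_ge0// divr_ge0// mulr_ge0// ltW.
apply: le_trans (ler_wpM2l b1 sN) _.
have -> : 1 / (2 * C) * Num.sqrt N * (2 * Num.sqrt N) = C^-1 * Num.sqrt N ^+ 2.
  by field; rewrite gt_eqF.
by rewrite sqr_sqrtr// ler_pdivrMl.
Qed.
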